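(* Let $\omega$ be a non-quasianalytic weight function and $f\in C^\infty(\mathbb{R}^N)$. Then the following properties are equivalent. (1) $f\in \mathcal{O}_{M,\omega}(\mathbb{R}^N)$. (2) For every $g\in \mathcal{S}_\omega(\mathbb{R}^N)$ we have $fg\in \mathcal{S}_{\omega}(\mathbb{R}^N)$. Moreover, if $f\in\mathcal{O}_{M,\omega}(\mathbb{R}^N)$, then the linear operator $M_f\colon \mathcal{S}_{\omega}(\mathbb{R}^N)\to\mathcal{S}_{\omega}(\mathbb{R}^N)$ defined by $M_f(g):=fg$ for $g\in\mathcal{S}_{\omega}(\mathbb{R}^N)$ is continuous.
   Context: A non-quasianalytic weight function is a continuous increasing function $\omega:[0,\infty)\to[0,\infty)$ such that: $(\alpha)$ there is $K\geq 1$ with $\omega(2t)\leq K(1+\omega(t))$ for all $t\geq 0$; $(\beta)$ $\int_1^\infty \frac{\omega(t)}{1+t^2}\,dt<\infty$; $(\gamma)$ there are $a\in\mathbb{R}$, $b>0$ with $\omega(t)\geq a+b\log(1+t)$ for all $t\geq 0$; $(\delta)$ $\varphi_\omega(t)=\omega(e^t)$ is convex. Standing normalization: $\omega$ vanishes on $[0,1]$. For $x\in\mathbb{R}^N$ put $\omega(x):=\omega(|x|)$ with $|\cdot|$ the Euclidean norm. The Young conjugate is $\varphi^*_\omega(s):=\sup_{t\geq 0}\{st-\varphi_\omega(t)\}\ge 0$, $s\geq 0$; the value $+\infty$ is allowed, with $\exp(-\infty)=0$ and $\exp(+\infty)=+\infty$. Functions are complex-valued, $\mathbb{N}=\{1,2,\dots\}$,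 $\mathbb{N}_0=\mathbb{N}\cup\{0\}$. $\mathcal{S}_\omega(\mathbb{R}^N)$ is the set of $f\in L^1(\mathbb{R}^N)$ with $f,\hat f\in C^\infty(\mathbb{R}^N)$ and $\|\exp(\lambda\omega)\partial^\alpha f\|_\infty<\infty$, $\|\exp(\lambda\omega)\partial^\alpha \hat f\|_\infty<\infty$ for all $\lambda>0$, $\alpha\in\mathbb{N}_0^N$. Equivalently (known), it is the set of $f\in C^\infty(\mathbb{R}^N)$ with $q_{\lambda,\mu}(f):=\sup_{\alpha\in\mathbb{N}_0^N}\sup_{x\in\mathbb{R}^N}\exp\left(-\lambda\varphi^*_\omega(|\alpha|/\lambda)\right)\exp(\mu\omega(x))|\partial^\alpha f(x)|<\infty$ for all $\lambda,\mu>0$. Its Fréchet topology is generated by the norms $q_{m,n}$, $m,n\in\mathbb{N}$. $\mathcal{O}_{M,\omega}(\mathbb{R}^N)$ is the set of all $f\in C^\infty(\mathbb{R}^N)$ such that for each $m\in\mathbb{N}$ there exist $C>0$ and $n\in\mathbb{N}$ with $|\partial^\alpha f(x)|\leq C\exp\left(n\omega(x)+m\varphi^*_\omega(|\alpha|/m)\right)$ for all $\alpha\in\mathbb{N}_0^N$, $x\in\mathbb{R}^N$. *)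

(* Defs.v *)
From HB Require Import structures.
From mathcomp Require Import all_boot all_order all_algebra.
From mathcomp Require Import all_classical all_reals all_analysis.
From mathcomp Require Import complex.

Set Implicit Arguments.
Unset Strict Implicit.
Unset Printing Implicit Defensive.

Import Order.TTheory GRing.Theory Num.Theory.
Import numFieldNormedType.Exports.

Local Open Scope classical_set_scope.
Local Open Scope ring_scope.
Local Open Scope complex_scope.

(* A weight is encoded as a total function on R, of which only the values on
   [0, +oo[ are constrained and used. "Increasing" is taken in the weak sense,
   since weights vanish on [0, 1]. *)
Record nonquasianalytic_weight (R : realType) (w : R -> R) : Prop := {
  weight_continuous : {within `[0, +oo[, continuous w} ;
  weight_increasing : {in `[0, +oo[ &, {homo w : s t / s <= t}} ;
  weight_ge0 : forall t : R, 0 <= t -> 0 <= w t ;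
  weight_alpha : exists2 K : R, 1 <= K &
    forall t : R, 0 <= t -> w (2 * t) <= K * (1 + w t) ;
  weight_beta : (\int[lebesgue_measure]_(t in `[1%R, +oo[)
    (w t / (1 + t ^+ 2))%:E < +oo)%E ;
  weight_gamma : exists (a b : R), 0 < b /\
    forall t : R, 0 <= t -> a + b * ln (1 + t) <= w t ;
  weight_delta : @convex_function R R^o setT (fun t => w (expR t)) ;
  weight_normalized : forall t : R, 0 <= t <= 1 -> w t = 0
}.

Definition young_conj (R : realType) (w : R -> R) (s : R) : \bar R :=
  ereal_sup [set (s * t - w (expR t))%:E | t in `[0, +oo[].

Section euclidean_space.
Context {R : realType} {N : nat}.
Implicit Types (f : 'rV[R]_N -> R[i]) (x y : 'rV[R]_N).

Definition dotp x y : R := \sum_(j < N) x 0 j * y 0 j.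

(* the library norm on 'rV[R]_N is the sup norm, hence this definition *)
Definition enorm x : R := Num.sqrt (dotp x x).

Definition cRe f : 'rV[R]_N -> R := fun x => complex.Re (f x).
Definition cIm f : 'rV[R]_N -> R := fun x => complex.Im (f x).

Definition partial (j : 'I_N) f : 'rV[R]_N -> R[i] := fun x =>
  'D_(delta_mx 0 j) (cRe f) x +i* 'D_(delta_mx 0 j) (cIm f) x.

Definition partially_derivable f := forall (j : 'I_N) x,
  derivable (cRe f) x (delta_mx 0 j) /\ derivable (cIm f) x (delta_mx 0 j).

Fixpoint Ck (k : nat) f : Prop :=
  [/\ continuous (cRe f), continuous (cIm f) &
      if k is k'.+1 then
        partially_derivable f /\ forall j, Ck k' (partial j f)
      else True].

Definition smooth f := forall k, Ck k f.

(* on smooth functions the order of differentiation is immaterial *)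
Definition dmulti (alpha : {ffun 'I_N -> nat}) f : 'rV[R]_N -> R[i] :=
  foldr (fun j g => iter (alpha j) (partial j) g) f (enum 'I_N).

Definition mlen (alpha : {ffun 'I_N -> nat}) : nat := (\sum_(j < N) alpha j)%N.

End euclidean_space.

Section lebesgue_cons.
Context {R : realType} {n : nat}.
Local Notation T := (measurableTypeR R).
Variable mu : {sigma_finite_measure set (n.-tuple T) -> \bar R}.

Let cons_pair (p : T * n.-tuple T) : n.+1.-tuple T := [tuple of p.1 :: p.2].

Let uncons (t : n.+1.-tuple T) : T * n.-tuple T := (thead t, [tuple of behead t]).

Let mcons : measurable_fun [set: T * n.-tuple T] cons_pair.
Proof. exact: measurable_cons. Qed.

Let muncons : measurable_fun [set: n.+1.-tuple T] uncons.
Proof.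
apply: measurable_fun_pair; last exact: measurable_behead.
exact: (measurable_tnth ord0).
Qed.

Definition lebesgue_cons : set (n.+1.-tuple T) -> \bar R :=
  pushforward (lebesgue_measure \x mu)%E cons_pair.

Let lc0 : lebesgue_cons set0 = 0%E.
Proof. by rewrite /lebesgue_cons /pushforward preimage_set0 measure0. Qed.

Let lc_ge0 A : (0 <= lebesgue_cons A)%E.
Proof. exact: measure_ge0. Qed.

Let lc_sigma_additive : semi_sigma_additive lebesgue_cons.
Proof.
move=> F mF tF mUF; rewrite /lebesgue_cons /pushforward preimage_bigcup.
apply: measure_semi_sigma_additive.
- by move=> k; rewrite -[X in measurable X]setTI; exact: mcons.
- apply/trivIsetP => /= i j _ _ ij; rewrite -preimage_setI.
  by move/trivIsetP : tF => /(_ _ _ _ _ ij) ->//; rewrite preimage_set0.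
- by rewrite -preimage_bigcup -[X in measurable X]setTI; exact: mcons.
Qed.

HB.instance Definition _ := isMeasure.Build _ _ _ lebesgue_cons
  lc0 lc_ge0 lc_sigma_additive.

Let lc_sigma_finite : sigma_finite setT lebesgue_cons.
Proof.
have /sigma_finiteP[F [FT ndF Foo]] := sigma_finiteT (@lebesgue_measure R).
have /sigma_finiteP[G [GT ndG Goo]] := sigma_finiteT mu.
exists (fun k => uncons @^-1` (F k `*` G k)) => [|k].
  rewrite -preimage_bigcup (_ : \bigcup_k _ = setT) ?preimage_setT//.
  rewrite -subTset => -[x t] _.
  have [i _ Fix] : (\bigcup_i F i) x by rewrite -FT.
  have [j _ Gjt] : (\bigcup_i G i) t by rewrite -GT.
  exists (maxn i j) => //; split.
  - by move: x Fix; exact/subsetPset/ndF/leq_maxl.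
  - by move: t Gjt; exact/subsetPset/ndG/leq_maxr.
have [mF Fk] := Foo k; have [mG Gk] := Goo k; split.
  by rewrite -[X in measurable X]setTI; apply: muncons => //; exact: measurableX.
rewrite /lebesgue_cons /pushforward -comp_preimage.
rewrite (_ : uncons \o cons_pair = id).
  by rewrite preimage_id product_measure1E// lte_mul_pinfty// ge0_fin_numE.
by apply/funext => -[x t]; congr pair; exact: val_inj.
Qed.

HB.instance Definition _ := Measure_isSigmaFinite.Build _ _ _ lebesgue_cons
  lc_sigma_finite.

End lebesgue_cons.

Section dirac_nil.
Context {R : realType}.
Local Notation T := (0.-tuple (measurableTypeR R)).

Definition lebesgue_nil : set T -> \bar R := \d_([tuple] : T).
HB.instance Definition _ := Measure.on lebesgue_nil.

Let ln_sigma_finite : sigma_finite setT lebesgue_nil.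
Proof.
apply: fin_num_fun_sigma_finite; first by rewrite measure0.
by move=> A mA; rewrite /lebesgue_nil diracE.
Qed.

HB.instance Definition _ := Measure_isSigmaFinite.Build _ _ _ lebesgue_nil
  ln_sigma_finite.
End dirac_nil.

(* Lebesgue measure on R^n, as the n-fold product of lebesgue_measure on the
   product sigma-algebra of n-tuples (the unit mass at the empty tuple if
   n = 0). *)
Fixpoint lebesgue_Rn (R : realType) (n : nat) :
    {sigma_finite_measure set (n.-tuple (measurableTypeR R)) -> \bar R} :=
  if n is n'.+1 then
    [the {sigma_finite_measure set _ -> \bar R} of
      lebesgue_cons (lebesgue_Rn R n')]
  else [the {sigma_finite_measure set _ -> \bar R} of lebesgue_nil].

Section S_omega.
Context {R : realType} {N : nat}.
Implicit Types (f g : 'rV[R]_N -> R[i]) (w : R -> R).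

Definition vec_of_tuple (t : N.-tuple (measurableTypeR R)) : 'rV[R]_N :=
  \row_j tnth t j.

Definition L1 f : Prop :=
  (lebesgue_Rn R N).-integrable setT (fun t => (cRe f (vec_of_tuple t))%:E) /\
  (lebesgue_Rn R N).-integrable setT (fun t => (cIm f (vec_of_tuple t))%:E).

Definition cintegral f : R[i] :=
  Rintegral (lebesgue_Rn R N) setT (fun t => cRe f (vec_of_tuple t)) +i*
  Rintegral (lebesgue_Rn R N) setT (fun t => cIm f (vec_of_tuple t)).

(* the convention F f (xi) = \int f(x) exp(- i <x, xi>) dx; other
   normalizations define the same space S_omega *)
Definition fourier f : 'rV[R]_N -> R[i] := fun xi =>
  cintegral (fun x => f x * (cos (dotp x xi) -i* sin (dotp x xi))).

Definition cmod (z : R[i]) : R := Normc.normc z.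

Definition weighted_sup_norm w (lambda : R) f : \bar R :=
  ereal_sup [set (expR (lambda * w (enorm x)) * cmod (f x))%:E
            | x in [set: 'rV[R]_N]].

Definition S_omega w f : Prop :=
  [/\ L1 f, smooth f, smooth (fourier f) &
    forall (lambda : R) (alpha : {ffun 'I_N -> nat}), 0 < lambda ->
      (weighted_sup_norm w lambda (dmulti alpha f) < +oo)%E /\
      (weighted_sup_norm w lambda (dmulti alpha (fourier f)) < +oo)%E].

(* the suprema are taken in \bar R: expeR (- +oo) = 0 and expeR +oo = +oo *)
Definition q_norm w (lambda mu : R) f : \bar R :=
  ereal_sup [set
    (expeR (- (lambda%:E * young_conj w ((mlen ax.1)%:R / lambda)%R)) *
     (expR (mu * w (enorm ax.2)) * cmod (dmulti ax.1 f ax.2))%:E)%E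
  | ax in [set: {ffun 'I_N -> nat} * 'rV[R]_N]].

Definition O_M_omega w f : Prop :=
  smooth f /\
  forall m : nat, (0 < m)%N -> exists (C : R) (n : nat),
    [/\ 0 < C, (0 < n)%N &
      forall (alpha : {ffun 'I_N -> nat}) (x : 'rV[R]_N),
        ((cmod (dmulti alpha f x))%:E <=
         C%:E * expeR ((n%:R * w (enorm x))%:E +
           m%:R%:E * young_conj w ((mlen alpha)%:R / m%:R)%R))%E].

Definition mulop f g : 'rV[R]_N -> R[i] := fun x => f x * g x.

End S_omega.

Definition S_space (R : realType) (N : nat) (w : R -> R) : Type :=
  {f : 'rV[R]_N -> R[i] | S_omega w f}.

Section S_space_topology.
Context {R : realType} {N : nat} {w : R -> R}.
Local Notation S := (S_space N w).

HB.instance Definition _ := gen_eqMixin S.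
HB.instance Definition _ := gen_choiceMixin S.

Definition q_ball (m n : nat) (e : R) (g : S) : set S :=
  [set h : S |
    (q_norm w m%:R n%:R (fun x => sval h x - sval g x)%R < e%:E)%E].

Definition q_subbase : set (set S) :=
  [set U | exists m n e g,
    [/\ (0 < m)%N, (0 < n)%N, 0 < e & U = q_ball m n e g]].

HB.instance Definition _ := @isSubBaseTopological.Build S (set S) q_subbase id.

End S_space_topology.

(* Main.v *)
(* Write [E_l(k) = exp (l phi^*(k / l)) = sup_{r >= 1} r^k exp (- l w r)].

   S_omega is characterised by derivatives alone: a smooth [g] is in S_omega
   iff for all [l, m] the derivatives of order [k] are bounded by
   [C E_l(k) exp (- m w)].  If these bounds hold, optimising over the order of
   differentiation bounds the Fourier transform of [g], and multiplication by
   coordinates preserves them.  Conversely, Fourier inversion turns the decay of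
   the Fourier transform into bounds on derivatives without decay in space;
   applied to [g] times a window [prod_j sech (x_j - p_j)], whose Fourier transform
   is small both in [p] and in the frequency, it gives the decay at [p],
   since multiplying back by [prod_j cosh (x_j - p_j)] is harmless there.
   Inversion is only needed as an inequality, obtained by integrating [F g]
   against a damped exponential and letting the Poisson kernel concentrate.

   The product rule and [E_l(i) E_l(j) <= E_l(i + j)] show that f in O_M,omega
   multiplies this space continuously.  If f is not in O_M,omega, some
   derivatives of f at points [x_k] exceed [C_k exp (n_k w(x_k)) E_l] with
   [C_k, n_k] tending to infinity.  Take [g = prod_j gamma_j] where [gamma_j] is
   the sum over [k] of [2^-k exp (- k w(x_k)) sech (. - x_{k,j})].  Derivatives of
   order [i] of [gamma_j] and of [1 / gamma_j] are at most [C^i i!] times the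
   function itself, so [g] is in S_omega, and if [f g] were in S_omega then
   [f = (f g) (1 / g)] would have derivatives too small at [x_k]. *)

(* Two obstacles shape the estimates. Derivatives are indexed by nondecreasing words of coordinates:
   [dmulti] differentiates in a fixed order, subwords of nondecreasing words are nondecreasing, and
   so the product rule stays inside this class without any interchange of partial derivatives. The
   [2 ^ k] terms of the product rule are absorbed by replacing [r] with [2 r] in the supremum; by
   (alpha) this multiplies [l] by a constant. Condition (beta) enters as [w t = o(t)], with two
   effects: [A ^ k k!] is at most a constant times [E_l(k)] for every [l], so that analytic
   functions with factorial bounds are admissible, and [exp (- |s|)] is at most a constant times
   [exp (- m w s)] for every [m]. Windows such as sech are preferred to compactly supported cutoffs
   because they have no zeros: one can divide by them. *)
Require Import Defs.
From HB Require Import structures.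
From mathcomp Require Import all_boot all_order all_algebra.
From mathcomp Require Import all_classical all_reals all_analysis.
From mathcomp Require Import measurable_realfun complex ring lra.

Set Implicit Arguments.
Unset Strict Implicit.
Unset Printing Implicit Defensive.

Import Order.TTheory GRing.Theory Num.Theory.
Import numFieldNormedType.Exports.

Local Open Scope classical_set_scope.
Local Open Scope ring_scope.
Local Open Scope complex_scope.

(** * Weight functions and their Young conjugates *)

Section weight_calculus.
Context {R : realType} {w : R -> R}.
Hypothesis hw : nonquasianalytic_weight w.
Implicit Types (l m r s t : R) (k : nat) (M : R).

Lemma weight_le s t : 0 <= s -> s <= t -> w s <= w t.
Proof.
move=> s0 st; apply: (weight_increasing hw) => //.
- by rewrite in_itv /= andbT.
- by rewrite in_itv /= andbT (le_trans s0).
Qed.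

Lemma weight1 : w 1 = 0.
Proof. by apply: (weight_normalized hw); rewrite ler01 lexx. Qed.

(** Since [n < 2 ^ n], doubling the argument [n] times more than covers the factor [n]. *)
Lemma weight_scale (n : nat) : exists2 L : R, 1 <= L &
  forall t, 0 <= t -> w (n%:R * t) <= L * (1 + w t).
Proof.
have [K K1 hK] := weight_alpha hw.
have pow (p : nat) : exists2 L : R, 1 <= L &
    forall t, 0 <= t -> w (2 ^+ p * t) <= L * (1 + w t).
  elim: p => [|p [L L1 hL]].
    exists 1 => // t t0; rewrite expr0 !mul1r; lra.
  exists (K * (1 + L)) => [|t t0]; first by nra.
  rewrite exprS -mulrA.
  have t0' : 0 <= 2 ^+ p * t by rewrite mulr_ge0 // exprn_ge0.
  have := hK _ t0'; have := hL _ t0; have := weight_ge0 hw t0.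
  move=> h1 h2 h3; nra.
have [L L1 hL] := pow n; exists L => // t t0.
apply: (le_trans _ (hL t t0)); apply: weight_le.
  by rewrite mulr_ge0.
rewrite ler_wpM2r // -natrX ler_nat; exact/ltnW/ltn_expl.
Qed.

(** The sum is at most twice the larger argument, so one doubling suffices. *)
Lemma weight_add : exists2 K : R, 1 <= K &
  forall s t, 0 <= s -> 0 <= t -> w (s + t) <= K * (1 + w s + w t).
Proof.
have [K K1 hK] := weight_alpha hw; exists K => // s t s0 t0.
wlog st : s t s0 t0 / s <= t.
  move=> h; case: (leP s t) => [|/ltW] st; first exact: h.
  by rewrite addrC -addrA (addrC (w s)) addrA; exact: h.
have : w (s + t) <= w (2 * t) by apply: weight_le; [rewrite addr_ge0|lra].
have := hK t t0; have := weight_ge0 hw s0; have := weight_ge0 hw t0; nra.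
Qed.

(** The exponentiated form of (gamma): through it, polynomial factors are paid for by exponential
    weights. *)
Lemma weight_log : exists b : R, 0 < b /\ exists2 C : R, 1 <= C &
  forall t, 0 <= t -> 1 + t <= C * expR (b * w t).
Proof.
have [a [b [b0 hab]]] := weight_gamma hw.
exists b^-1; split; first by rewrite invr_gt0.
exists (expR (`|a| / b)) => [|t t0].
  by rewrite -expR0 ler_expR divr_ge0 // ltW.
rewrite -expRD -(@lnK _ (1 + t)); last by rewrite posrE; lra.
rewrite ler_expR (mulrC b^-1) -mulrDl ler_pdivlMr // mulrC.
have := hab t t0; have := ler_norm (- a); rewrite normrN; lra.
Qed.

Lemma weight_expr (n : nat) : exists b : R, 0 < b /\ exists2 C : R, 1 <= C &
  forall t, 0 <= t -> (1 + t) ^+ n <= C * expR (b * w t).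
Proof.
have [b [b0 [C C1 h]]] := weight_log.
(* The successor keeps the exponent positive for [n = 0]. *)
exists (b * n.+1%:R); split; first by rewrite mulr_gt0.
exists (C ^+ n) => [|t t0]; first by rewrite exprn_ege1.
apply: (@le_trans _ _ ((C * expR (b * w t)) ^+ n)).
  by rewrite lerXn2r ?nnegrE ?h ?addr_ge0 // mulr_ge0 ?expR_ge0 //; lra.
rewrite exprMn -expRM_natl ler_wpM2l ?exprn_ge0 //; first lra.
rewrite ler_expR mulrCA -mulrA ler_wpM2l ?(ltW b0) //.
by rewrite ler_wpM2r ?ler_nat // (weight_ge0 hw).
Qed.

Let mu := @lebesgue_measure R.

(* Monotonicity gives [w (2^n) / (5 * 2^n) <= \int_[2^n, 2^(n+1)[ w / (1 + t^2)],
   and these integrals are the terms of a convergent series. *)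
Lemma weight_littleo (e : R) : 0 < e ->
  exists2 C : R, 0 <= C & forall t, 0 <= t -> w t <= e * t + C.
Proof.
move=> e0.
pose f t := w t / (1 + t ^+ 2).
have pos1 t : 0 < 1 + t ^+ 2 by have := sqr_ge0 t; lra.
have f0 t : 1 <= t -> 0 <= f t.
  move=> t1; apply: divr_ge0; last exact/ltW/pos1.
    by apply: (weight_ge0 hw); lra.
have cf : {within `[1%R, +oo[, continuous f}.
  have cw : {within `[1%R, +oo[, continuous w}.
    apply: (continuous_subspaceW _ (weight_continuous hw)) => x /=.
    rewrite !in_itv /= !andbT; lra.
  move=> x; apply: cvgM; first exact: cw.
  apply: cvgV; first by rewrite gt_eqF.
  have : {within `[1%R, +oo[, continuous (fun t : R => 1 + t ^+ 2)}.
    apply: continuous_subspaceT => y.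
    by apply: cvgD; [exact: cvg_cst|exact: exprn_continuous].
  exact.
have mf : measurable_fun (`[1%R, +oo[ : set (measurableTypeR R)) f.
  apply: subspace_continuous_measurable_fun => //; exact: measurable_itv.
pose I (n : nat) := `[2 ^+ n, 2 ^+ n.+1[%classic : set R.
have p1 n : 1 <= 2 ^+ n :> R by rewrite exprn_ege1 // ler1n.
have IS n : I n `<=` `[1%R, +oo[.
  move=> x; rewrite /I /= !in_itv /= => /andP[+ _]; rewrite andbT.
  exact: le_trans.
have tI : trivIset setT I.
  apply: ltn_trivIset => j i ij.
  rewrite -subset0 => x; rewrite /I /= !in_itv /= => -[/andP[_ h1] /andP[h2 _]].
  have : 2 ^+ j <= 2 ^+ j :> R by [].
  have : 2 ^+ i.+1 <= 2 ^+ j :> R by rewrite ler_eXn2l // ltr1n.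
  lra.
have mI n : measurable (I n) by exact: measurable_itv.
have lowI n : ((w (2 ^+ n) / (5 * 2 ^+ n))%:E <= \int[mu]_(t in I n) (f t)%:E)%E.
  have q0 : 0 < 2 ^+ n :> R by exact: lt_le_trans (p1 n).
  (* On [I n] the numerator is at least [w (2 ^+ n)] and the denominator at most [5 * 4 ^ n]; the
     interval has length [2 ^ n]. *)
  pose c := w (2 ^+ n) / (5 * 2 ^+ n * 2 ^+ n).
  have -> : (w (2 ^+ n) / (5 * 2 ^+ n))%:E = (\int[mu]_(t in I n) c%:E)%E.
    rewrite integral_cst; last exact: mI.
    have E : lebesgue_measure (I n) = (2 ^+ n.+1 - 2 ^+ n)%:E.
      rewrite -[LHS]/(lebesgue_measure `[2 ^+ n, 2 ^+ n.+1[%classic).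
      rewrite lebesgue_measure_itv /= lte_fin.
      by have -> : 2 ^+ n < 2 ^+ n.+1 :> R by rewrite exprS; lra.
    rewrite [X in (_ * X)%E](_ : _ = lebesgue_measure (I n)) // E.
    by rewrite -EFinM exprS; congr EFin; rewrite /c; field; lra.
  apply: ge0_le_integral; first exact: mI.
  - by move=> x _; rewrite lee_fin divr_ge0 ?(weight_ge0 hw) //; nra.
  - exact: measurable_cst.
  - by apply/measurable_EFinP; apply: measurable_funS mf => //; exact: measurable_itv.
  - move=> x Ix; rewrite lee_fin /f /c; move: Ix; rewrite /I /= in_itv /= => /andP[x1 x2].
    have wx : w (2 ^+ n) <= w x by apply: weight_le => //; exact: ltW.
    have w0 : 0 <= w (2 ^+ n) by apply: (weight_ge0 hw); exact: ltW.
    apply: ler_pM => //.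
    rewrite lef_pV2 ?posrE ?mulr_gt0 //.
    move: q0 x1 x2; rewrite exprS; move: (2 ^+ n) (p1 n) => q q1 q0 x1 x2.
    by rewrite expr2; nra.
have fin n : (\int[mu]_(t in I n) (f t)%:E)%E \is a fin_num.
  rewrite ge0_fin_numE; last by apply: integral_ge0 => x /IS /=; rewrite in_itv /= andbT lee_fin; exact: f0.
  apply: le_lt_trans (weight_beta hw); apply: ge0_subset_integral.
  - exact: mI.
  - exact: measurable_itv.
  - by apply/measurable_EFinP.
  - by move=> x /=; rewrite in_itv /= andbT lee_fin; exact: f0.
  - exact: IS.
pose u n := fine (\int[mu]_(t in I n) (f t)%:E)%E.
have u0 n : 0 <= u n.
  by apply/fine_ge0/integral_ge0 => x /IS /=; rewrite in_itv /= andbT lee_fin; exact: f0.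
have bu : (\sum_(0 <= n <oo) (u n)%:E < +oo)%E.
  under eq_eseriesr do rewrite /u fineK //.
  rewrite (_ : (\sum_(0 <= n <oo) _)%E = \int[mu]_(t in \bigcup_n I n) (f t)%:E)%E; last first.
    apply/esym/ge0_integral_bigcup => //.
    - by apply/measurable_EFinP; apply: measurable_funS mf => //; exact: bigcup_sub.
    - by move=> x [n _ /IS] /=; rewrite in_itv /= andbT lee_fin; exact: f0.
  apply: le_lt_trans (weight_beta hw); apply: ge0_subset_integral.
  - by apply: bigcup_measurable => n _; exact: mI.
  - exact: measurable_itv.
  - by apply/measurable_EFinP.
  - by move=> x /=; rewrite in_itv /= andbT lee_fin; exact: f0.
  - exact: bigcup_sub.
have cu : cvgn (series u).
  apply: nondecreasing_is_cvgn.
    by apply/nondecreasing_seqP => n; rewrite seriesSr lerDl.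
  exists (fine (\sum_(0 <= n <oo) (u n)%:E)%E) => _ [n _ <-].
  rewrite -lee_fin fineK; last first.
    by rewrite ge0_fin_numE //; apply: nneseries_ge0 => *; rewrite lee_fin.
  rewrite /series /= -sumEFin; apply: nneseries_lim_ge => *.
  by rewrite lee_fin.
(* The factor 5 of [lowI] turns [e / 10] into [e / 2], and passing from [t] to the next power of 2
   turns this into [e]. *)
have := cvg_series_cvg_0 cu => /cvgrPdist_lt /(_ (e / 10)).
rewrite divr_gt0 // => /(_ isT) [n0 _ hn0].
have big n : (n0 <= n)%N -> w (2 ^+ n) <= e / 2 * 2 ^+ n.
  move=> /hn0 /=; rewrite sub0r normrN ger0_norm // => h.
  have := lowI n; rewrite -(fineK (fin n)) lee_fin -/(u n).
  have q0 : 0 < 2 ^+ n :> R by exact: lt_le_trans (p1 n).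
  rewrite ler_pdivrMr; last lra.
  nra.
exists (w (2 ^+ n0)) => [|t t0]; first exact/(weight_ge0 hw)/exprn_ge0.
case: (leP t (2 ^+ n0)) => [tn|nt].
  by apply: (le_trans (weight_le t0 tn)); rewrite lerDr mulr_ge0 // ltW.
have [n [n0n nt1 tn2]] : exists n, [/\ (n0 <= n)%N, 2 ^+ n <= t & t <= 2 ^+ n.+1].
  have ex : exists n, t <= 2 ^+ n.
    exists (Num.truncn t).+1; have /andP[_ /ltW h] := truncn_itv t0.
    by apply: (le_trans h); rewrite -natrX ler_nat; exact/ltnW/ltn_expl.
  case: (ex_minnP ex) => -[|n] tn hn.
    have := p1 n0; rewrite expr0 in tn; lra.
  exists n; split => //.
    rewrite leqNgt; apply/negP => h.
    have : 2 ^+ n.+1 <= 2 ^+ n0 :> R by rewrite ler_weXn2l ?ler1n.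
    lra.
  by rewrite leNgt; apply/negP => /ltW /hn; rewrite ltnn.
apply: (@le_trans _ _ (w (2 ^+ n.+1))); first exact: weight_le.
have := big n.+1 (leqW n0n); rewrite exprS.
have := weight_ge0 hw (exprn_ge0 n0 (ler0n R 2)); nra.
Qed.

(* [ub l k M] means [exp (l phi^*(k / l)) <= M], where [phi^*] is the Young
   conjugate of [w]: the exponential is the supremum of the left-hand sides. *)
Definition ub l k M := forall r, 1 <= r -> r ^+ k * expR (- (l * w r)) <= M.

Lemma ub_ge1 l k M : ub l k M -> 1 <= M.
Proof. by move=> /(_ 1 (lexx _)); rewrite expr1n weight1 mulr0 oppr0 expR0 mulr1. Qed.

Lemma ub_le l l' k M : l <= l' -> ub l k M -> ub l' k M.
Proof.
move=> ll' h r r1; apply: le_trans (h r r1).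
rewrite ler_wpM2l ?exprn_ge0 //; first lra.
by rewrite ler_expR lerN2 ler_wpM2r // (weight_ge0 hw) //; lra.
Qed.

Lemma ub0 l : 0 <= l -> ub l 0 1.
Proof.
move=> l0 r r1; rewrite expr0 mul1r -expR0 ler_expR oppr_le0 mulr_ge0 //.
by apply: (weight_ge0 hw); lra.
Qed.

Lemma ub_expr l k M r : 0 <= l -> ub l k M -> 0 <= r -> r ^+ k <= M * expR (l * w r).
Proof.
move=> l0 h r0; case: (leP 1 r) => r1.
  by have := h r r1; rewrite expRN ler_pdivrMr // expR_gt0.
have M1 := ub_ge1 h.
apply: (@le_trans _ _ 1); first by rewrite exprn_ile1 // ltW.
rewrite -[1]mul1r ler_pM // -[leLHS]expR0 ler_expR mulr_ge0 //.
exact: (weight_ge0 hw).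
Qed.

(* The larger of two radii serves both factors. *)
Lemma ub_split l i j M : 0 <= l -> ub l (i + j) M ->
  exists M1 M2, [/\ ub l i M1, ub l j M2 & M1 * M2 <= M].
Proof.
move=> l0 h.
pose A k := [set r ^+ k * expR (- (l * w r)) | r in [set r : R | 1 <= r]].
have hA k : (k <= i + j)%N -> has_sup (A k).
  move=> kij; split.
    by exists (1 ^+ k * expR (- (l * w 1))), 1 => //=.
  exists M => _ [r /= r1 <-]; apply: le_trans (h r r1).
  by rewrite ler_wpM2r ?expR_ge0 // ler_weXn2l.
have hi := hA i (leq_addr _ _); have hj := hA j (leq_addl _ _).
have ubi : ub l i (sup (A i)).
  by move=> r r1; apply: (sup_upper_bound hi); exists r.
have ubj : ub l j (sup (A j)).
  by move=> r r1; apply: (sup_upper_bound hj); exists r.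
(* With the exact suprema as witnesses, it is enough to bound the product of two values at
   independent radii [r] and [s]. *)
exists (sup (A i)), (sup (A j)); split => //.
have i1 := ub_ge1 ubi; have j1 := ub_ge1 ubj.
have M1 := ub_ge1 h.
have key r s : 1 <= r -> 1 <= s ->
    (r ^+ i * expR (- (l * w r))) * (s ^+ j * expR (- (l * w s))) <= M.
  move=> r1 s1.
  have er t : 1 <= t -> 0 <= expR (- (l * w t)) <= 1.
    move=> t1; rewrite expR_ge0 /= -expR0 ler_expR oppr_le0 mulr_ge0 //.
    by apply: (weight_ge0 hw); lra.
  have /andP[er0 er1] := er r r1; have /andP[es0 es1] := er s s1.
  have ri : 0 <= r ^+ i by rewrite exprn_ge0 //; lra.
  have sj : 0 <= s ^+ j by rewrite exprn_ge0 //; lra.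
  case: (leP r s) => [rs|/ltW sr].
    apply: le_trans (h s s1); rewrite exprD -mulrA (mulrA (expR _)).
    rewrite (mulrC (expR _)) -!mulrA.
    apply: ler_pM => //; first by rewrite !mulr_ge0.
      by rewrite lerXn2r ?nnegrE //; lra.
    by rewrite ler_wpM2l // ler_piMl.
  apply: le_trans (h r r1); rewrite exprD -!mulrA ler_wpM2l //.
  rewrite mulrC -mulrA ler_pM ?mulr_ge0 //.
    by rewrite lerXn2r ?nnegrE //; lra.
  by rewrite ler_piMl.
rewrite -ler_pdivlMr; last lra.
apply: ge_sup; first exact: hi.1.
move=> _ [r /= r1 <-]; rewrite ler_pdivlMr; last lra.
have [a0|a0] := ltP 0 (r ^+ i * expR (- (l * w r))); last first.
  by apply: (@le_trans _ _ 0); [rewrite mulr_le0_ge0 //|]; lra.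
rewrite mulrC -ler_pdivlMr //; apply: ge_sup; first exact: hj.1.
by move=> _ [s /= s1 <-]; rewrite ler_pdivlMr // mulrC key.
Qed.

(** Evaluating the hypothesis at [c.+1 * r] gains the factor [c.+1 ^ k]; the weight grows there by
    at most a factor [L], up to a constant. This is how the [2 ^ k] of the product rule is
    absorbed. *)
Lemma ub_geom (c : nat) l : 0 <= l ->
  exists2 L : R, 1 <= L & exists2 C : R, 1 <= C & forall l' k M, l * L <= l' ->
    ub l k M -> ub l' k (C * M / c.+1%:R ^+ k).
Proof.
move=> l0; have [L L1 hL] := weight_scale c.+1.
exists L => //; exists (expR (l * L)) => [|l' k M ll' h r r1].
  by rewrite -expR0 ler_expR mulr_ge0 //; lra.
have ck0 : 0 < c.+1%:R ^+ k :> R by rewrite exprn_gt0.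
have r0 : 0 <= r by lra.
rewrite ler_pdivlMr // mulrAC -exprMn mulrC (mulrC r).
have cr1 : 1 <= c.+1%:R * r by rewrite mulr_ege1 // ler1n.
have := h _ cr1; rewrite expRN ler_pdivrMr ?expR_gt0 // => H.
rewrite expRN mulrC ler_pdivrMr ?expR_gt0 //.
apply: (le_trans H); rewrite mulrAC -expRD mulrC ler_wpM2r //.
  by have := ub_ge1 h; lra.
rewrite ler_expR; apply: (@le_trans _ _ (l * (L * (1 + w r)))).
  by rewrite ler_wpM2l // hL.
have := weight_ge0 hw r0; nra.
Qed.

Lemma natr_fact_le k : (k`!)%:R <= k%:R ^+ k :> R.
Proof.
rewrite -natrX ler_nat; elim: k => // k IH.
rewrite factS expnS leq_mul2l /= (leq_trans IH) //.
by case: k {IH} => // k; rewrite leq_exp2r.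
Qed.

(* Because [w t = o(t)]: evaluate [ub] at [r = k / (l e)] for small [e]. *)
Lemma ub_fact (A : nat) l : 0 < l ->
  exists2 C : R, 1 <= C & forall k M, ub l k M -> A%:R ^+ k * (k`!)%:R <= C * M.
Proof.
(* The factor [expR 1] compensates [expR k], the size of [expR (l * w r)] at the chosen radius up to
   a constant; the successor ensures [B >= 1], hence [r >= 1], also for [A = 0]. *)
move=> l0; pose B : R := A.+1%:R * expR 1.
have B1 : 1 <= B.
  by rewrite mulr_ege1 ?ler1n // -[leLHS]expR0 ler_expR.
have B0 : 0 < B by lra.
have [|C C0 hC] := @weight_littleo (l * B)^-1.
  by rewrite invr_gt0 mulr_gt0.
exists (expR (l * C)) => [|k M h].
  by rewrite -expR0 ler_expR mulr_ge0 // ltW.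
have M1 := ub_ge1 h.
have C1 : 1 <= expR (l * C) by rewrite -expR0 ler_expR mulr_ge0 // ltW.
case: k => [|k] in h *; first by rewrite expr0 fact0 mul1r -[leLHS]mul1r ler_pM.
pose r := B * k.+1%:R.
have r1 : 1 <= r by rewrite mulr_ege1 // ler1n.
have := h r r1; rewrite expRN ler_pdivrMr ?expR_gt0 // => H.
have wr : l * w r <= k.+1%:R + l * C.
  apply: (@le_trans _ _ (l * ((l * B)^-1 * r + C))).
    by rewrite ler_wpM2l ?hC //; lra.
  rewrite mulrDr lerD2r /r le_eqVlt; apply/orP; left; apply/eqP.
  by field; lra.
have H2 : r ^+ k.+1 <= M * (expR (l * C) * expR 1 ^+ k.+1).
  apply: (le_trans H); rewrite ler_wpM2l //; first lra.
  by rewrite -expRM_natl -expRD ler_expR mulr1 addrC.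
have e0 : 0 < expR 1 ^+ k.+1 :> R by rewrite exprn_gt0 ?expR_gt0.
move: H2; rewrite mulrA -ler_pdivrMr // => H2.
rewrite (mulrC _ M); apply: le_trans H2.
rewrite /r /B !exprMn mulrAC mulfK ?gt_eqF //.
apply: ler_pM => //.
  by rewrite lerXn2r ?nnegrE // ler_nat.
exact: natr_fact_le.
Qed.

Let phi t : R := w (expR t).

(** Condition (delta) in the form of increasing slopes, with [b] written as a convex combination of
    [a] and [c]. *)
Lemma weight_expR_convex a b c : a < b -> b < c ->
  (phi b - phi a) / (b - a) <= (phi c - phi b) / (c - b).
Proof.
move=> ab bc.
have ac : 0 < c - a by lra.
have h01 : 0 <= (c - b) / (c - a) <= 1.
  by rewrite divr_ge0 /= ?ler_pdivrMr ?mul1r //; lra.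
pose p : {i01 R} := Itv01 (andP h01).1 (andP h01).2.
have := weight_delta hw p (in_setT a) (in_setT c).
rewrite !convRE /=.
have -> : conv p (a : convex_lmodType R^o) c = b.
  by rewrite /conv /= /unstable.onem /GRing.scale /=; field; lra.
rewrite /unstable.onem -/(phi a) -/(phi b) -/(phi c) => h.
have cb : 0 < c - b by lra.
have ba : 0 < b - a by lra.
rewrite ler_pdivrMr // mulrAC ler_pdivlMr //.
have := ler_wpM2r (ltW ac) h.
have -> : ((c - b) / (c - a) * phi a + (1 - (c - b) / (c - a)) * phi c) * (c - a)
   = (c - b) * phi a + (b - a) * phi c by field; lra.
lra.
Qed.

(* [k] is the integer part of the right derivative of [l * w (expR _)] at [ln r]. *)
Lemma ub_legendre l r : 0 <= l -> 1 <= r ->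
  exists k, ub l k (r ^+ k.+1 * expR (- (l * w r))).
Proof.
move=> l0 r1; have r0 : 0 < r by lra.
pose t0 := ln r; have t00 : 0 <= t0 by rewrite ln_ge0.
have Et0 : expR t0 = r by rewrite lnK // posrE.
pose q t := (phi t - phi t0) / (t - t0).
pose A := [set q t | t in [set t | t0 < t]].
have phi_le s t : s <= t -> phi s <= phi t.
  by move=> st; apply: weight_le; [exact: expR_ge0|rewrite ler_expR].
have lbA : lbound A 0.
  move=> _ [t /= tt0 <-]; apply: divr_ge0; last lra.
  by rewrite subr_ge0 phi_le // ltW.
have A0 : A !=set0 by exists (q (t0 + 1)), (t0 + 1) => //=; lra.
pose s := inf A.
have s0 : 0 <= s by apply: lb_le_inf.
have sq t : t0 < t -> s <= q t by move=> tt0; apply: ge_inf; [exists 0|exists t].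
(* The line of slope [s] through [t0] supports [phi]: to the left of [t0] every slope is at most the
   infimum of those to the right. *)
have sup t : phi t0 + s * (t - t0) <= phi t.
  have [tt0|tt0|->] := ltgtP t t0; last by rewrite subrr mulr0 addr0.
    have : (phi t0 - phi t) / (t0 - t) <= s.
      by apply: lb_le_inf => // _ [u /= ut <-]; exact: weight_expR_convex.
    rewrite ler_pdivrMr; last lra. lra.
  have := sq t tt0; rewrite /q ler_pdivlMr; last lra. lra.
have ls0 : 0 <= l * s by rewrite mulr_ge0.
(* Rounding the slope [l * s] down to [k] is harmless for [t >= t0]; for [0 <= t < t0] it costs at
   most [t0 - t <= ln r], that is one more factor [r], whence the exponent [k.+1]. *)
pose k := Num.truncn (l * s); exists k => rho rho1.
have /andP[k1 k2] : k%:R <= l * s < k.+1%:R by exact: truncn_itv.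
pose t := ln rho; have t1 : 0 <= t by rewrite ln_ge0.
have Et : expR t = rho by rewrite lnK // posrE; lra.
rewrite -Et -Et0 -!expRM_natl -!expRD ler_expR -/(phi t) -/(phi t0).
have := sup t; rewrite -natr1 in k2 *.
nra.
Qed.

End weight_calculus.

(** * Iterated partial derivatives and the Leibniz rule *)

Section cmod_lemmas.
Context {R : realType}.
Implicit Types z : R[i].

Lemma cmod_ge0 z : 0 <= cmod z.
Proof. by case: z => a b; exact: sqrtr_ge0. Qed.

Lemma cmodM (x y : R[i]) : cmod (x * y) = cmod x * cmod y.
Proof. exact: Normc.normcM. Qed.

Lemma cmodD (x y : R[i]) : cmod (x + y) <= cmod x + cmod y.
Proof. exact: le_normcD. Qed.

Lemma cmod0 : cmod (0 : R[i]) = 0.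
Proof. exact: Normc.normc0. Qed.

Lemma cmodC (a : R) : cmod a%:C = `|a|.
Proof. by rewrite /cmod /= expr0n /= addr0 sqrtr_sqr. Qed.

Lemma cmod_sum (I : Type) (s : seq I) (F : I -> R[i]) :
  cmod (\sum_(i <- s) F i) <= \sum_(i <- s) cmod (F i).
Proof.
elim: s => [|i s IH]; first by rewrite !big_nil cmod0.
by rewrite !big_cons (le_trans (cmodD _ _)) // lerD2l.
Qed.

Lemma Re_le_cmod z : `|complex.Re z| <= cmod z.
Proof.
by case: z => a b /=; rewrite -sqrtr_sqr ler_wsqrtr // lerDl sqr_ge0.
Qed.

Lemma Im_le_cmod z : `|complex.Im z| <= cmod z.
Proof.
by case: z => a b /=; rewrite -sqrtr_sqr ler_wsqrtr // lerDr sqr_ge0.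
Qed.

Lemma cmod_le z : cmod z <= `|complex.Re z| + `|complex.Im z|.
Proof.
case: z => a b /=; rewrite -(ger0_norm (addr_ge0 (normr_ge0 a) (normr_ge0 b))).
rewrite -sqrtr_sqr ler_wsqrtr // sqrrD !real_normK ?num_real // lerD2r lerDl.
by rewrite mulrn_wge0 // mulr_ge0.
Qed.

End cmod_lemmas.

Section calculus.
Context {R : realType} {N : nat}.
Local Notation V := 'rV[R]_N.
Local Notation e j := (delta_mx 0 j : V).
Implicit Types (f g : V -> R[i]) (ws : seq 'I_N) (i j : 'I_N) (k n : nat).

(** The two difference quotients coincide, so directional derivatives reduce to calculus in one
    variable. *)
Lemma is_derive_line (f : V -> R) x v (df : R) :
  is_derive (0 : R) (1 : R) (fun s : R => f (s *: v + x)) df -> is_derive x v f df.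
Proof.
move=> [d <-].
have E : (fun h : R => h^-1 *: (((fun s : R => f (s *: v + x)) \o shift 0) (h *: 1)
                       - f (0 *: v + x)))
   = (fun h : R => h^-1 *: ((f \o shift x) (h *: v) - f x)).
  apply/funext => h /=.
  by rewrite scale0r add0r addr0 /GRing.scale /= mulr1.
split; first by move: d; rewrite /derivable E.
by rewrite /derive E.
Qed.

Lemma Ck_continuous k f : Ck k f -> continuous (cRe f) /\ continuous (cIm f).
Proof. by case: k => [|k] [cr ci _]. Qed.

Lemma CkW k f : Ck k.+1 f -> Ck k f.
Proof.
elim: k f => [|k IH] f; first by case.
by case=> cr ci [pd h]; split => //; split => // j; exact: IH.
Qed.

Lemma cReM f g : cRe (mulop f g) = (fun x => cRe f x * cRe g x - cIm f x * cIm g x).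
Proof. by apply/funext => x; rewrite /cRe /cIm /mulop; case: (f x); case: (g x). Qed.

Lemma cImM f g : cIm (mulop f g) = (fun x => cRe f x * cIm g x + cIm f x * cRe g x).
Proof. by apply/funext => x; rewrite /cRe /cIm /mulop; case: (f x); case: (g x). Qed.

Lemma cReD f g : cRe (fun x => f x + g x) = (fun x => cRe f x + cRe g x).
Proof. by apply/funext => x; rewrite /cRe; case: (f x); case: (g x). Qed.

Lemma cImD f g : cIm (fun x => f x + g x) = (fun x => cIm f x + cIm g x).
Proof. by apply/funext => x; rewrite /cIm; case: (f x); case: (g x). Qed.

Lemma is_dM (u v : V -> R) x y : derivable u x y -> derivable v x y ->
  is_derive x y (fun x => u x * v x) ('D_y u x * v x + u x * 'D_y v x).
Proof.
move=> /derivableP du /derivableP dv; have := is_deriveM du dv.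
by rewrite /GRing.scale /= addrC (mulrC (v x)).
Qed.

Lemma is_dD (u v : V -> R) x y : derivable u x y -> derivable v x y ->
  is_derive x y (fun x => u x + v x) ('D_y u x + 'D_y v x).
Proof. by move=> /derivableP du /derivableP dv; exact: is_deriveD. Qed.

Lemma is_dB (u v : V -> R) x y : derivable u x y -> derivable v x y ->
  is_derive x y (fun x => u x - v x) ('D_y u x - 'D_y v x).
Proof. by move=> /derivableP du /derivableP dv; exact: is_deriveB. Qed.

Lemma is_d_val (u : V -> R) x y d : is_derive x y u d -> derivable u x y /\ 'D_y u x = d.
Proof. by move=> h; split; [exact: ex_derive|exact: derive_val]. Qed.

Lemma is_dMRe f g x y : derivable (cRe f) x y -> derivable (cIm f) x y ->
  derivable (cRe g) x y -> derivable (cIm g) x y ->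
  derivable (cRe (mulop f g)) x y /\ 'D_y (cRe (mulop f g)) x =
   ('D_y (cRe f) x * cRe g x + cRe f x * 'D_y (cRe g) x) -
   ('D_y (cIm f) x * cIm g x + cIm f x * 'D_y (cIm g) x).
Proof.
move=> fr fi gr gi; have [h1 e1] := is_d_val (is_dM fr gr).
have [h2 e2] := is_d_val (is_dM fi gi).
by rewrite cReM -e1 -e2; exact: (is_d_val (is_dB h1 h2)).
Qed.

Lemma is_dMIm f g x y : derivable (cRe f) x y -> derivable (cIm f) x y ->
  derivable (cRe g) x y -> derivable (cIm g) x y ->
  derivable (cIm (mulop f g)) x y /\ 'D_y (cIm (mulop f g)) x =
   ('D_y (cRe f) x * cIm g x + cRe f x * 'D_y (cIm g) x) +
   ('D_y (cIm f) x * cRe g x + cIm f x * 'D_y (cRe g) x).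
Proof.
move=> fr fi gr gi; have [h1 e1] := is_d_val (is_dM fr gi).
have [h2 e2] := is_d_val (is_dM fi gr).
by rewrite cImM -e1 -e2; exact: (is_d_val (is_dD h1 h2)).
Qed.

Lemma partially_derivableM f g : partially_derivable f -> partially_derivable g ->
  partially_derivable (mulop f g).
Proof.
move=> hf hg j x; have [fr fi] := hf j x; have [gr gi] := hg j x.
by split; [have [] := is_dMRe fr fi gr gi|have [] := is_dMIm fr fi gr gi].
Qed.

Lemma partially_derivableD f g : partially_derivable f -> partially_derivable g ->
  partially_derivable (fun x => f x + g x).
Proof.
move=> hf hg j x; have [fr fi] := hf j x; have [gr gi] := hg j x.
by rewrite cReD cImD; split; [have [] := is_d_val (is_dD fr gr)|have [] := is_d_val (is_dD fi gi)].
Qed.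

Lemma partialM j f g : partially_derivable f -> partially_derivable g ->
  partial j (mulop f g) =
  (fun x => mulop (partial j f) g x + mulop f (partial j g) x).
Proof.
move=> hf hg; apply/funext => x; have [fr fi] := hf j x; have [gr gi] := hg j x.
rewrite {1}/partial (is_dMRe fr fi gr gi).2 (is_dMIm fr fi gr gi).2 /mulop.
apply/eqP; rewrite eq_complex; apply/andP.
rewrite /partial; move: ('D__ (cRe f) x) ('D__ (cIm f) x) ('D__ (cRe g) x) ('D__ (cIm g) x).
rewrite /cRe /cIm; case: (f x) => a b; case: (g x) => c d p q r s /=.
by split; apply/eqP; ring.
Qed.

Lemma partialD j f g : partially_derivable f -> partially_derivable g ->
  partial j (fun x => f x + g x) = (fun x => partial j f x + partial j g x).
Proof.
move=> hf hg; apply/funext => x; have [fr fi] := hf j x; have [gr gi] := hg j x.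
by rewrite {1}/partial cReD cImD (is_d_val (is_dD fr gr)).2 (is_d_val (is_dD fi gi)).2.
Qed.

Lemma continuous_fD (u v : V -> R) : continuous u -> continuous v -> continuous (fun x => u x + v x).
Proof. by move=> cu cv x; exact: (continuousD (cu x) (cv x)). Qed.

Lemma continuous_fB (u v : V -> R) : continuous u -> continuous v -> continuous (fun x => u x - v x).
Proof. by move=> cu cv x; exact: (continuousB (cu x) (cv x)). Qed.

Lemma continuous_fM (u v : V -> R) : continuous u -> continuous v -> continuous (fun x => u x * v x).
Proof. by move=> cu cv x; exact: (continuousM (cu x) (cv x)). Qed.

Lemma CkD k f g : Ck k f -> Ck k g -> Ck k (fun x => f x + g x).
Proof.
elim: k f g => [|k IH] f g [fr fi hf] [gr gi hg]; split; rewrite ?cReD ?cImD //;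
  do ?exact: continuous_fD.
case: hf hg => [df hf] [dg hg]; split; first exact: partially_derivableD.
move=> j; rewrite partialD //; apply: IH; [exact: hf|exact: hg].
Qed.

Lemma CkM k f g : Ck k f -> Ck k g -> Ck k (mulop f g).
Proof.
have cRI f' g' : continuous (cRe f') -> continuous (cIm f') -> continuous (cRe g') ->
    continuous (cIm g') -> continuous (cRe (mulop f' g')) /\ continuous (cIm (mulop f' g')).
  by move=> fr fi gr gi; rewrite cReM cImM; split; [apply: continuous_fB|apply: continuous_fD]; exact: continuous_fM.
elim: k f g => [|k IH] f g Cf Cg.
  case: Cf Cg => [fr fi _] [gr gi _].
  by have [? ?] := cRI _ _ fr fi gr gi.
case: (Cf) (Cg) => [fr fi [df hf]] [gr gi [dg hg]].
have [? ?] := cRI _ _ fr fi gr gi.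
split => //; split; first exact: partially_derivableM.
have hf' : forall j, Ck k (partial j f) := hf.
have hg' : forall j, Ck k (partial j g) := hg.
by move=> j; rewrite partialM //; exact: (CkD (IH _ _ (hf' j) (CkW Cg)) (IH _ _ (CkW Cf) (hg' j))).
Qed.

Lemma smoothM f g : smooth f -> smooth g -> smooth (mulop f g).
Proof. by move=> hf hg k; exact: CkM. Qed.

Lemma smoothD f g : smooth f -> smooth g -> smooth (fun x => f x + g x).
Proof. by move=> hf hg k; exact: CkD. Qed.

Lemma smooth_partial j f : smooth f -> smooth (partial j f).
Proof. by move=> h k; have [_ _ [_]] := h k.+1; exact. Qed.

Lemma smooth_derivable f : smooth f -> partially_derivable f.
Proof. by move=> /(_ 1%N) [_ _ []]. Qed.

Lemma smooth_continuous f : smooth f -> continuous (cRe f) /\ continuous (cIm f).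
Proof. by move=> /(_ 0%N); exact: Ck_continuous. Qed.

(** A class closed under partial derivatives replaces an induction on the order; it is applied to
    constants, tensors and Fourier transforms. *)
Lemma smooth_coind (P : (V -> R[i]) -> Prop) :
  (forall f, P f -> [/\ continuous (cRe f), continuous (cIm f),
     partially_derivable f & forall j, P (partial j f)]) ->
  forall f, P f -> smooth f.
Proof.
move=> hP f Pf k; elim: k f Pf => [|k IH] f Pf; have [cr ci pd hp] := hP f Pf => //.
by split => //; split => // j; exact/IH/hp.
Qed.

Lemma smooth_cst (c : R[i]) : smooth (fun _ : V => c).
Proof.
pose P f := exists c : R[i], f = fun _ : V => c.
apply: (smooth_coind (P := P)); last by exists c.
move=> _ [{}c ->]; split; try exact: cst_continuous.
  by move=> j x; split; exact: derivable_cst.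
by move=> j; exists 0; apply/funext => x; rewrite /partial !derive_cst.
Qed.

(** One letter is one derivative, so the product rule becomes an induction on the word. *)
Definition dw ws f : V -> R[i] := foldr (@partial R N) f ws.

(** [dmulti] follows the order of [enum 'I_N], so multi-indices correspond exactly to these
    words. *)
Definition sorted_word ws := sorted (fun i j : 'I_N => (i <= j)%N) ws.

Lemma smooth_dw ws f : smooth f -> smooth (dw ws f).
Proof. by move=> hf; elim: ws => //= j ws; exact: smooth_partial. Qed.

Let word (alpha : {ffun 'I_N -> nat}) (s : seq 'I_N) :=
  flatten [seq nseq (alpha j) j | j <- s].

Let word_count alpha (s : seq 'I_N) i : uniq s ->
  count_mem i (word alpha s) = if i \in s then alpha i else 0%N.
Proof.
elim: s => //= j s IH /andP[js us]; rewrite /word /= count_cat -/(word _ _) IH //.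
rewrite count_nseq /= inE eq_sym; case: eqVneq => [->|ij] /=.
  by rewrite mul1n (negPf js) addn0.
by rewrite mul0n.
Qed.

Let word_size alpha (s : seq 'I_N) :
  size (word alpha s) = (\sum_(j <- s) alpha j)%N.
Proof.
elim: s => [|j s IH]; first by rewrite big_nil.
by rewrite big_cons /word /= size_cat size_nseq -IH.
Qed.

Let leT (i j : 'I_N) := (i <= j)%N.
Let leT_trans : transitive leT. Proof. by move=> ? ? ?; exact: leq_trans. Qed.
Let leT_anti : antisymmetric leT.
Proof. by move=> i j /anti_leq /val_inj. Qed.

Let enum_sorted : pairwise leT (enum 'I_N).
Proof.
rewrite -sorted_pairwise //.
have : sorted leq (map val (enum 'I_N)) by rewrite val_enum_ord iota_sorted.
by rewrite sorted_map.
Qed.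

Let word_sorted alpha (s : seq 'I_N) : pairwise leT s -> pairwise leT (word alpha s).
Proof.
elim: s => //= j s IH /andP[js ps]; rewrite /word /= pairwise_cat -/(word _ _) IH // andbT.
apply/andP; split.
  apply/allrelP => x y; rewrite mem_nseq => /andP[_ /eqP ->] /flattenP[_ /mapP[i is_ ->]].
  by rewrite mem_nseq => /andP[_ /eqP ->]; exact: (allP js).
by elim: (alpha j) => //= n ->; rewrite andbT; apply/allP => x; rewrite mem_nseq => /andP[_ /eqP ->]; rewrite /leT.
Qed.

Let dmulti_word alpha f : dmulti alpha f = dw (word alpha (enum 'I_N)) f.
Proof.
rewrite /dmulti; elim: (enum 'I_N) => //= j s ->.
rewrite /dw /word /= foldr_cat; elim: (alpha j) => //= n IH.
by rewrite IH.
Qed.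

Lemma dmulti_dw alpha : exists ws,
  [/\ sorted_word ws, size ws = mlen alpha & forall f, dmulti alpha f = dw ws f].
Proof.
exists (word alpha (enum 'I_N)); split; last exact: dmulti_word.
- by rewrite /sorted_word sorted_pairwise //; exact: word_sorted.
- by rewrite word_size /mlen big_enum.
Qed.

(** A sorted word is determined by the number of occurrences of each letter. *)
Lemma dw_dmulti ws : sorted_word ws ->
  exists2 alpha, mlen alpha = size ws & forall f, dw ws f = dmulti alpha f.
Proof.
move=> sws; pose alpha := [ffun j : 'I_N => count_mem j ws].
have E : word alpha (enum 'I_N) = ws.
  apply: (sorted_eq leT_trans leT_anti) => //.
    by rewrite sorted_pairwise //; exact: word_sorted.
  apply/allP => i _ /=; rewrite word_count ?enum_uniq // mem_enum inE /=.
  by rewrite ffunE.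
exists alpha => [|f]; last by rewrite dmulti_word E.
by rewrite -E word_size /mlen big_enum.
Qed.

(** Every letter is handed to one of two factors. The list keeps repetitions, which take the place
    of binomial coefficients. *)
Fixpoint splits ws : seq (seq 'I_N * seq 'I_N) :=
  if ws is j :: ws' then [seq (j :: p.1, p.2) | p <- splits ws'] ++
                         [seq (p.1, j :: p.2) | p <- splits ws']
  else [:: ([::], [::])].

Lemma size_splits ws : size (splits ws) = (2 ^ size ws)%N.
Proof. by elim: ws => //= j ws IH; rewrite size_cat !size_map IH addnn -mul2n expnS. Qed.

(** Subsequences of a sorted word are sorted, so bounds on sorted words apply to both factors of a
    term of the product rule. *)
Lemma splitsP ws p : p \in splits ws ->
  [/\ (size p.1 + size p.2 = size ws)%N, subseq p.1 ws & subseq p.2 ws].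
Proof.
elim: ws p => [|j ws IH] p /=; first by rewrite inE => /eqP ->.
rewrite mem_cat => /orP[] /mapP[q /IH [h1 h2 h3] ->] /=; split.
- by rewrite addSn h1.
- by rewrite eqxx.
- exact: subseq_trans h3 (subseq_cons _ _).
- by rewrite addnS h1.
- exact: subseq_trans h2 (subseq_cons _ _).
- by rewrite eqxx.
Qed.

Lemma partial_sum j (I : Type) (s : seq I) (F : I -> V -> R[i]) :
  (forall p, smooth (F p)) ->
  partial j (fun x => \sum_(p <- s) F p x) = (fun x => \sum_(p <- s) partial j (F p) x)
  /\ smooth (fun x => \sum_(p <- s) F p x).
Proof.
move=> hF; elim: s => [|p s [IH1 IH2]].
  have -> : (fun x => \sum_(p <- [::]) F p x) = fun=> 0.
    by apply/funext => x; rewrite big_nil.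
  split; last exact: smooth_cst.
  by apply/funext => x; rewrite big_nil /partial !derive_cst.
have -> : (fun x => \sum_(q <- p :: s) F q x) = fun x => F p x + \sum_(q <- s) F q x.
  by apply/funext => x; rewrite big_cons.
split; last exact: smoothD.
rewrite partialD; [|exact: smooth_derivable|exact: smooth_derivable].
by rewrite IH1; apply/funext => x; rewrite big_cons.
Qed.

Lemma dw_mulop ws f g : smooth f -> smooth g ->
  dw ws (mulop f g) = fun x => \sum_(p <- splits ws) mulop (dw p.1 f) (dw p.2 g) x.
Proof.
move=> sf sg; elim: ws => [|j ws IH]; first by apply/funext => x; rewrite big_seq1.
rewrite /= -/(dw ws _) IH (partial_sum _ _ _).1; last first.
  by move=> p; apply: smoothM; exact: smooth_dw.
apply/funext => x; rewrite big_cat /= !big_map -big_split /=.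
apply: eq_bigr => p _; rewrite partialM //; apply: smooth_derivable; exact: smooth_dw.
Qed.

Lemma dw_mulop_le ws f g x (B : R) : smooth f -> smooth g -> sorted_word ws ->
  (forall u v, sorted_word u -> sorted_word v -> (size u + size v = size ws)%N ->
    cmod (dw u f x) * cmod (dw v g x) <= B) ->
  cmod (dw ws (mulop f g) x) <= 2 ^+ size ws * B.
Proof.
move=> sf sg sws h; rewrite dw_mulop // (le_trans (cmod_sum _ _)) //.
rewrite -natrX -size_splits mulr_natl.
have -> : B *+ size (splits ws) = \sum_(p <- splits ws) B.
  by rewrite big_const_seq count_predT iter_addr_0.
rewrite big_seq [leRHS]big_seq.
apply: ler_sum => p /splitsP[h1 h2 h3]; rewrite cmodM; apply: h => //.
  exact: (subseq_sorted leT_trans h2).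
exact: (subseq_sorted leT_trans h3).
Qed.

Lemma sorted_nseq n j : sorted_word (nseq n j).
Proof.
rewrite /sorted_word; case: n => //= n; elim: n => //= n ->.
by rewrite leqnn.
Qed.

Lemma enorm_ge0 (x : V) : 0 <= enorm x.
Proof. exact: sqrtr_ge0. Qed.

Lemma coord_le_enorm (x : V) j : `|x 0 j| <= enorm x.
Proof.
rewrite -sqrtr_sqr ler_wsqrtr // /dotp (bigD1 j) //= -expr2 lerDl.
by apply: sumr_ge0 => i _; rewrite -expr2 sqr_ge0.
Qed.

End calculus.

Lemma enorm_le_coord (R : realType) (N : nat) (x : 'rV[R]_N) : (0 < N)%N ->
  exists j, enorm x <= N%:R * `|x 0 j| /\ forall i, `|x 0 i| <= `|x 0 j|.
Proof.
case: N x => // n x _.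
have [j _ hj] := Order.TotalTheory.arg_maxP (fun i => `|x 0 i|) (erefl : xpredT (ord0 : 'I_n.+1)).
exists j; split; last by move=> i; exact: hj.
have h0 : 0 <= n.+1%:R * `|x 0 j| by rewrite mulr_ge0.
rewrite -[leRHS]ger0_norm // -sqrtr_sqr ler_wsqrtr //.
apply: (@le_trans _ _ (\sum_(i < n.+1) `|x 0 j| ^+ 2)).
  apply: ler_sum => i _; rewrite -expr2 -real_normK ?num_real //.
  by rewrite lerXn2r ?nnegrE //; exact: hj.
rewrite sumr_const card_ord exprMn -[leLHS]mulr_natl ler_wpM2r ?sqr_ge0 //.
by rewrite -natrX ler_nat expnS leq_pmulr // expn1.
Qed.

(** * Sequences of derivatives in one variable, series and tensor products *)

Section jets.
Context {R : realType}.
Implicit Types (d u v : nat -> R -> R) (x y h : R) (n k : nat).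

(** All derivatives are carried along as data: they stay explicit, and bounds on all orders can be
    multiplied, summed and shifted together. *)
Definition jet d := forall n x, is_derive x (1 : R) (d n) (d n.+1 x).

(** Quadratic error bounds pass through sums and integrals. This is the means of differentiating
    both the series [wsum] and the Fourier integral. *)
Lemma is_derive_quad (u : R -> R) x (du M : R) :
  (forall h, `|u (x + h) - u x - h * du| <= M * h ^+ 2) -> is_derive x (1 : R) u du.
Proof.
move=> hM.
have cv : (fun h : R => h^-1 *: ((u \o shift x) (h *: (1 : R)) - u x)) @ 0^' --> du.
  apply/cvgrPdist_le => e e0.
  have M1 : 0 < `|M| + 1 by rewrite ltr_wpDl.
  have d0 : 0 < e / (`|M| + 1) by rewrite divr_gt0.
  near=> h.
  have h0 : h != 0 by near: h; exact: nbhs_dnbhs_neq.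
  have hd : `|h| < e / (`|M| + 1).
    by near: h; apply: dnbhs0_lt.
  rewrite /= /GRing.scale /= mulr1 distrC (addrC h).
  have -> : h^-1 * (u (x + h) - u x) - du = h^-1 * (u (x + h) - u x - h * du).
    by field.
  rewrite normrM normfV mulrC ler_pdivrMr ?normr_gt0 //.
  apply: (le_trans (hM h)); rewrite -real_normK ?num_real // expr2 mulrA ler_wpM2r //.
  move: hd; rewrite ltr_pdivlMr // => hd.
  have := ler_norm M; have := normr_ge0 h; nra.
by split; [apply/cvg_ex; exists du|exact/cvg_lim].
Unshelve. all: by end_near. Qed.

Lemma MVT_shift (u u' : R -> R) x h : (forall y, is_derive y (1 : R) u (u' y)) ->
  exists2 z, `|z - x| <= `|h| & u (x + h) - u x = u' z * h.
Proof.
move=> hu; have cu y z : {within `[y, z], continuous u}.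
  apply: derivable_within_continuous => t _; exact: ex_derive.
case: (leP 0 h) => h0.
  have [|z] := @MVT_segment R u u' x (x + h) _ (fun t _ => hu t) (cu _ _); first lra.
  rewrite in_itv /= => /andP[z1 z2] E; exists z.
    by rewrite !ger0_norm; lra.
  by rewrite E; ring.
have [|z] := @MVT_segment R u u' (x + h) x _ (fun t _ => hu t) (cu _ _); first lra.
rewrite in_itv /= => /andP[z1 z2] E; exists z.
  by rewrite !ler0_norm; lra.
rewrite -opprB E; ring.
Qed.

(** Two applications of the mean value theorem, hence the constant [M] in place of [M / 2]. *)
Lemma taylor2 (u0 u1 u2 : R -> R) (M : R) x h :
  (forall y, is_derive y (1 : R) u0 (u1 y)) -> (forall y, is_derive y (1 : R) u1 (u2 y)) ->
  (forall y, `|u2 y| <= M) -> `|u0 (x + h) - u0 x - h * u1 x| <= M * h ^+ 2.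
Proof.
move=> h0 h1 h2; have [z zh ->] := MVT_shift x h h0.
have [t _ E] := MVT_shift x (z - x) h1; rewrite (addrC x) subrK in E.
have -> : u1 z * h - h * u1 x = (u1 z - u1 x) * h by ring.
rewrite E !normrM -mulrA ler_pM //; last first.
  by rewrite -real_normK ?num_real // expr2 ler_wpM2r.
Qed.

Lemma jet_shift d (a : R) : jet d -> jet (fun n x => d n (x - a)).
Proof.
move=> hd n x; have [h1 h2] := hd n (x - a).
have E : (fun h : R => h^-1 *: (((d n) \o shift (x - a)) (h *: (1 : R)) - d n (x - a)))
   = (fun h : R => h^-1 *: (((fun y => d n (y - a)) \o shift x) (h *: (1 : R)) - d n (x - a))).
  by apply/funext => h /=; rewrite addrA.
split; first by move: h1; rewrite /derivable E.
by rewrite -h2 /derive E.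
Qed.

Lemma jet_unique u v : jet u -> jet v -> u 0 =1 v 0 -> forall n, u n =1 v n.
Proof.
move=> hu hv h0; elim=> // n /funext E x.
have := hu n x; rewrite E => h1; have h2 := hv n x.
by rewrite -(@derive_val _ _ _ _ _ _ _ h1) (@derive_val _ _ _ _ _ _ _ h2).
Qed.

Definition jet_mul u v n x : R := \sum_(l < n.+1) 'C(n, l)%:R * u l x * v (n - l)%N x.

(** Pascal's rule, after splitting off the two boundary terms. *)
Lemma jet_mulP u v : jet u -> jet v -> jet (jet_mul u v).
Proof.
move=> hu hv n x.
have -> : jet_mul u v n.+1 x =
    \sum_(l < n.+1) 'C(n, l)%:R * (u l.+1 x * v (n - l)%N x + u l x * v (n - l).+1 x).
  rewrite /jet_mul big_ord_recl /= bin0 mul1r subn0.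
  under eq_bigr => l _ do rewrite /bump /= add1n binS subSS natrD !mulrDl.
  rewrite big_split /= [X in _ + (X + _)]big_ord_recr /= bin_small // !mul0r addr0.
  under [RHS]eq_bigr => l _ do rewrite mulrDr !mulrA.
  rewrite big_split /= [X in _ = _ + X]big_ord_recl /= bin0 mul1r subn0.
  rewrite [RHS]addrCA; congr (_ + _); rewrite addrC; congr (_ + _).
  by apply: eq_bigr => l _; rewrite /bump /= add1n subnSK.
have -> : jet_mul u v n = \sum_(l < n.+1) (fun y => 'C(n, l)%:R * u l y * v (n - l)%N y).
  by apply/funext => y; rewrite fct_sumE.
apply: is_derive_sum => l.
have h1 := hu l x; have h2 := hv (n - l)%N x.
have h3 := is_deriveM h1 h2.
have := is_deriveZ ('C(n, l)%:R : R) h3.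
rewrite /GRing.scale /= => h4.
have -> : (fun y => 'C(n, l)%:R * u l y * v (n - l)%N y) = 'C(n, l)%:R \*: (u l * v (n - l)%N).
  by apply/funext => y; rewrite /= /GRing.scale /= mulrA.
apply: is_derive_eq h4 _; rewrite -/(GRing.scale _ _) /GRing.scale /=; ring.
Qed.

(* Differential polynomials in a function [g] and its reciprocal: their
   derivatives are again of this form. *)
Inductive jexpr := JG of nat | JR | JN of jexpr | JA of jexpr & jexpr | JM of jexpr & jexpr.

Fixpoint jderiv (t : jexpr) := match t with
  | JG n => JG n.+1
  | JR => JN (JM (JG 1) (JM JR JR))
  | JN a => JN (jderiv a)
  | JA a b => JA (jderiv a) (jderiv b)
  | JM a b => JA (JM (jderiv a) b) (JM a (jderiv b))
  end.

Fixpoint jeval d (t : jexpr) (x : R) : R := match t with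
  | JG n => d n x
  | JR => (d 0 x)^-1
  | JN a => - jeval d a x
  | JA a b => jeval d a x + jeval d b x
  | JM a b => jeval d a x * jeval d b x
  end.

Lemma jeval_derive d t x : jet d -> (forall y, d 0 y != 0) ->
  is_derive x (1 : R) (jeval d t) (jeval d (jderiv t) x).
Proof.
move=> hd d0; elim: t => [n||a IH|a IHa b IHb|a IHa b IHb] /=.
- exact: hd.
- have h := @is_deriveV _ (d 0) x (d 1 x) 1 (d0 x) (hd 0 x).
  apply: is_derive_eq h _; rewrite /GRing.scale /=; field; exact: d0.
- exact: is_deriveN.
- exact: is_deriveD.
- have h := is_deriveM IHa IHb.
  by apply: is_derive_eq h _; rewrite /GRing.scale /= addrC (mulrC (jeval d b x)).
Qed.

(** The derivatives of [r * d = 1] vanish; solving for the top derivative of [r] gives a recursion.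
    Doubling [A] absorbs the sum of [2 ^+ l] over [l <= n], which is below [2 ^+ n.+1]. *)
Lemma jet_inv d : jet d -> (forall y, 0 < d 0 y) ->
  exists r, [/\ jet r, (forall x, r 0 x = (d 0 x)^-1) &
    forall (A : R), 0 <= A -> (forall n x, `|d n x| <= A ^+ n * n`!%:R * d 0 x) ->
    forall n x, `|r n x| <= (2 * A) ^+ n * n`!%:R * r 0 x].
Proof.
move=> hd d0; pose r n := jeval d (iter n jderiv JR).
have dn0 y : d 0 y != 0 by rewrite gt_eqF.
have jr : jet r by move=> n x; rewrite /r iterS; exact: jeval_derive.
exists r; split => // A A0 hA.
(* The jet of the constant 1: by uniqueness it is the jet of [r * d]. *)
have jc : jet (fun n (x : R) => (n == 0)%:R).
  by move=> n x; rewrite /=; exact: is_derive_cst.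
have E n x : (0 < n)%N -> jet_mul r d n x = 0.
  move=> n0; rewrite (jet_unique (jet_mulP jr hd) jc).
    by case: n n0.
  by move=> y; rewrite /jet_mul big_ord1 /= bin0 mul1r mulVf.
elim/ltn_ind => -[|n] IH x.
  by rewrite expr0 fact0 !mul1r ger0_norm // /r /= invr_ge0 ltW.
(* The last term of the vanishing Leibniz sum is [r n.+1 x * d 0 x]; the remaining ones are known by
   induction. *)
have := E n.+1 x erefl; rewrite /jet_mul big_ord_recr /= binn mul1r subnn => /eqP.
rewrite addrC addr_eq0 => /eqP H.
rewrite -(ler_pM2r (d0 x)) -{1}(gtr0_norm (d0 x)) -normrM H normrN.
apply: (le_trans (ler_norm_sum _ _ _)).
apply: (@le_trans _ _ (\sum_(l < n.+1) 2 ^+ l * (A ^+ n.+1 * (n.+1)`!%:R * r 0 x * d 0 x))).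
  apply: ler_sum => l _; rewrite !normrM ger0_norm //.
  apply: (@le_trans _ _ ('C(n.+1, l)%:R * ((2 * A) ^+ l * l`!%:R * r 0 x) *
     (A ^+ (n.+1 - l) * (n.+1 - l)`!%:R * d 0 x))).
    by apply: ler_pM => //; rewrite ?mulr_ge0 // ler_wpM2l // IH.
  have ln : (l <= n.+1)%N by exact: ltnW.
  have -> : A ^+ n.+1 = A ^+ l * A ^+ (n.+1 - l) by rewrite -exprD subnKC.
  have -> : (n.+1)`!%:R = 'C(n.+1, l)%:R * (l`!%:R * (n.+1 - l)`!%:R) :> R.
    by rewrite -!natrM bin_fact.
  by rewrite exprMn le_eqVlt; apply/orP; left; apply/eqP; ring.
rewrite -mulr_suml -!mulrA exprMn -!mulrA ler_wpM2r //.
  rewrite !mulr_ge0 ?exprn_ge0 ?invr_ge0 // ltW //.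
elim: {IH E H} n => [|n IH]; first by rewrite big_ord1 expr0 expr1; lra.
rewrite big_ord_recr /= (exprS _ n.+1); lra.
Qed.

End jets.

Section weighted_series.
Context {R : realType}.
Variable c : nat -> R.
Hypothesis c0 : forall k, 0 <= c k.
Hypothesis cc : cvgn (series c).
Implicit Types (b : nat -> R) (B : R).

Definition wsum b := limn (series (fun k => c k * b k)).

Lemma is_cvg_wsum b B : (forall k, `|b k| <= B) -> cvgn (series (fun k => c k * b k)).
Proof.
move=> hb; apply: normed_cvg; apply: (series_le_cvg (v_ := fun k => c k * B)) => //.
- by move=> k; exact: normr_ge0.
- by move=> k; rewrite mulr_ge0 // (le_trans _ (hb k)).
- by move=> k /=; rewrite normrM ger0_norm // ler_wpM2l.
- have -> : (fun k => c k * B) = B *: c by apply/funext => k; rewrite mulrC.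
  exact: is_cvg_seriesZ.
Qed.

Lemma wsum_lin b b' B B' (p q : R) : (forall k, `|b k| <= B) -> (forall k, `|b' k| <= B') ->
  wsum (fun k => p * b k + q * b' k) = p * wsum b + q * wsum b'.
Proof.
move=> hb hb'; have h := is_cvg_wsum hb; have h' := is_cvg_wsum hb'.
rewrite /wsum; apply/cvg_lim => //.
have -> : series (fun k => c k * (p * b k + q * b' k)) =
    (fun n => p * series (fun k => c k * b k) n + q * series (fun k => c k * b' k) n).
  apply/funext => n; rewrite /series /= !mulr_sumr -big_split /=.
  by apply: eq_bigr => k _; ring.
by apply: cvgD; apply: cvgM => //; exact: cvg_cst.
Qed.

Lemma wsum_le b b' B B' : (forall k, `|b k| <= B) -> (forall k, `|b' k| <= B') ->
  (forall k, b k <= b' k) -> wsum b <= wsum b'.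
Proof.
move=> hb hb' bb'; have h := is_cvg_wsum hb; have h' := is_cvg_wsum hb'.
by apply: ler_lim => //; near=> n; apply: ler_sum => k _; exact: ler_wpM2l.
Unshelve. all: by end_near. Qed.

Lemma wsum_cst B : wsum (fun=> B) = B * limn (series c).
Proof.
rewrite /wsum; apply/cvg_lim => //.
have -> : series (fun k => c k * B) = (fun n => B * series c n).
  by apply/funext => n; rewrite /series /= mulr_sumr; apply: eq_bigr => k _; ring.
by apply: cvgM => //; exact: cvg_cst.
Qed.

Lemma wsum_abs b B : (forall k, `|b k| <= B) -> `|wsum b| <= B * limn (series c).
Proof.
move=> hb; have B0 : 0 <= B by rewrite (le_trans _ (hb 0)).
have hB (k : nat) : `|B| <= B by rewrite ger0_norm.
have hNB (k : nat) : `|- B| <= B by rewrite normrN ger0_norm.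
rewrite ler_norml -!mulNr -!wsum_cst; apply/andP; split.
  by apply: (wsum_le hNB hb) => k; move: (hb k); rewrite ler_norml => /andP[].
by apply: (wsum_le hb hB) => k; move: (hb k); rewrite ler_norml => /andP[].
Qed.

Lemma wsum_term b B k : (forall k, `|b k| <= B) -> (forall k, 0 <= b k) -> c k * b k <= wsum b.
Proof.
move=> hb b0; have h := is_cvg_wsum hb.
apply: (@le_trans _ _ (series (fun k => c k * b k) k.+1)).
  rewrite seriesSr lerDr; apply: sumr_ge0 => i _; exact: mulr_ge0.
apply: nondecreasing_cvgn_le => //; apply/nondecreasing_seqP => n.
by rewrite seriesSr lerDl mulr_ge0.
Qed.

(** The Taylor error of the terms is quadratic with a constant uniform in [k], so the error of the
    weighted sum is quadratic as well. *)
Lemma jet_wsum (d : nat -> R -> R) (a : nat -> R) : jet d ->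
  (forall n, exists B : R, forall x, `|d n x| <= B) ->
  jet (fun n s => wsum (fun k => d n (s - a k))).
Proof.
move=> hd hB n x.
have [B0 h0] := hB n; have [B1 h1] := hB n.+1; have [B2 h2] := hB n.+2.
apply: (@is_derive_quad _ _ _ _ (B2 * limn (series c))) => h.
have e1 : wsum (fun k => d n (x + h - a k) - d n (x - a k)) =
    wsum (fun k => d n (x + h - a k)) - wsum (fun k => d n (x - a k)).
  have := @wsum_lin (fun k => d n (x + h - a k)) (fun k => d n (x - a k)) B0 B0 1 (-1).
  by under eq_fun do rewrite mul1r mulN1r; move=> ->; rewrite // mul1r mulN1r.
have e2 : wsum (fun k => d n (x + h - a k) - d n (x - a k) - h * d n.+1 (x - a k)) =
    wsum (fun k => d n (x + h - a k)) - wsum (fun k => d n (x - a k)) -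
    h * wsum (fun k => d n.+1 (x - a k)).
  rewrite -e1.
  have := @wsum_lin (fun k => d n (x + h - a k) - d n (x - a k)) (fun k => d n.+1 (x - a k)) (B0 + B0) B1 1 (- h).
  under eq_fun do rewrite mul1r mulNr; move=> ->; rewrite ?mul1r ?mulNr //.
  by move=> k; rewrite (le_trans (ler_normB _ _)) // lerD.
rewrite -e2 mulrAC; apply: wsum_abs => k.
have := @taylor2 _ (d n) (d n.+1) (d n.+2) B2 (x - a k) h (hd n) (hd n.+1) h2.
by rewrite (addrAC x).
Qed.

End weighted_series.

Lemma continuous_prod (R : realType) (N : nat) (I : Type) (s : seq I) (F : I -> 'rV[R]_N -> R) :
  (forall i, continuous (F i)) -> continuous (fun x : 'rV[R]_N => \prod_(i <- s) F i x).
Proof.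
move=> hF; elim: s => [|i s IH].
  have -> : (fun x : 'rV[R]_N => \prod_(i <- [::]) F i x) = fun=> 1.
    by apply/funext => x; rewrite big_nil.
  exact: cst_continuous.
have -> : (fun x : 'rV[R]_N => \prod_(j <- i :: s) F j x) = fun x : 'rV[R]_N => F i x * \prod_(j <- s) F j x.
  by apply/funext => x; rewrite big_cons.
exact: continuous_fM.
Qed.

Section tensors.
Context {R : realType} {N : nat}.
Local Notation V := 'rV[R]_N.
Implicit Types (g : 'I_N -> nat -> R -> R) (n : 'I_N -> nat) (x : V) (i j : 'I_N).

(** The argument [n] holds the order of differentiation in each variable, so the family is closed
    under partial derivatives: [partial i] raises [n i] by one. *)
Definition tensor g n : V -> R[i] := fun x => (\prod_j g j (n j) (x 0 j))%:C.

Lemma cRe_tensor g n : cRe (tensor g n) = fun x => \prod_j g j (n j) (x 0 j).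
Proof. by []. Qed.

Lemma cIm_tensor g n : cIm (tensor g n) = fun=> 0.
Proof. by []. Qed.

Lemma continuous_coord j : continuous (fun x : V => x 0 j).
Proof. exact: coord_continuous. Qed.

Lemma jet_continuous (d : nat -> R -> R) k : jet d -> continuous (d k).
Proof.
by move=> hd x; apply/differentiable_continuous/derivable1_diffP; exact: ex_derive.
Qed.

Lemma is_derive_tensor g n i x : (forall j, jet (g j)) ->
  is_derive x (delta_mx 0 i) (fun x => \prod_j g j (n j) (x 0 j))
    (\prod_j g j (n j + (j == i))%N (x 0 j)).
Proof.
move=> hg; apply: is_derive_line.
have -> : (fun s : R => \prod_j g j (n j) ((s *: delta_mx 0 i + x) 0 j)) =
    (fun s => (\prod_(j | j != i) g j (n j) (x 0 j)) * g i (n i) (s - (- x 0 i))).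
  apply/funext => s; rewrite (bigD1 i) //= mulrC; congr (_ * _).
    apply: eq_bigr => j ji; rewrite !mxE eqxx /= (negPf ji) mulr0 add0r //.
  by rewrite !mxE !eqxx mulr1 opprK.
rewrite [X in is_derive _ _ _ X](bigD1 i) //= eqxx addn1 mulrC.
have -> : \prod_(j | j != i) g j (n j + (j == i))%N (x 0 j) =
    \prod_(j | j != i) g j (n j) (x 0 j).
  by apply: eq_bigr => j /negPf ->; rewrite addn0.
have h := jet_shift (- x 0 i) (hg i) (n i) 0.
have E : 0 - - x 0 i = x 0 i by rewrite sub0r opprK.
rewrite E in h.
exact: (is_deriveZ (\prod_(j | j != i) g j (n j) (x 0 j)) h).
Qed.

Lemma partial_tensor g n i : (forall j, jet (g j)) ->
  partial i (tensor g n) = tensor g (fun j => n j + (j == i))%N.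
Proof.
move=> hg; apply/funext => x; rewrite /partial cRe_tensor cIm_tensor derive_cst.
by have h := is_derive_tensor n i x hg; rewrite (@derive_val _ _ _ _ _ _ _ h).
Qed.

Lemma smooth_tensor g n : (forall j, jet (g j)) -> smooth (tensor g n).
Proof.
move=> hg; apply: (smooth_coind (P := fun f => exists n, f = tensor g n)); last by exists n.
move=> _ [{}n ->]; split.
- rewrite cRe_tensor; apply: continuous_prod => j x.
  apply: continuous_comp; [exact: continuous_coord|exact: jet_continuous].
- rewrite cIm_tensor; exact: cst_continuous.
- move=> j x; split; last exact: derivable_cst.
  by rewrite cRe_tensor; have h := is_derive_tensor n j x hg; exact: ex_derive.
- by move=> j; exists (fun i => n i + (i == j))%N; rewrite partial_tensor.
Qed.

Lemma dw_tensor g (ws : seq 'I_N) : (forall j, jet (g j)) ->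
  dw ws (tensor g (fun=> 0%N)) = tensor g (fun j => count_mem j ws).
Proof.
move=> hg; elim: ws => //= i ws IH; rewrite -/(dw ws _) IH partial_tensor //.
congr tensor; apply/funext => j; by rewrite addnC eq_sym.
Qed.

Lemma prod_fact_le (I : Type) (s : seq I) (n : I -> nat) :
  (\prod_(j <- s) (n j)`! <= (\sum_(j <- s) n j)`!)%N.
Proof.
elim: s => [|j s IH]; first by rewrite !big_nil.
rewrite !big_cons; apply: (@leq_trans ((n j)`! * (\sum_(j <- s) n j)`!)).
  by rewrite leq_mul2l IH orbT.
have := bin_fact (leq_addr (\sum_(j <- s) n j) (n j)); rewrite addKn => <-.
by rewrite leq_pmull // bin_gt0 leq_addr.
Qed.

Lemma sum_count (ws : seq 'I_N) : (\sum_(j < N) count_mem j ws)%N = size ws.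
Proof.
elim: ws => [|i ws IH]; first by rewrite big1.
rewrite /= big_split /= IH -addn1 addnC; congr addn.
by rewrite (bigD1 i) //= eqxx big1 // => j /negPf; rewrite eq_sym => ->.
Qed.

(** Factorial bounds survive tensor products because a product of factorials is at most the
    factorial of the sum. *)
Lemma dw_tensor_le g (ws : seq 'I_N) x (A : R) (b : 'I_N -> R) : (forall j, jet (g j)) -> 0 <= A ->
  (forall j k, `|g j k (x 0 j)| <= A ^+ k * k`!%:R * b j) ->
  cmod (dw ws (tensor g (fun=> 0%N)) x) <= A ^+ size ws * (size ws)`!%:R * \prod_j b j.
Proof.
move=> hg A0 hb; rewrite dw_tensor // /tensor cmodC normr_prod.
have b0 j : 0 <= b j by have := hb j 0%N; rewrite expr0 fact0 !mul1r; apply: le_trans.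
apply: (@le_trans _ _ (\prod_j (A ^+ count_mem j ws * (count_mem j ws)`!%:R * b j))).
  by apply: ler_prod => j _; rewrite normr_ge0 hb.
rewrite !big_split /= ler_wpM2r ?prodr_ge0 // prodrXr sum_count ler_wpM2l ?exprn_ge0 //.
by rewrite -natr_prod ler_nat -(sum_count ws) prod_fact_le.
Qed.

End tensors.

(** * Integration *)

Section dominated_fubini.
Context d1 d2 (X : measurableType d1) (Y : measurableType d2) (R : realType).
Variables (m1 : {sigma_finite_measure set X -> \bar R})
          (m2 : {sigma_finite_measure set Y -> \bar R}).
Variables (k1 : X -> R) (k2 : Y -> R).
Hypotheses (i1 : m1.-integrable setT (EFin \o k1)) (i2 : m2.-integrable setT (EFin \o k2)).
Variables (G : X * Y -> R) (C : R).
Hypotheses (mG : measurable_fun setT G) (hG : forall x y, `|G (x, y)| <= C * k1 x * k2 y).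

Lemma dominated_integrable d (Z : measurableType d) (m : {measure set Z -> \bar R})
  (f g : Z -> R) (D : R) : measurable_fun setT f -> m.-integrable setT (EFin \o g) ->
  (forall z, `|f z| <= D * g z) -> m.-integrable setT (EFin \o f).
Proof.
move=> mf ig hfg; apply: (@le_integrable _ _ _ m setT measurableT _ (fun z => D%:E * (g z)%:E)%E).
- exact/measurable_EFinP.
- move=> z _ /=; rewrite lee_fin; apply: (le_trans (hfg z)); exact: ler_norm.
- exact: integrableZl.
Qed.

Lemma integrable_section1 x : m2.-integrable setT (EFin \o (fun y => G (x, y))).
Proof.
apply: (@dominated_integrable _ _ _ _ k2 (C * k1 x)) => //.
exact: measurableT_comp mG (measurable_pair1 x).
Qed.

Lemma integrable_section2 y : m1.-integrable setT (EFin \o (fun x => G (x, y))).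
Proof.
apply: (@dominated_integrable _ _ _ _ k1 (C * k2 y)) => //.
  exact: measurableT_comp mG (measurable_pair2 y).
by move=> x; rewrite mulrAC.
Qed.

Lemma Rintegral_EFin d (Z : measurableType d) (m : {measure set Z -> \bar R}) (f : Z -> R) :
  m.-integrable setT (EFin \o f) ->
  (\int[m]_z (f z)%:E)%E = (Rintegral m setT f)%:E.
Proof. by move=> h; rewrite /Rintegral fineK //; exact: integrable_fin_num. Qed.

(** The product majorant makes the iterated integral of the absolute value finite, as Tonelli's
    criterion requires. *)
Lemma integrable_prod : (m1 \x m2)%E.-integrable setT (EFin \o G).
Proof.
apply/integrable12ltyP; first exact/measurable_EFinP.
apply: (@le_lt_trans _ _ (\int[m1]_x ((C * fine (\int[m2]_y (k2 y)%:E))%:E * (k1 x)%:E))%E).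
  apply: ge0_le_integral => //.
  - by move=> x _; apply: integral_ge0.
  - apply: (measurable_fun_fubini_tonelli_F (fun z => `|(G z)%:E|%E)) => //.
    by apply/measurableT_comp => //; exact/measurable_EFinP.
  - by apply: emeasurable_funM => //; exact: measurable_int i1.
  - move=> x _.
    apply: (@le_trans _ _ (\int[m2]_y ((C * k1 x)%:E * (k2 y)%:E))%E).
      apply: ge0_le_integral => //.
      + apply/measurableT_comp => //; apply/measurable_EFinP.
        exact: measurableT_comp mG (measurable_pair1 x).
      + by apply: emeasurable_funM => //; exact: measurable_int i2.
      + by move=> y _; rewrite -EFinM lee_fin.
    rewrite integralZl // (_ : (\int[m2]_y _)%E = (fine (\int[m2]_y (k2 y)%:E))%:E).
      by rewrite -!EFinM lee_fin mulrAC.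
    by rewrite fineK //; exact: integrable_fin_num i2.
rewrite integralZl // (Rintegral_EFin i1) -EFinM; exact: ltry.
Qed.

Lemma Rintegral12 :
  Rintegral m1 setT (fun x => Rintegral m2 setT (fun y => G (x, y))) =
  Rintegral (m1 \x m2)%E setT G.
Proof.
rewrite /Rintegral -(integral12_prod_meas1 integrable_prod); congr fine.
by apply: eq_integral => x _; rewrite /fubini_F (Rintegral_EFin (integrable_section1 x)).
Qed.

Lemma Rintegral21 :
  Rintegral m2 setT (fun y => Rintegral m1 setT (fun x => G (x, y))) =
  Rintegral (m1 \x m2)%E setT G.
Proof.
rewrite /Rintegral -(integral21_prod_meas1 integrable_prod); congr fine.
by apply: eq_integral => y _; rewrite /fubini_G (Rintegral_EFin (integrable_section2 y)).
Qed.

End dominated_fubini.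

(** * Integrals over the line and the Poisson kernel *)

Section real_line.
Context {R : realType}.
Local Notation mu := (@lebesgue_measure R).
Implicit Types (f F G : R -> R) (x y t e C : R).

(** The common integrable majorant: its products over the coordinates dominate every integrand on
    tuples and vectors below. *)
Definition ker1 x : R := (1 + x ^+ 2)^-1.

Lemma ker1_gt0 x : 0 < ker1 x.
Proof. by rewrite invr_gt0 ltr_wpDr ?sqr_ge0. Qed.

Lemma ker1_ge0 x : 0 <= ker1 x. Proof. exact/ltW/ker1_gt0. Qed.

Lemma ker1_le1 x : ker1 x <= 1.
Proof. by rewrite invf_le1 ?ltr_wpDr ?sqr_ge0 // lerDl sqr_ge0. Qed.

Lemma continuous_ker1 : continuous (ker1 : R -> R).
Proof. exact: continuous_oneDsqrV. Qed.

Lemma ker1N x : ker1 (- x) = ker1 x. Proof. by rewrite /ker1 sqrrN. Qed.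

Lemma ge0_integral_halves f : (forall x, 0 <= f x) -> continuous f ->
  (\int[mu]_x (f x)%:E = \int[mu]_(x in `[0%R, +oo[) (f x)%:E +
     \int[mu]_(x in `[0%R, +oo[) (f (- x))%:E)%E.
Proof.
move=> f0 cf.
have mf : measurable_fun [set: R] f by exact: continuous_measurable_fun.
rewrite -(setUv `[0%R, +oo[%classic) ge0_integral_setU //=; last 4 first.
- exact: measurableC.
- by apply/measurable_EFinP; rewrite setUv.
- by move=> x _; rewrite lee_fin.
- exact/disj_setPCl.
congr (_ + _)%E; rewrite setCitvr.
rewrite integral_itv_bndo_bndc; last exact/measurable_EFinP/measurable_funTS.
rewrite -{1}oppr0 ge0_integration_by_substitutionNy //.
exact: continuous_subspaceT.
Qed.

Lemma ge0_integral_halfline f F l : (forall x, 0 <= f x) -> continuous f ->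
  continuous F -> (forall x, 0 < x -> is_derive x (1 : R) F (f x)) ->
  F x @[x --> +oo] --> l ->
  (\int[mu]_(x in `[0%R, +oo[) (f x)%:E = (l - F 0)%:E)%E.
Proof.
move=> f0 cf cF dF lF; rewrite (@ge0_continuous_FTC2y _ f F 0 l) ?EFinB //.
- exact: continuous_subspaceT.
- by move=> x /dF h; exact: ex_derive.
- by apply: cvg_at_right_filter; exact: cF.
- by move=> x; rewrite in_itv /= andbT => /dF h; rewrite derive1E; exact: derive_val.
Qed.

(** [G] is an antiderivative of the reflected integrand, so the negative half-line is treated as a
    second positive one. *)
Lemma ge0_integral_line f F G l l' : (forall x, 0 <= f x) -> continuous f ->
  continuous F -> (forall x, 0 < x -> is_derive x (1 : R) F (f x)) ->
  F x @[x --> +oo] --> l ->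
  continuous G -> (forall x, 0 < x -> is_derive x (1 : R) G (f (- x))) ->
  G x @[x --> +oo] --> l' ->
  (\int[mu]_x (f x)%:E = (l - F 0 + (l' - G 0))%:E)%E.
Proof.
move=> f0 cf cF dF lF cG dG lG; rewrite ge0_integral_halves //.
rewrite (ge0_integral_halfline f0 cf cF dF lF).
rewrite (ge0_integral_halfline (f := fun x => f (- x)) _ _ cG dG lG) //.
by move=> x; apply: continuous_comp; [exact: opp_continuous|exact: cf].
Qed.

(* The Poisson kernel up to a factor [pi]. *)
Definition poisson e x : R := e / (e ^+ 2 + x ^+ 2).

Lemma poisson1 x : poisson 1 x = ker1 x.
Proof. by rewrite /poisson expr1n mul1r. Qed.

Lemma poisson_ge0 e x : 0 < e -> 0 <= poisson e x.
Proof. by move=> e0; rewrite divr_ge0 ?addr_ge0 ?sqr_ge0 // ltW. Qed.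

Lemma sqrD_gt0 e x : 0 < e -> 0 < e ^+ 2 + x ^+ 2.
Proof. by move=> e0; rewrite ltr_wpDr ?sqr_ge0 // exprn_gt0. Qed.

Lemma continuous_poisson e : 0 < e -> continuous (poisson e).
Proof.
move=> e0 x; apply: cvgM; first exact: cvg_cst.
apply: cvgV; first by rewrite gt_eqF // sqrD_gt0.
by apply: cvgD; [exact: cvg_cst|exact: exprn_continuous].
Qed.

Let is_derive_scale f e x (d : R) : is_derive (x / e) (1 : R) f d ->
  is_derive x (1 : R) (fun y => f (y / e)) (d / e).
Proof.
move=> hf; have hs : is_derive x (1 : R) (fun y : R => y / e) e^-1.
  have := is_deriveZ (e^-1 : R) (is_derive_id x (1 : R)).
  rewrite /GRing.scale /= mulr1 => h.
  have -> : (fun y : R => y / e) = (fun y => e^-1 * y) by apply/funext => y; rewrite mulrC.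
  exact: h.
have := @is_derive1_comp _ f (fun y : R => y / e) x d e^-1 hf hs; exact.
Qed.

Lemma integral_poisson e a : 0 < e -> (\int[mu]_x (poisson e (x - a))%:E = pi%:E)%E.
Proof.
move=> e0.
pose F b x := atan ((x - b) / e).
have cd b x : is_derive x (1 : R) (F b) (poisson e (x - b)).
  have h y : is_derive (y / e) (1 : R) atan (1 + (y / e) ^+ 2)^-1.
    have -> : (1 + (y / e) ^+ 2)^-1 = derive1 atan (y / e) by rewrite derive1_atan.
    by rewrite derive1E; apply/derivableP; exact: derivable_atan.
  have hs : is_derive x (1 : R) (fun y : R => y - b) 1.
    by apply: is_derive_eq; rewrite subr0.
  have := @is_derive1_comp _ (fun y => atan (y / e)) (fun y => y - b) x _ 1 (is_derive_scale (h (x - b))) hs.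
  move=> H; apply: is_derive_eq H _.
  rewrite /poisson mulr1; field; rewrite !gt_eqF ?sqrD_gt0 //=.
have cF b : continuous (F b).
  by move=> x; apply/differentiable_continuous/derivable1_diffP; exact: ex_derive.
have lF b : F b x @[x --> +oo] --> pi / 2.
  apply: cvg_comp (@cvgy_atan R).
  apply: gt0_cvgMly; first by rewrite invr_gt0.
  exact: cvg_addrr.
apply: etrans (_ : (pi / 2 - F a 0 + (pi / 2 - F (- a) 0))%:E = _).
  apply: (@ge0_integral_line (fun x => poisson e (x - a)) (F a) (F (- a)) (pi / 2) (pi / 2)) => //.
  - by move=> x; exact: poisson_ge0.
  - move=> x; apply: (@continuous_comp _ _ _ (fun x => x - a) (poisson e)).
      by apply: cvgB; [exact: cvg_id|exact: cvg_cst].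
    exact: continuous_poisson.
  (* The kernel is even, so reflection only moves its centre from [a] to [- a]. *)
  - move=> x _; have -> : poisson e (- x - a) = poisson e (x - (- a)).
      by rewrite /poisson; congr (_ / (_ + _)); ring.
    exact: cd.
by rewrite /F !sub0r opprK mulNr atanN; congr EFin; field.
Qed.

Lemma integrable_ker1 : mu.-integrable setT (EFin \o ker1).
Proof.
apply/integrableP; split.
  by apply/measurable_EFinP; apply: continuous_measurable_fun; exact: continuous_ker1.
rewrite (_ : (\int[mu]_x _)%E = (\int[mu]_x (poisson 1 (x - 0))%:E)%E).
  by rewrite integral_poisson // ltry.
by apply: eq_integral => x _; rewrite /= subr0 poisson1 ger0_norm // ker1_ge0.
Qed.

Lemma integral_ker1 : (\int[mu]_x (ker1 x)%:E = pi%:E)%E.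
Proof.
rewrite -(integral_poisson 0 ltr01).
by apply: eq_integral => x _; rewrite subr0 poisson1.
Qed.

(** Adding [C * ker1] makes the integrand nonnegative; its known integral [C * pi] is subtracted
    afterwards. *)
Lemma Rintegral_line f F G C : continuous f -> (forall x, `|f x| <= C * ker1 x) ->
  continuous F -> (forall x, 0 < x -> is_derive x (1 : R) F (f x)) ->
  F x @[x --> +oo] --> (0 : R) ->
  continuous G -> (forall x, 0 < x -> is_derive x (1 : R) G (f (- x))) ->
  G x @[x --> +oo] --> (0 : R) ->
  Rintegral mu setT f = - F 0 - G 0.
Proof.
move=> cf hf cF dF lF cG dG lG.
pose f1 x := f x + C * ker1 x.
have cf1 : continuous f1.
  by move=> x; apply: cvgD; [exact: cf|apply: cvgM; [exact: cvg_cst|exact: continuous_ker1]].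
have f10 x : 0 <= f1 x by have := hf x; rewrite ler_norml /f1 => /andP[]; lra.
have da x : is_derive x (1 : R) (fun y => C * atan y) (C * ker1 x).
  have h : is_derive x (1 : R) atan (ker1 x).
    have -> : ker1 x = derive1 atan x by rewrite derive1_atan.
    by rewrite derive1E; apply/derivableP; exact: derivable_atan.
  exact: is_deriveZ h.
have ca : continuous (fun y => C * atan y).
  by move=> x; apply/differentiable_continuous/derivable1_diffP; exact: ex_derive.
have la : C * atan x @[x --> +oo] --> C * (pi / 2).
  by apply: cvgM; [exact: cvg_cst|exact: cvgy_atan].
have mf : measurable_fun [set: R] f by exact: continuous_measurable_fun.
have If : mu.-integrable setT (EFin \o f) by exact: dominated_integrable integrable_ker1 hf.
have IK : mu.-integrable setT (EFin \o (fun x => C * ker1 x)).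
  exact: (integrableZl measurableT C integrable_ker1).
have H1 : Rintegral mu setT f1 = - F 0 - G 0 + C * pi.
  apply: (@etrans _ _ (0 + C * (pi / 2) - (F 0 + C * atan 0) +
     (0 + C * (pi / 2) - (G 0 + C * atan 0)))); last by rewrite atan0; field.
  rewrite /Rintegral -[RHS]/(fine _%:E); congr fine.
  apply: (@ge0_integral_line f1 (fun x => F x + C * atan x)
     (fun x => G x + C * atan x) (0 + C * (pi / 2)) (0 + C * (pi / 2))) => //=.
  - by move=> x; apply: cvgD; [exact: cF|exact: ca].
  - by move=> x x0; exact: is_deriveD (dF x x0) (da x).
  - exact: cvgD.
  - by move=> x; apply: cvgD; [exact: cG|exact: ca].
  - move=> x x0; rewrite /f1 ker1N; exact: is_deriveD (dG x x0) (da x).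
  - exact: cvgD.
have H2 : Rintegral mu setT (fun x => C * ker1 x) = C * pi.
  rewrite RintegralZl //; last exact: integrable_ker1.
  by rewrite /Rintegral integral_ker1.
have H3 : Rintegral mu setT f1 = Rintegral mu setT f + C * pi by rewrite RintegralD // H2.
by apply: (addIr (C * pi)); rewrite -H3 H1.
Qed.

Lemma dominated_cvg0 f C : (forall x, `|f x| <= C * ker1 x) -> f x @[x --> +oo] --> (0 : R).
Proof.
move=> hf; apply/cvgrPdist_le => e e0; near=> x.
rewrite sub0r normrN; apply: (le_trans (hf x)).
have x0 : 0 < x by near: x; exact: nbhs_pinfty_gt.
have xC : `|C| / e <= x by near: x; apply: nbhs_pinfty_ge; rewrite num_real.
have x1 : 1 <= x by near: x; apply: nbhs_pinfty_ge; rewrite num_real.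
rewrite ler_pdivrMr; last by rewrite ltr_wpDr ?sqr_ge0.
move: xC; rewrite ler_pdivrMr // => xC.
apply: (le_trans (ler_norm C)); apply: (le_trans xC); rewrite mulrC ler_wpM2l ?(ltW e0) //.
rewrite expr2; nra.
Unshelve. all: by end_near. Qed.

Lemma Rintegral_derive0 F f C : (forall x, is_derive x (1 : R) F (f x)) -> continuous f ->
  (forall x, `|F x| <= C * ker1 x) -> (forall x, `|f x| <= C * ker1 x) ->
  Rintegral mu setT f = 0.
Proof.
move=> dF cf hF hf.
have cF : continuous F.
  by move=> x; apply/differentiable_continuous/derivable1_diffP; exact: ex_derive.
transitivity (- F 0 - (- F (- 0))); last by rewrite oppr0 opprK addNr.
apply: (@Rintegral_line f F (fun x => - F (- x)) C) => //.
- exact: dominated_cvg0 hF.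
- move=> x; apply: cvgN; apply: continuous_comp; [exact: opp_continuous|exact: cF].
- move=> x _.
  have h := @is_derive1_comp _ F (fun y : R => - y) x (f (- x)) (-1) (dF _) (is_deriveNid _ _).
  apply: is_derive_eq (is_deriveN h) _; ring.
- apply: (@dominated_cvg0 _ C) => x.
  by rewrite normrN -(ker1N x).
Qed.

End real_line.

(** * Complex-valued integrals *)

Section complex_integral.
Context d (X : measurableType d) (R : realType) (m : {measure set X -> \bar R}).
Implicit Types (F G : X -> R[i]) (k : X -> R) (C : R).

Definition Cint F : R[i] :=
  Rintegral m setT (fun x => complex.Re (F x)) +i*
  Rintegral m setT (fun x => complex.Im (F x)).

Definition cmeasurable F := measurable_fun setT (fun x => complex.Re (F x)) /\
  measurable_fun setT (fun x => complex.Im (F x)).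

Definition cintegrable F := m.-integrable setT (EFin \o (fun x => complex.Re (F x))) /\
  m.-integrable setT (EFin \o (fun x => complex.Im (F x))).

Lemma cintegrable_dominated F k C : cmeasurable F -> m.-integrable setT (EFin \o k) ->
  (forall x, cmod (F x) <= C * k x) -> cintegrable F.
Proof.
move=> [mr mi] ik hF; split; apply: (dominated_integrable (g := k) (D := C)) => // x.
  exact: le_trans (Re_le_cmod _) (hF x).
exact: le_trans (Im_le_cmod _) (hF x).
Qed.

Lemma CintD F G : cintegrable F -> cintegrable G ->
  Cint (fun x => F x + G x) = Cint F + Cint G.
Proof.
move=> [fr fi] [gr gi]; rewrite /Cint.
have -> : (fun x => complex.Re (F x + G x)) = (fun x => complex.Re (F x) + complex.Re (G x)).
  by apply/funext => x; case: (F x); case: (G x).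
have -> : (fun x => complex.Im (F x + G x)) = (fun x => complex.Im (F x) + complex.Im (G x)).
  by apply/funext => x; case: (F x); case: (G x).
by rewrite !RintegralD.
Qed.

Lemma CintZ (c : R[i]) F : cintegrable F -> Cint (fun x => c * F x) = c * Cint F.
Proof.
move=> [fr fi]; rewrite /Cint; case: c => a b.
have -> : (fun x => complex.Re ((a +i* b) * F x)) =
    (fun x => a * complex.Re (F x) - b * complex.Im (F x)).
  by apply/funext => x; case: (F x).
have -> : (fun x => complex.Im ((a +i* b) * F x)) =
    (fun x => a * complex.Im (F x) + b * complex.Re (F x)).
  by apply/funext => x; case: (F x).
have iZ (u : R) f : m.-integrable setT (EFin \o f) ->
    m.-integrable setT (EFin \o (fun x => u * f x)).
  by move=> h; exact: (integrableZl measurableT u h).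
rewrite RintegralB ?RintegralD ?RintegralZl //; do ?exact: iZ.
Qed.

(** The factor 2 comes from bounding the real and imaginary parts separately; it recurs in all
    bounds on Fourier transforms. *)
Lemma Cint_le F k C I : cmeasurable F -> m.-integrable setT (EFin \o k) ->
  Rintegral m setT k = I ->
  (forall x, cmod (F x) <= C * k x) -> cmod (Cint F) <= 2 * (C * I).
Proof.
move=> mF ik kI hF; have [fr fi] := cintegrable_dominated mF ik hF.
have iCk : m.-integrable setT (EFin \o (fun x => C * k x)) := integrableZl measurableT C ik.
have H f : m.-integrable setT (EFin \o f) -> (forall x, `|f x| <= C * k x) ->
    `|Rintegral m setT f| <= C * I.
  move=> jf hf; apply: (le_trans (le_normr_Rintegral measurableT jf)).
  rewrite -kI -RintegralZl //; apply: le_Rintegral => //.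
  exact: (integrable_norm jf).
apply: (le_trans (cmod_le _)); rewrite mulr_natl mulr2n lerD // H // => x.
  exact: le_trans (Re_le_cmod _) (hF x).
exact: le_trans (Im_le_cmod _) (hF x).
Qed.

End complex_integral.

Section complex_fubini.
Context d1 d2 (X : measurableType d1) (Y : measurableType d2) (R : realType).
Variables (m1 : {sigma_finite_measure set X -> \bar R})
          (m2 : {sigma_finite_measure set Y -> \bar R}).

Lemma Cint_fubini (k1 : X -> R) (k2 : Y -> R) (G : X * Y -> R[i]) (C : R) :
  m1.-integrable setT (EFin \o k1) -> m2.-integrable setT (EFin \o k2) ->
  cmeasurable G -> (forall x y, cmod (G (x, y)) <= C * k1 x * k2 y) ->
  Cint m1 (fun x => Cint m2 (fun y => G (x, y))) = Cint (m1 \x m2)%E G /\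
  Cint m2 (fun y => Cint m1 (fun x => G (x, y))) = Cint (m1 \x m2)%E G.
Proof.
move=> i1 i2 [mr mi] hG.
have hr x y : `|complex.Re (G (x, y))| <= C * k1 x * k2 y.
  exact: le_trans (Re_le_cmod _) (hG x y).
have hi x y : `|complex.Im (G (x, y))| <= C * k1 x * k2 y.
  exact: le_trans (Im_le_cmod _) (hG x y).
rewrite /Cint; split; congr (_ +i* _).
- exact (@Rintegral12 _ _ _ _ _ m1 m2 k1 k2 i1 i2 _ C mr hr).
- exact (@Rintegral12 _ _ _ _ _ m1 m2 k1 k2 i1 i2 _ C mi hi).
- exact (@Rintegral21 _ _ _ _ _ m1 m2 k1 k2 i1 i2 _ C mr hr).
- exact (@Rintegral21 _ _ _ _ _ m1 m2 k1 k2 i1 i2 _ C mi hi).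
Qed.

End complex_fubini.

(** * Iterated integrals over tuples *)

Section tuple_integrals.
Context {R : realType}.
Local Notation T := (measurableTypeR R).
Local Notation mu := (@lebesgue_measure R).
Local Notation L n := (lebesgue_Rn R n).
Implicit Types (n : nat) (C : R).

Definition tcons n (p : T * n.-tuple T) : n.+1.-tuple T := [tuple of p.1 :: p.2].

Lemma measurable_tcons n : measurable_fun setT (@tcons n).
Proof. exact: measurable_cons. Qed.

Definition kern n (t : n.-tuple T) : R := \prod_(i < n) ker1 (tnth t i).

Lemma kern_gt0 n (t : n.-tuple T) : 0 < kern t.
Proof. by apply: prodr_gt0 => i _; exact: ker1_gt0. Qed.

Lemma kern_tcons n (x : T) (t : n.-tuple T) : kern (tcons (x, t)) = ker1 x * kern t.
Proof.
rewrite /kern big_ord_recl; congr (_ * _).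
by apply: eq_bigr => i _; rewrite /tcons tnthS.
Qed.

Lemma measurable_ker1 : measurable_fun setT (ker1 : T -> R).
Proof. by apply: continuous_measurable_fun; exact: continuous_ker1. Qed.

Lemma measurable_prod_tnth n (a : 'I_n -> T -> R) :
  (forall i, measurable_fun setT (a i)) ->
  measurable_fun setT (fun t : n.-tuple T => \prod_(i < n) a i (tnth t i)).
Proof.
move=> ma; apply: measurable_prod => i _.
exact: measurableT_comp (ma i) (measurable_tnth i).
Qed.

Lemma measurable_kern n : measurable_fun setT (@kern n).
Proof. exact (@measurable_prod_tnth n (fun=> ker1) (fun=> measurable_ker1)). Qed.

Lemma integral_lebesgue_RnS n (F : n.+1.-tuple T -> \bar R) :
  measurable_fun setT F -> (mu \x L n)%E.-integrable setT (F \o @tcons n) ->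
  (\int[L n.+1]_t F t = \int[mu \x L n]_p F (tcons p))%E.
Proof.
move=> mF iF; rewrite -[RHS]/(\int[(mu \x L n)%E]_p (F \o @tcons n) p)%E.
have := @integral_pushforward _ _ _ _ _ (@tcons n) (@measurable_tcons n) (mu \x L n)%E setT F mF.
rewrite preimage_setT => /(_ iF measurableT) <-.
apply: eq_measure_integral; first exact: measurable_tcons.
by move=> mt A mA _.
Qed.

Lemma integrable_lebesgue_RnS n (F : n.+1.-tuple T -> \bar R) :
  measurable_fun setT F -> (mu \x L n)%E.-integrable setT (F \o @tcons n) ->
  (L n.+1).-integrable setT F.
Proof.
move=> mF iF.
have := @integrable_pushforward _ _ _ _ _ (@tcons n) (@measurable_tcons n) (mu \x L n)%E setT F mF.
by rewrite preimage_setT => /(_ iF measurableT).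
Qed.

Lemma Rintegral_RnS n (F : n.+1.-tuple T -> R) :
  measurable_fun setT F -> (mu \x L n)%E.-integrable setT (EFin \o (F \o @tcons n)) ->
  Rintegral (L n.+1) setT F = Rintegral (mu \x L n)%E setT (F \o @tcons n).
Proof.
move=> mF iF; rewrite /Rintegral integral_lebesgue_RnS //.
exact/measurable_EFinP.
Qed.

Lemma lebesgue_R0T : L 0 setT = 1%E.
Proof. exact: (diracT R ([tuple] : 0.-tuple T)). Qed.

Lemma Rintegral_R0 (r : R) : Rintegral (L 0) setT (fun=> r) = r.
Proof.
rewrite Rintegral_cst // [X in _ * X](_ : _ = 1) ?mulr1 //.
exact: (congr1 fine lebesgue_R0T).
Qed.

Lemma integral_kern n : (L n).-integrable setT (EFin \o @kern n) /\
  Rintegral (L n) setT (@kern n) = pi ^+ n.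
Proof.
elim: n => [|n [IH1 IH2]].
  have E : @kern 0 = fun=> 1 by apply/funext => t; rewrite /kern big_ord0.
  rewrite E; split; last first.
    exact: Rintegral_R0.
  apply/integrableP; split; first exact/measurable_EFinP.
  under eq_integral do rewrite /= normr1.
  rewrite integral_cst // [X in (_ * X)%E](_ : _ = 1%E) ?mule1 ?ltry //.
  exact: lebesgue_R0T.
have k0 (x : T) : 0 <= ker1 x by exact: ker1_ge0.
have kn0 (t : n.-tuple T) : 0 <= kern t by exact/ltW/kern_gt0.
have mk : measurable_fun setT (@kern n.+1 \o @tcons n).
  exact: measurableT_comp (@measurable_kern _) (@measurable_tcons n).
have hk (x : T) (t : n.-tuple T) : `|(@kern n.+1 \o @tcons n) (x, t)| <= 1 * ker1 x * kern t.
  by rewrite /= kern_tcons mul1r ger0_norm // mulr_ge0.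
have ip := @integrable_prod _ _ _ _ _ mu (L n) _ _ (@integrable_ker1 R) IH1 _ 1 mk hk.
split.
  apply: integrable_lebesgue_RnS => //.
  by apply/measurable_EFinP; exact: measurable_kern.
rewrite Rintegral_RnS //; last exact: measurable_kern.
rewrite -(@Rintegral12 _ _ _ _ _ mu (L n) _ _ (@integrable_ker1 R) IH1 _ 1 mk hk).
under eq_Rintegral => x _.
  under eq_Rintegral => t _ do rewrite /= kern_tcons.
  rewrite RintegralZl // IH2; over.
rewrite RintegralZr //; last exact: integrable_ker1.
by rewrite {1}/Rintegral integral_ker1 exprS.
Qed.

Lemma Rintegral_cst0 d (X : measurableType d) (m : {measure set X -> \bar R}) :
  Rintegral m setT (fun=> 0) = 0.
Proof. by rewrite /Rintegral integral0. Qed.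

(** Both orders serve in [Rint_derive0]: the differentiated coordinate has to be innermost, while a
    coordinate that is a mere parameter is stripped off from outside. *)
Lemma Rint_cons n (F : n.+1.-tuple T -> R) C : measurable_fun setT F ->
  (forall t, `|F t| <= C * kern t) ->
  Rintegral (L n.+1) setT F =
    Rintegral mu setT (fun x : T => Rintegral (L n) setT (fun t => F (tcons (x, t)))) /\
  Rintegral (L n.+1) setT F =
    Rintegral (L n) setT (fun t => Rintegral mu setT (fun x : T => F (tcons (x, t)))).
Proof.
move=> mF hF; have [ik _] := integral_kern n.
have mG : measurable_fun setT (F \o @tcons n) := measurableT_comp mF (@measurable_tcons n).
have hG (x : T) (t : n.-tuple T) : `|(F \o @tcons n) (x, t)| <= C * ker1 x * kern t.
  by rewrite -mulrA -kern_tcons; exact: hF.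
have ip := @integrable_prod _ _ _ _ _ mu (L n) _ _ (@integrable_ker1 R) ik _ C mG hG.
rewrite Rintegral_RnS //.
by rewrite -{1}(@Rintegral12 _ _ _ _ _ mu (L n) _ _ (@integrable_ker1 R) ik _ C mG hG)
   -{1}(@Rintegral21 _ _ _ _ _ mu (L n) _ _ (@integrable_ker1 R) ik _ C mG hG).
Qed.

Lemma cmeasurable_comp d d' (X : measurableType d) (Y : measurableType d')
  (F : Y -> R[i]) (p : X -> Y) : measurable_fun setT p -> cmeasurable F ->
  cmeasurable (fun x => F (p x)).
Proof.
by move=> mp [mr mi]; split; [exact: (measurableT_comp mr mp)|exact: (measurableT_comp mi mp)].
Qed.

Lemma Cint_cons n (F : n.+1.-tuple T -> R[i]) C : cmeasurable F ->
  (forall t, cmod (F t) <= C * kern t) ->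
  Cint (L n.+1) F = Cint mu (fun x : T => Cint (L n) (fun t => F (tcons (x, t)))) /\
  Cint (L n.+1) F = Cint (L n) (fun t => Cint mu (fun x : T => F (tcons (x, t)))).
Proof.
move=> [mr mi] hF.
have [r1 r2] := Rint_cons mr (fun t => le_trans (Re_le_cmod _) (hF t)).
have [i1 i2] := Rint_cons mi (fun t => le_trans (Im_le_cmod _) (hF t)).
by rewrite /Cint; split; congr (_ +i* _).
Qed.

Definition upd n (t : n.-tuple T) (i : 'I_n) (s : T) : n.-tuple T :=
  [tuple (if j == i then s else tnth t j) | j < n].

Lemma upd0 n (x s : T) (t : n.-tuple T) : upd (tcons (x, t)) ord0 s = tcons (s, t).
Proof.
apply: eq_from_tnth => j; rewrite tnth_mktuple.
by case: (unliftP ord0 j) => [j' ->|->] //=; rewrite /tcons !tnthS.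
Qed.

Lemma upd_lift n (x s : T) (t : n.-tuple T) i :
  upd (tcons (x, t)) (lift ord0 i) s = tcons (x, upd t i s).
Proof.
apply: eq_from_tnth => j; rewrite tnth_mktuple.
case: (unliftP ord0 j) => [j' ->|->] //=.
by rewrite /tcons !tnthS tnth_mktuple (inj_eq lift_inj).
Qed.

(** The integral over the differentiated coordinate vanishes by the fundamental theorem of calculus;
    the induction removes the coordinates in front of it. *)
Lemma Rint_derive0 n (i : 'I_n) (F f : n.-tuple T -> R) C : measurable_fun setT f ->
  (forall t, `|F t| <= C * kern t) -> (forall t, `|f t| <= C * kern t) ->
  (forall t (s : R), is_derive s (1 : R) (fun s : R => F (upd t i s)) (f (upd t i s))) ->
  (forall t, continuous (fun s : R => f (upd t i s))) ->
  Rintegral (L n) setT f = 0.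
Proof.
elim: n i F f C => [|n IH] i F f C; first by case: i.
move=> mf hF hf dF cf; have [E1 E2] := Rint_cons mf hf.
case: (unliftP ord0 i) => [j ij|i0].
  rewrite E1 -[RHS](Rintegral_cst0 mu); apply: eq_Rintegral => x _.
  apply: (IH j (fun t => F (tcons (x, t))) _ (C * ker1 x)).
  - apply: (measurableT_comp mf); apply: (measurableT_comp (@measurable_tcons n)).
    exact: measurable_pair1.
  - by move=> t; rewrite -mulrA -kern_tcons.
  - by move=> t; rewrite -mulrA -kern_tcons.
  - move=> t s; have := dF (tcons (x, t)) s; rewrite ij upd_lift.
    by under eq_fun do rewrite upd_lift.
  - by move=> t; have := cf (tcons (x, t)); rewrite ij; under eq_fun do rewrite upd_lift.
rewrite E2 -[RHS](Rintegral_cst0 (L n)); apply: eq_Rintegral => t _.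
apply: (@Rintegral_derive0 _ (fun x => F (tcons (x, t))) _ (C * kern t)).
- move=> s; have := dF (tcons (0, t)) s; rewrite i0 upd0.
  by under eq_fun do rewrite upd0.
- by have := cf (tcons (0, t)); rewrite i0; under eq_fun do rewrite upd0.
- by move=> x; rewrite mulrAC -mulrA -kern_tcons.
- by move=> x; rewrite mulrAC -mulrA -kern_tcons.
Qed.

Lemma cmeasurableM d (X : measurableType d) (F G : X -> R[i]) :
  cmeasurable F -> cmeasurable G -> cmeasurable (fun x => F x * G x).
Proof.
move=> [fr fi] [gr gi]; split.
  have -> : (fun x => complex.Re (F x * G x)) =
    (fun x => complex.Re (F x) * complex.Re (G x) - complex.Im (F x) * complex.Im (G x)).
    by apply/funext => x; case: (F x); case: (G x).
  by apply: measurable_funB; exact: measurable_funM.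
have -> : (fun x => complex.Im (F x * G x)) =
    (fun x => complex.Re (F x) * complex.Im (G x) + complex.Im (F x) * complex.Re (G x)).
  by apply/funext => x; case: (F x); case: (G x).
by apply: measurable_funD; exact: measurable_funM.
Qed.

Lemma cmeasurable_prod d (X : measurableType d) (I : Type) (s : seq I) (F : I -> X -> R[i]) :
  (forall i, cmeasurable (F i)) -> cmeasurable (fun x => \prod_(i <- s) F i x).
Proof.
move=> hF; elim: s => [|i s IH].
  have -> : (fun x => \prod_(i <- [::]) F i x) = fun=> 1.
    by apply/funext => x; rewrite big_nil.
  by split; exact: measurable_cst.
have -> : (fun x => \prod_(j <- i :: s) F j x) = fun x => F i x * \prod_(j <- s) F j x.
  by apply/funext => x; rewrite big_cons.
exact: cmeasurableM.
Qed.

Lemma cmod_prod (I : Type) (s : seq I) (F : I -> R[i]) :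
  cmod (\prod_(i <- s) F i) = \prod_(i <- s) cmod (F i).
Proof.
elim: s => [|i s IH]; first by rewrite !big_nil /cmod Normc.normc1.
by rewrite !big_cons cmodM IH.
Qed.

Lemma Cint_prod n (a : 'I_n -> T -> R[i]) C : (forall i, cmeasurable (a i)) ->
  (forall i x, cmod (a i x) <= C * ker1 x) ->
  Cint (L n) (fun t => \prod_(i < n) a i (tnth t i)) = \prod_(i < n) Cint mu (a i).
Proof.
move=> ma ha; elim: n a ma ha => [|n IH] a ma ha.
  rewrite big_ord0 /Cint.
  under eq_Rintegral do rewrite big_ord0.
  under [X in _ +i* X]eq_Rintegral do rewrite big_ord0.
  by rewrite !Rintegral_R0.
have mp k (b : 'I_k -> T -> R[i]) : (forall i, cmeasurable (b i)) ->
    cmeasurable (fun t : k.-tuple T => \prod_(i < k) b i (tnth t i)).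
  move=> mb; apply: cmeasurable_prod => i.
  exact: cmeasurable_comp (measurable_tnth i) (mb i).
have hp k (b : 'I_k -> T -> R[i]) : (forall i x, cmod (b i x) <= C * ker1 x) ->
    forall t : k.-tuple T, cmod (\prod_(i < k) b i (tnth t i)) <= C ^+ k * kern t.
  move=> hb t; rewrite cmod_prod.
  have -> : C ^+ k * kern t = \prod_(i < k) (C * ker1 (tnth t i)).
    by rewrite big_split /= prodr_const card_ord.
  by apply: ler_prod => i _; rewrite cmod_ge0 hb.
have [-> _] := Cint_cons (mp _ a ma) (hp _ a ha).
have [ik _] := integral_kern n.
have I1 := cintegrable_dominated (mp _ _ (fun i => ma (lift ord0 i))) ik
  (hp _ _ (fun i => ha (lift ord0 i))).
have E (x : T) : Cint (L n) (fun t => \prod_(i < n.+1) a i (tnth (tcons (x, t)) i)) =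
    (\prod_(i < n) Cint mu (a (lift ord0 i))) * a ord0 x.
  rewrite mulrC -(IH (fun i => a (lift ord0 i)) (fun i => ma _) (fun i => ha _)) -CintZ //.
  congr Cint; apply/funext => t; rewrite big_ord_recl; congr (_ * _).
  by apply: eq_bigr => i _; rewrite /tcons tnthS.
under [X in Cint mu X]eq_fun do rewrite E.
rewrite CintZ; first by rewrite big_ord_recl mulrC.
exact: cintegrable_dominated (ma ord0) (@integrable_ker1 R) (ha ord0).
Qed.

End tuple_integrals.

(** * The Fourier transform *)

Section fourier_basics.
Context {R : realType} {N : nat}.
Local Notation V := 'rV[R]_N.
Local Notation T := (measurableTypeR R).
Local Notation L := (lebesgue_Rn R N).
Local Notation vec := (@vec_of_tuple R N).
Local Notation e j := (delta_mx 0 j : V).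
Implicit Types (f g h : V -> R[i]) (x y xi : V) (C : R) (j : 'I_N).

(** An open set is a countable union of balls with rational centre and radius. Balls of the sup norm
    are boxes, which belong to the product sigma-algebra. *)
Lemma open_vec_measurable (U : set V) : open U -> measurable (vec @^-1` U).
Proof.
move=> oU.
pose q2v (q : N.-tuple rat) : V := \row_j ratr (tnth q j).
pose F (p : N.-tuple rat * rat) : set (N.-tuple T) :=
  if `[< (0 : R) < ratr p.2 /\ ball (q2v p.1) (ratr p.2 : R) `<=` U >]
  then vec @^-1` (ball (q2v p.1) (ratr p.2 : R)) else set0.
have -> : vec @^-1` U = \bigcup_p F p.
  apply/seteqP; split => [t /= Ut|t [p _]]; last first.
    by rewrite /F; case: asboolP => // -[_ sU] /=; exact: sU.
  have /nbhs_ballP[eps /= e0 eU] : nbhs (vec t) U by exact: open_nbhs_nbhs.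
  (* A ball that contains [vec t] reaches at most twice its radius away from it, so a radius below
     [eps / 2] keeps it inside [U]. *)
  have [r] : exists r : rat, (ratr r : R) \in `]0, (eps / 2)[.
    by apply: rat_in_itvoo; rewrite divr_gt0.
  rewrite in_itv /= => /andP[r0 re].
  have hq j : exists q : rat, (ratr q : R) \in `](tnth t j - ratr r), (tnth t j + ratr r)[.
    by apply: rat_in_itvoo; rewrite ltrD2l; lra.
  have [q hq'] := choice hq.
  have bq : ball (q2v [tuple q j | j < N]) (ratr r : R) (vec t).
    split => // i j; rewrite !mxE tnth_mktuple /ball /= ltr_norml.
    by have := hq' j; rewrite in_itv /= => /andP[h1 h2]; apply/andP; split; lra.
  exists ([tuple q j | j < N], r) => //; rewrite /F; case: asboolP => //= ns; exfalso; apply: ns; split=> //.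
  move=> y by_; apply: eU; apply: (@le_ball _ _ _ (ratr r + ratr r)); first lra.
  exact: ball_triangle (ball_sym bq) by_.
apply: countable_bigcupT_measurable => // p; rewrite /F; case: asboolP => [[r0 _]|_] //.
have -> : vec @^-1` (ball (q2v p.1) (ratr p.2 : R)) =
  \bigcap_(j in [set: 'I_N]) ((fun t : N.-tuple T => tnth t j) @^-1` (ball (ratr (tnth p.1 j) : R) (ratr p.2 : R))).
  apply/seteqP; split => t /= h.
    by move=> j _; have := h.2 0 j; rewrite !mxE.
  by split=> // i j; rewrite !mxE; exact: h.
apply: fin_bigcap_measurable => // j _.
rewrite -[X in measurable X]setTI; apply: measurable_tnth => //.
by apply: open_measurable; exact: ball_open.
Qed.

Lemma measurable_vec (u : V -> R) : continuous u ->
  measurable_fun setT (fun t : N.-tuple T => u (vec t)).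
Proof.
move=> /continuousP cu; apply: (measurability _ (RGenOpens.measurableE R)).
move=> _ [_ [a [b ->] <-]]; rewrite setTI.
apply: (@open_vec_measurable (u @^-1` `]a, b[%classic)).
exact/cu/interval_open.
Qed.

Definition ccontinuous f := continuous (cRe f) /\ continuous (cIm f).

Lemma cmeasurable_vec f : ccontinuous f -> cmeasurable (fun t : N.-tuple T => f (vec t)).
Proof. by move=> [cr ci]; split; [exact (measurable_vec cr)|exact (measurable_vec ci)]. Qed.

Lemma ccontinuousM f g : ccontinuous f -> ccontinuous g -> ccontinuous (mulop f g).
Proof.
move=> [fr fi] [gr gi]; rewrite /ccontinuous cReM cImM.
by split; [apply: continuous_fB|apply: continuous_fD]; exact: continuous_fM.
Qed.

Lemma smooth_ccontinuous f : smooth f -> ccontinuous f.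
Proof. exact: smooth_continuous. Qed.

Definition kerv x : R := \prod_(j < N) ker1 (x 0 j).

Lemma kerv_gt0 x : 0 < kerv x.
Proof. by apply: prodr_gt0 => j _; exact: ker1_gt0. Qed.

Lemma kerv_le1 x : kerv x <= 1.
Proof. by apply: prodr_ile1 => j _; rewrite ker1_ge0 ker1_le1. Qed.

Lemma kern_vec (t : N.-tuple T) : kern t = kerv (vec t).
Proof. by apply: eq_bigr => j _; rewrite mxE. Qed.

Definition dominated f C := forall x, cmod (f x) <= C * kerv x.

Lemma cintegralE f : cintegral f = Cint L (fun t => f (vec t)).
Proof. by []. Qed.

Lemma dominated_cintegrable f C : ccontinuous f -> dominated f C ->
  cintegrable L (fun t => f (vec t)).
Proof.
move=> cf df; apply: (cintegrable_dominated (cmeasurable_vec cf) (integral_kern N).1 (C := C)).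
by move=> t; rewrite kern_vec.
Qed.

Lemma cintegral_le f C : ccontinuous f -> dominated f C ->
  cmod (cintegral f) <= 2 * (C * pi ^+ N).
Proof.
move=> cf df; have [ik kI] := @integral_kern R N.
by apply: (Cint_le (cmeasurable_vec cf) ik kI) => t; rewrite kern_vec.
Qed.

(** This is [exp (- i a)], with the sign of the Fourier kernel. *)
Definition cis (a : R) : R[i] := cos a -i* sin a.

Lemma cmod_cis a : cmod (cis a) = 1.
Proof. by rewrite /cmod /cis /= sqrrN cos2Dsin2 sqrtr1. Qed.

Lemma cisD a b : cis (a + b) = cis a * cis b.
Proof.
by apply/eqP; rewrite eq_complex /= cosD sinD; apply/andP; split; apply/eqP; ring.
Qed.

Definition wave xi : V -> R[i] := fun x => cis (dotp x xi).

Lemma fourierE f xi : fourier f xi = cintegral (mulop f (wave xi)).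
Proof. by []. Qed.

Lemma continuous_dotp xi : continuous (fun x : V => dotp x xi).
Proof.
rewrite /dotp; elim: (index_enum _) => [|j s IH].
  by under eq_fun do rewrite big_nil; exact: cst_continuous.
under eq_fun do rewrite big_cons.
apply: continuous_fD IH; apply: continuous_fM; [exact: continuous_coord|exact: cst_continuous].
Qed.

Lemma ccontinuous_wave xi : ccontinuous (wave xi).
Proof.
split => x.
  by apply: continuous_comp; [exact: continuous_dotp|exact: continuous_cos].
apply: (@continuous_comp _ _ _ (fun x => dotp x xi) (fun a => - sin a)).
  exact: continuous_dotp.
by apply: continuousN; exact: continuous_sin.
Qed.

Lemma dominated_wave f C xi : dominated f C -> dominated (mulop f (wave xi)) C.
Proof. by move=> df x; rewrite /mulop cmodM cmod_cis mulr1. Qed.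

Lemma fourier_le f C xi : ccontinuous f -> dominated f C ->
  cmod (fourier f xi) <= 2 * (C * pi ^+ N).
Proof.
move=> cf df; rewrite fourierE; apply: cintegral_le.
  exact: ccontinuousM (ccontinuous_wave xi).
exact: dominated_wave.
Qed.

Lemma is_derive_seg (u : V -> R) x v (s0 : R) : derivable u x v ->
  is_derive s0 (1 : R) (fun s : R => u ((s - s0) *: v + x)) ('D_v u x).
Proof.
move=> du.
have E : (fun h : R => h^-1 *: (((fun s : R => u ((s - s0) *: v + x)) \o shift s0) (h *: (1 : R))
     - u ((s0 - s0) *: v + x))) = (fun h : R => h^-1 *: ((u \o shift x) (h *: v) - u x)).
  apply/funext => h /=.
  by rewrite subrr scale0r add0r addrK /GRing.scale /= mulr1.
split; first by rewrite /derivable E.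
by rewrite /derive E.
Qed.

Lemma vec_upd (t : N.-tuple T) j (s s0 : R) :
  vec (upd t j s) = (s - s0) *: e j + vec (upd t j s0).
Proof.
apply/rowP => i; rewrite !mxE !tnth_mktuple eqxx /=.
by case: eqVneq => _; rewrite ?mulr1 ?mulr0 ?subrK ?add0r.
Qed.

Lemma Rint_partial0 (u : V -> R) j C : (forall x, derivable u x (e j)) ->
  continuous (fun x => 'D_(e j) u x) -> (forall x, `|u x| <= C * kerv x) ->
  (forall x, `|'D_(e j) u x| <= C * kerv x) ->
  Rintegral L setT (fun t => 'D_(e j) u (vec t)) = 0.
Proof.
move=> du cdu hu hdu; apply: (@Rint_derive0 _ _ j (fun t => u (vec t)) _ C).
- exact (measurable_vec cdu).
- by move=> t; rewrite kern_vec.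
- by move=> t; rewrite kern_vec.
- move=> t s; have := is_derive_seg s (du (vec (upd t j s))).
  by under eq_fun => s' do rewrite -vec_upd.
- move=> t s.
  have -> : (fun s : R => 'D_(e j) u (vec (upd t j s))) =
      (fun s : R => 'D_(e j) u (s *: e j + vec (upd t j 0))).
    by apply/funext => s'; rewrite (vec_upd t j s' 0) subr0.
  apply: (@continuous_comp _ _ _ (fun s : R => s *: e j + vec (upd t j 0)) (fun x => 'D_(e j) u x)).
    by apply: cvgD; [apply: scalel_continuous|exact: cvg_cst].
  exact: cdu.
Qed.

Lemma cintegral_partial0 f j C : partially_derivable f -> ccontinuous (partial j f) ->
  dominated f C -> dominated (partial j f) C -> cintegral (partial j f) = 0.
Proof.
move=> pf [cr ci] df dpf.
have hr : Rintegral L setT (fun t => cRe (partial j f) (vec t)) = 0.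
  apply: (@Rint_partial0 (cRe f) j C) => //.
  - by move=> x; have [] := pf j x.
  - by move=> x; exact: le_trans (Re_le_cmod (f x)) (df x).
  - by move=> x; exact: le_trans (Re_le_cmod (partial j f x)) (dpf x).
have hi : Rintegral L setT (fun t => cIm (partial j f) (vec t)) = 0.
  apply: (@Rint_partial0 (cIm f) j C) => //.
  - by move=> x; have [] := pf j x.
  - by move=> x; exact: le_trans (Im_le_cmod (f x)) (df x).
  - by move=> x; exact: le_trans (Im_le_cmod (partial j f x)) (dpf x).
by rewrite /cintegral hr hi.
Qed.

Lemma is_derive_dotp xi x j (F : R -> R) d : is_derive (dotp x xi) (1 : R) F d ->
  is_derive x (e j) (fun x => F (dotp x xi)) (xi 0 j * d).
Proof.
move=> hF; apply: is_derive_line.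
have E s : dotp (s *: e j + x) xi = s * xi 0 j + dotp x xi.
  rewrite /dotp (eq_bigr (fun i => s * (e j 0 i * xi 0 i) + x 0 i * xi 0 i)); last first.
    by move=> i _; rewrite !mxE mulrDl mulrA.
  rewrite big_split /= -mulr_sumr; congr (_ * _ + _).
  rewrite (bigD1 j) //= !mxE !eqxx mul1r big1 ?addr0 // => i /negPf ij.
  by rewrite !mxE eqxx /= ij mul0r.
under eq_fun do rewrite E.
have hs : is_derive (0 : R) (1 : R) (fun s : R => s * xi 0 j + dotp x xi) (xi 0 j).
  have h := is_deriveD (is_deriveZ (xi 0 j) (is_derive_id (0 : R) (1 : R)))
    (is_derive_cst (dotp x xi) (0 : R) (1 : R)).
  rewrite /GRing.scale /= addr0 mulr1 in h.
  by under eq_fun do rewrite mulrC.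
have hF' : is_derive (0 * xi 0 j + dotp x xi) (1 : R) F d by rewrite mul0r add0r.
have := @is_derive1_comp _ F (fun s : R => s * xi 0 j + dotp x xi) 0 d (xi 0 j) hF' hs.
by rewrite mulrC.
Qed.

Lemma partial_wave xi j : partially_derivable (wave xi) /\
  partial j (wave xi) = (fun x => (0 -i* xi 0 j) * wave xi x).
Proof.
have hr x i : is_derive x (e i) (cRe (wave xi)) (xi 0 i * (- sin (dotp x xi))).
  exact: (is_derive_dotp i (is_derive_cos _)).
have hi x i : is_derive x (e i) (cIm (wave xi)) (xi 0 i * (- cos (dotp x xi))).
  exact: (is_derive_dotp i (is_deriveN (is_derive_sin _))).
split; first by move=> i x; have := hr x i; have := hi x i; split; exact: ex_derive.
apply/funext => x; rewrite /partial (@derive_val _ _ _ _ _ _ _ (hr x j)).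
rewrite (@derive_val _ _ _ _ _ _ _ (hi x j)) /wave /cis.
by apply/eqP; rewrite eq_complex /=; apply/andP; split; apply/eqP; ring.
Qed.

(** Integration by parts: the integral of the partial derivative of [f] times the wave vanishes, and
    the wave is an eigenfunction of [partial j]. *)
Lemma fourier_partial f j C xi : partially_derivable f -> ccontinuous f ->
  ccontinuous (partial j f) -> dominated f C -> dominated (partial j f) C ->
  fourier (partial j f) xi = (0 +i* xi 0 j) * fourier f xi.
Proof.
move=> pf cf cpf df dpf; have [pw Ew] := partial_wave xi j.
have E := partialM j pf pw.
have E2 x : partial j (mulop f (wave xi)) x =
   mulop (partial j f) (wave xi) x + (0 -i* xi 0 j) * mulop f (wave xi) x.
  by rewrite E Ew /mulop; congr (_ + _); rewrite mulrCA.
have cw := ccontinuous_wave xi.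
have c1 := ccontinuousM cpf cw; have c2 := ccontinuousM cf cw.
have cc : ccontinuous (fun x => (0 -i* xi 0 j) * mulop f (wave xi) x).
  by apply: (@ccontinuousM (fun=> 0 -i* xi 0 j)) => //; split; exact: cst_continuous.
have cE : ccontinuous (partial j (mulop f (wave xi))).
  rewrite (_ : partial j _ = fun x =>
    mulop (partial j f) (wave xi) x + (0 -i* xi 0 j) * mulop f (wave xi) x); last exact/funext.
  case: c1 cc => [a1 a2] [b1 b2].
  by split; rewrite ?cReD ?cImD; exact: continuous_fD.
have C0 : 0 <= C.
  have := df 0; have := cmod_ge0 (f 0); have := kerv_gt0 0; nra.
(* One constant that dominates both the product and its derivative, as [cintegral_partial0] asks. *)
pose D := C + cmod (0 -i* xi 0 j) * C.
have CD : C <= D by rewrite lerDl mulr_ge0 // cmod_ge0.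
have dE : dominated (partial j (mulop f (wave xi))) D.
  move=> x; rewrite E2 (le_trans (cmodD _ _)) // mulrDl lerD //.
    exact: dominated_wave dpf x.
  rewrite cmodM -mulrA ler_wpM2l ?cmod_ge0 //; exact: dominated_wave df x.
have dfD : dominated (mulop f (wave xi)) D.
  move=> x; apply: (le_trans (dominated_wave xi df x)).
  by rewrite ler_wpM2r // ltW // kerv_gt0.
have := @cintegral_partial0 (mulop f (wave xi)) j D (partially_derivableM pf pw) cE dfD dE.
rewrite (_ : partial j _ = fun x =>
    mulop (partial j f) (wave xi) x + (0 -i* xi 0 j) * mulop f (wave xi) x); last exact/funext.
rewrite !cintegralE CintD; last 2 first.
- exact: dominated_cintegrable c1 (dominated_wave xi dpf).
- apply: (@dominated_cintegrable (fun x => (0 -i* xi 0 j) * mulop f (wave xi) x) D) => // x.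
  rewrite cmodM /D mulrDl; apply: (@le_trans _ _ (cmod (0 -i* xi 0 j) * C * kerv x)).
    by rewrite -mulrA ler_wpM2l ?cmod_ge0 //; exact: dominated_wave df x.
  by rewrite lerDr mulr_ge0 // ltW // kerv_gt0.
rewrite CintZ; last exact: dominated_cintegrable c2 (dominated_wave xi df).
rewrite -!cintegralE -!fourierE => /eqP; rewrite addr_eq0 => /eqP ->.
rewrite -mulNr; congr (_ * _).
by apply/eqP; rewrite eq_complex /= oppr0 opprK !eqxx.
Qed.

End fourier_basics.

(** * Derivatives of the Fourier transform *)

Section fourier_derivatives.
Context {R : realType} {N : nat}.
Local Notation V := 'rV[R]_N.
Local Notation T := (measurableTypeR R).
Local Notation L := (lebesgue_Rn R N).
Local Notation vec := (@vec_of_tuple R N).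
Local Notation e j := (delta_mx 0 j : V).
Implicit Types (f g h : V -> R[i]) (x y xi : V) (C : R) (j : 'I_N) (k : nat).

(** Powers of [kerv] play the role of inverse polynomials: each power absorbs a coordinate factor,
    and one power is left for integrability. *)
Definition rapid f := forall k, exists C, forall x, cmod (f x) <= C * kerv x ^+ k.

(** Multiplication by [- i x_j], which the Fourier transform turns into [partial j]. *)
Definition mulX j f : V -> R[i] := mulop (fun x => 0 -i* x 0 j) f.

Lemma cmod_mulX j f x : cmod (mulX j f x) = `|x 0 j| * cmod (f x).
Proof. by rewrite /mulX /mulop cmodM /cmod /= expr0n /= add0r sqrrN sqrtr_sqr. Qed.

Lemma kerv_le_ker1 x j : kerv x <= ker1 (x 0 j).
Proof.
rewrite /kerv (bigD1 j) //= -[leRHS]mulr1 ler_wpM2l ?ker1_ge0 //.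
by apply: prodr_ile1 => i _; rewrite ker1_ge0 ker1_le1.
Qed.

Lemma coord_kerv x j : `|x 0 j| * kerv x <= 1.
Proof.
apply: (@le_trans _ _ (`|x 0 j| * ker1 (x 0 j))).
  by rewrite ler_wpM2l // kerv_le_ker1.
rewrite ler_pdivrMr ?mul1r; last by rewrite ltr_wpDr ?sqr_ge0.
rewrite -real_normK ?num_real //; have := sqr_ge0 (`|x 0 j| - 1); rewrite !expr2; nra.
Qed.

Lemma sqr_coord_kerv x j : x 0 j ^+ 2 * kerv x <= 1.
Proof.
apply: (@le_trans _ _ (x 0 j ^+ 2 * ker1 (x 0 j))).
  by rewrite ler_wpM2l ?sqr_ge0 // kerv_le_ker1.
rewrite ler_pdivrMr ?mul1r; last by rewrite ltr_wpDr ?sqr_ge0.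
by rewrite lerDr.
Qed.

Lemma ccontinuous_mulX j f : ccontinuous f -> ccontinuous (mulX j f).
Proof.
apply: ccontinuousM; split; first exact: cst_continuous.
move=> x; apply: (@continuous_comp _ _ _ (fun x => x 0 j) (fun a => - a)).
  exact: continuous_coord.
exact: opp_continuous.
Qed.

Lemma rapid_mulX j f : rapid f -> rapid (mulX j f).
Proof.
move=> rf k; have [C hC] := rf k.+1; exists C => x.
rewrite cmod_mulX; apply: (@le_trans _ _ (`|x 0 j| * (C * kerv x ^+ k.+1))).
  by rewrite ler_wpM2l.
have C0 : 0 <= C.
  have := le_trans (cmod_ge0 _) (hC x); rewrite pmulr_lge0 //.
  by rewrite exprn_gt0 // kerv_gt0.
have -> : `|x 0 j| * (C * kerv x ^+ k.+1) = C * kerv x ^+ k * (`|x 0 j| * kerv x).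
  by rewrite exprSr; ring.
by rewrite ler_piMr ?coord_kerv // mulr_ge0 // exprn_ge0 // ltW // kerv_gt0.
Qed.

Lemma rapid_dominated f : rapid f -> exists2 C, 0 <= C & dominated f C.
Proof.
move=> /(_ 1%N) [C hC]; exists C => [|x]; last by rewrite -(expr1 (kerv x)).
by have := le_trans (cmod_ge0 _) (hC 0); rewrite pmulr_lge0 // expr1 kerv_gt0.
Qed.

Lemma cis_quad (a : R) : cmod (cis a - 1 + (0 +i* a)) <= 2 * a ^+ 2.
Proof.
apply: (le_trans (cmod_le _)); rewrite mulr_natl mulr2n lerD //=.
  have hb (y : R) : `|- cos y| <= 1 by rewrite normrN ler_norml cos_geN1 cos_le1.
  have := @taylor2 _ cos _ _ 1 0 a (fun y : R => is_derive_cos y)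
    (fun y : R => is_deriveN (is_derive_sin y)) hb.
  by rewrite add0r cos0 sin0 oppr0 mulr0 subr0 mul1r addr0.
have hb (y : R) : `|- sin y| <= 1 by rewrite normrN ler_norml sin_geN1 sin_le1.
have := @taylor2 _ sin _ _ 1 0 a (fun y : R => is_derive_sin y) (fun y : R => is_derive_cos y) hb.
rewrite add0r sin0 cos0 mulr1 subr0 mul1r -normrN => H.
by rewrite (_ : - sin a - 0 + a = - (sin a - a)) //; ring.
Qed.

Lemma cis_lip (a b : R) : cmod (cis a - cis b) <= 2 * `|a - b|.
Proof.
apply: (le_trans (cmod_le _)); rewrite mulr_natl mulr2n lerD //=.
  have [z _ E] := @MVT_shift _ cos (fun y : R => - sin y) b (a - b) (fun y : R => is_derive_cos y).
  have -> : cos a - cos b = - sin z * (a - b) by rewrite -E; congr (cos _ - _); ring.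
  by rewrite normrM normrN ler_piMl // ler_norml sin_geN1 sin_le1.
have [z _ E] := @MVT_shift _ sin cos b (a - b) (fun y : R => is_derive_sin y).
have -> : - sin a - - sin b = - (cos z * (a - b)).
  by rewrite -E (_ : b + (a - b) = a); ring.
by rewrite normrN normrM ler_piMl // ler_norml cos_geN1 cos_le1.
Qed.

Lemma cintegralD f g C D : ccontinuous f -> ccontinuous g -> dominated f C -> dominated g D ->
  cintegral (fun x => f x + g x) = cintegral f + cintegral g.
Proof. by move=> cf cg df dg; rewrite !cintegralE CintD //; exact: dominated_cintegrable. Qed.

Lemma cintegralZ (c : R[i]) f C : ccontinuous f -> dominated f C ->
  cintegral (fun x => c * f x) = c * cintegral f.
Proof. by move=> cf df; rewrite !cintegralE CintZ //; exact: dominated_cintegrable. Qed.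

Lemma ccontinuousD f g : ccontinuous f -> ccontinuous g -> ccontinuous (fun x => f x + g x).
Proof. by move=> [fr fi] [gr gi]; split; rewrite ?cReD ?cImD; exact: continuous_fD. Qed.

Lemma ccontinuousZ (c : R[i]) f : ccontinuous f -> ccontinuous (fun x => c * f x).
Proof. by apply: (@ccontinuousM _ _ (fun=> c)); split; exact: cst_continuous. Qed.

Lemma dominatedZ (c : R[i]) f C : dominated f C -> dominated (fun x => c * f x) (cmod c * C).
Proof. by move=> df x; rewrite cmodM -mulrA ler_wpM2l // cmod_ge0. Qed.

Lemma dominatedD f g C D : dominated f C -> dominated g D ->
  dominated (fun x => f x + g x) (C + D).
Proof. by move=> df dg x; rewrite mulrDl (le_trans (cmodD _ _)) // lerD. Qed.

Lemma dotp_line x xi j (s : R) : dotp x (s *: e j + xi) = s * x 0 j + dotp x xi.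
Proof.
rewrite /dotp (eq_bigr (fun i => s * (e j 0 i * x 0 i) + x 0 i * xi 0 i)); last first.
  by move=> i _; rewrite !mxE; ring.
rewrite big_split /= -mulr_sumr; congr (_ * _ + _).
rewrite (bigD1 j) //= !mxE !eqxx mul1r big1 ?addr0 // => i /negPf ij.
by rewrite !mxE eqxx /= ij mul0r.
Qed.

(** Taylor's formula for the phase under the integral. The error contains [x_j ^ 2]; one of two
    powers of [kerv] absorbs it and the other makes it integrable. *)
Lemma fourier_quad f j xi : ccontinuous f -> rapid f -> exists M, forall s : R,
  cmod (fourier f (s *: e j + xi) - fourier f xi - s%:C * fourier (mulX j f) xi) <= M * s ^+ 2.
Proof.
move=> cf rf; have [C0 C00 d0] := rapid_dominated rf.
have [C1 C10 d1] := rapid_dominated (rapid_mulX j rf).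
have [C2 h2] := rf 2%N.
exists (2 * (2 * C2 * pi ^+ N)) => s.
have cw xi' := ccontinuousM cf (ccontinuous_wave xi').
have cX := ccontinuousM (ccontinuous_mulX j cf) (ccontinuous_wave xi).
have dw xi' := dominated_wave xi' d0; have dX := dominated_wave xi d1.
have -> : fourier f (s *: e j + xi) - fourier f xi - s%:C * fourier (mulX j f) xi =
   cintegral (fun x => (mulop f (wave (s *: e j + xi)) x + (-1) * mulop f (wave xi) x) +
      (- s%:C) * mulop (mulX j f) (wave xi) x).
  rewrite (cintegralD _ _ (dominatedD (dw _) (dominatedZ (-1) (dw _))) (dominatedZ (- s%:C) dX)); last 2 first.
  - exact: ccontinuousD (cw _) (ccontinuousZ _ (cw _)).
  - exact: ccontinuousZ.
  rewrite (cintegralD _ _ (dw _) (dominatedZ (-1) (dw _))) //; last exact: ccontinuousZ.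
  by rewrite (cintegralZ _ (cw _) (dw _)) (cintegralZ _ cX dX) mulN1r mulNr.
apply: (@le_trans _ _ (2 * ((2 * C2 * s ^+ 2) * pi ^+ N))); last first.
  by rewrite le_eqVlt; apply/orP; left; apply/eqP; ring.
apply: cintegral_le.
  exact: ccontinuousD (ccontinuousD (cw _) (ccontinuousZ _ (cw _))) (ccontinuousZ _ cX).
move=> x.
have -> : mulop f (wave (s *: e j + xi)) x + -1 * mulop f (wave xi) x +
    (- s%:C) * mulop (mulX j f) (wave xi) x =
    f x * wave xi x * (cis (s * x 0 j) - 1 + (0 +i* (s * x 0 j))).
  rewrite /mulX /mulop /wave dotp_line cisD.
  have -> : (0 +i* (s * x 0 j) : R[i]) = - (s%:C * (0 -i* x 0 j)).
    by apply/eqP; rewrite eq_complex /=; apply/andP; split; apply/eqP; ring.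
  ring.
rewrite !cmodM cmod_cis mulr1.
apply: (@le_trans _ _ (C2 * kerv x ^+ 2 * (2 * (s * x 0 j) ^+ 2))).
  by apply: ler_pM; rewrite ?cmod_ge0 // cis_quad.
have C20 : 0 <= C2.
  by have := le_trans (cmod_ge0 _) (h2 x); rewrite pmulr_lge0 // exprn_gt0 // kerv_gt0.
rewrite exprMn.
have -> : C2 * kerv x ^+ 2 * (2 * (s ^+ 2 * x 0 j ^+ 2)) =
   2 * C2 * s ^+ 2 * (x 0 j ^+ 2 * kerv x) * kerv x by ring.
rewrite ler_wpM2r ?(ltW (kerv_gt0 x)) // ler_piMr ?sqr_coord_kerv //.
by apply: mulr_ge0; [apply: mulr_ge0|exact: sqr_ge0].
Qed.

Lemma fourier_derivable f : ccontinuous f -> rapid f ->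
  partially_derivable (fourier f) /\ forall j, partial j (fourier f) = fourier (mulX j f).
Proof.
move=> cf rf.
have H j xi : is_derive xi (e j) (cRe (fourier f)) (cRe (fourier (mulX j f)) xi) /\
    is_derive xi (e j) (cIm (fourier f)) (cIm (fourier (mulX j f)) xi).
  have [M hM] := fourier_quad j xi cf rf.
  split; apply: is_derive_line; apply: (@is_derive_quad _ _ _ _ M) => s;
    rewrite add0r scale0r add0r; apply: le_trans (hM s).
    apply: le_trans (Re_le_cmod _); rewrite /cRe.
    move: (fourier f (s *: _ + xi)) (fourier f xi) (fourier (mulX j f) xi) => [a b] [c d] [u v] /=.
    by rewrite mul0r subr0.
  apply: le_trans (Im_le_cmod _); rewrite /cIm.
  move: (fourier f (s *: _ + xi)) (fourier f xi) (fourier (mulX j f) xi) => [a b] [c d] [u v] /=.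
  by rewrite mul0r addr0.
split=> [j xi|j]; first by have [h1 h2] := H j xi; split; exact: ex_derive.
apply/funext => xi; have [h1 h2] := H j xi.
rewrite /partial (@derive_val _ _ _ _ _ _ _ h1) (@derive_val _ _ _ _ _ _ _ h2).
by rewrite /cRe /cIm; case: (fourier _ _).
Qed.

Lemma lipschitz_continuous (u : V -> R) M : (forall x y, `|u x - u y| <= M * `|x - y|) ->
  continuous u.
Proof.
move=> hu x; apply/(@cvgrPdist_lt _ _ _ (nbhs x) (nbhs_filter x) u (u x)) => eps eps0.
have M1 : 0 < `|M| + 1 by rewrite ltr_wpDl.
near=> y; apply: (le_lt_trans (hu x y)).
have : `|x - y| < eps / (`|M| + 1).
  near: y.
  exact: (@cvgr_dist_lt R V V (nbhs x) (nbhs_filter x) id x cvg_id _ (divr_gt0 eps0 M1)).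
rewrite ltr_pdivlMr // => h.
have := ler_norm M; have := normr_ge0 (x - y); nra.
Unshelve. all: by end_near. Qed.

Lemma coord_le_norm x j : `|x 0 j| <= `|x|.
Proof.
rewrite [leRHS]/Num.Def.normr /= mx_normrE.
exact: (le_bigmax _ (fun ij : 'I_1 * 'I_N => `|x ij.1 ij.2|) (0, j)).
Qed.

(** The phase is Lipschitz in the frequency, with a constant linear in the coordinates of [x]; a
    spare power of [kerv] absorbs these, so the transform is Lipschitz. *)
Lemma fourier_continuous f : ccontinuous f -> rapid f -> ccontinuous (fourier f).
Proof.
move=> cf rf; have [C0 C00 d0] := rapid_dominated rf.
have [C2 h2] := rf 2%N.
have C20 : 0 <= C2.
  by have := le_trans (cmod_ge0 _) (h2 0); rewrite pmulr_lge0 // exprn_gt0 // kerv_gt0.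
have cw xi' := ccontinuousM cf (ccontinuous_wave xi').
have dw xi' := dominated_wave xi' d0.
pose M := 2 * (C2 * (2 * N%:R) * pi ^+ N).
have H xi eta : cmod (fourier f xi - fourier f eta) <= M * `|xi - eta|.
  have -> : fourier f xi - fourier f eta =
      cintegral (fun x => mulop f (wave xi) x + (-1) * mulop f (wave eta) x).
    rewrite (cintegralD (cw _) (ccontinuousZ _ (cw _)) (dw _) (dominatedZ (-1) (dw _))).
    by rewrite (cintegralZ _ (cw _) (dw _)) mulN1r.
  apply: (@le_trans _ _ (2 * ((C2 * (2 * N%:R) * `|xi - eta|) * pi ^+ N))); last first.
    by rewrite /M le_eqVlt; apply/orP; left; apply/eqP; ring.
  apply: cintegral_le; first exact: ccontinuousD (cw _) (ccontinuousZ _ (cw _)).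
  move=> x; rewrite /mulop mulN1r -mulrBr cmodM /wave.
  apply: (@le_trans _ _ (C2 * kerv x ^+ 2 * (2 * \sum_(j < N) `|x 0 j| * `|xi - eta|))).
    apply: ler_pM; rewrite ?cmod_ge0 //; apply: (le_trans (cis_lip _ _)).
    rewrite ler_wpM2l // /dotp -sumrB; apply: (le_trans (ler_norm_sum _ _ _)).
    apply: ler_sum => j _; rewrite -mulrBr normrM ler_wpM2l //.
    by have := coord_le_norm (xi - eta) j; rewrite !mxE.
  rewrite -mulr_suml.
  have -> : C2 * kerv x ^+ 2 * (2 * ((\sum_(j < N) `|x 0 j|) * `|xi - eta|)) =
    C2 * 2 * `|xi - eta| * kerv x * (\sum_(j < N) `|x 0 j| * kerv x).
    by rewrite -mulr_suml; ring.
  have -> : C2 * (2 * N%:R) * `|xi - eta| * kerv x = C2 * 2 * `|xi - eta| * kerv x * N%:R by ring.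
  rewrite ler_wpM2l ?mulr_ge0 ?(ltW (kerv_gt0 x)) //.
  rewrite -[X in _ <= X%:R]card_ord -sum1_card natr_sum.
  by apply: ler_sum => j _; exact: coord_kerv.
split; apply: (@lipschitz_continuous _ M) => x y; apply: le_trans (H x y).
  apply: le_trans (Re_le_cmod _); rewrite /cRe.
  by case: (fourier f x); case: (fourier f y).
apply: le_trans (Im_le_cmod _); rewrite /cIm.
by case: (fourier f x); case: (fourier f y).
Qed.

Definition mulXs (ws : seq 'I_N) f := foldr mulX f ws.

Lemma smooth_fourier f : ccontinuous f -> rapid f -> smooth (fourier f).
Proof.
move=> cf rf.
apply: (smooth_coind (P := fun h => exists f, [/\ ccontinuous f, rapid f & h = fourier f])).
  move=> _ [{cf rf}f [cf rf ->]]; have [c1 c2] := fourier_continuous cf rf.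
  have [pd E] := fourier_derivable cf rf; split => // j.
  exists (mulX j f); split => //; [exact: ccontinuous_mulX|exact: rapid_mulX].
by exists f.
Qed.

Lemma dw_fourier ws f : ccontinuous f -> rapid f ->
  [/\ dw ws (fourier f) = fourier (mulXs ws f), ccontinuous (mulXs ws f) & rapid (mulXs ws f)].
Proof.
move=> cf rf; elim: ws => //= j ws [-> c r]; split.
- by have [_ ->] := fourier_derivable c r.
- exact: ccontinuous_mulX.
- exact: rapid_mulX.
Qed.

End fourier_derivatives.

(** * Fourier inversion as an inequality *)

Section inversion_kernel.
Context {R : realType}.
Local Notation T := (measurableTypeR R).
Local Notation mu := (@lebesgue_measure R).
Implicit Types (e a b s t d : R).

Lemma expR_abs_ker1 e s : 0 < e -> expR (- (e * `|s|)) <= (1 + 2 / e ^+ 2) * ker1 s.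
Proof.
move=> e0; rewrite expRN -ler_pdivrMr ?ker1_gt0 // /ker1 invrK.
rewrite ler_pdivrMl ?expR_gt0 // mulrC.
have e20 : 0 < e ^+ 2 by rewrite exprn_gt0.
have x0 : 0 <= e * `|s| by rewrite mulr_ge0 // ltW.
have h : 1 + (e * `|s|) ^+ 2 / 2 <= expR (e * `|s|).
  by have := expR_ge1Dxn 1%N x0; rewrite (_ : 2`! = 2%N).
apply: (@le_trans _ _ ((1 + 2 / e ^+ 2) * (1 + (e * `|s|) ^+ 2 / 2))); last first.
  by rewrite ler_wpM2l // addr_ge0 // divr_ge0 // ltW.
rewrite exprMn real_normK ?num_real // .
have -> : (1 + 2 / e ^+ 2) * (1 + e ^+ 2 * s ^+ 2 / 2) =
  1 + s ^+ 2 + (2 / e ^+ 2 + e ^+ 2 * s ^+ 2 / 2) by field; rewrite gt_eqF.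
rewrite lerDl; apply: addr_ge0; first by rewrite divr_ge0 // ltW.
by rewrite divr_ge0 // mulr_ge0 // ?sqr_ge0 // ltW.
Qed.

Lemma continuous_expR_abs e : continuous (fun s : R => expR (- (e * `|s|))).
Proof.
move=> s; apply: (@continuous_comp _ _ _ (fun s => - (e * `|s|)) expR); last exact: continuous_expR.
apply: cvgN; apply: cvgM; first exact: cvg_cst.
exact: norm_continuous.
Qed.

Lemma poisson_shift_ker1 e a A t : 0 < e -> a ^+ 2 <= A ->
  poisson e (t - a) <= e * ((1 + 2 * A) / e ^+ 2 + 2) * ker1 t.
Proof.
move=> e0 aA; rewrite /poisson /ker1 -!mulrA ler_pM2l //.
have e20 : 0 < e ^+ 2 by rewrite exprn_gt0.
have p1 : 0 < e ^+ 2 + (t - a) ^+ 2 by rewrite ltr_wpDr ?sqr_ge0.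
have p2 : 0 < 1 + t ^+ 2 by rewrite ltr_wpDr ?sqr_ge0.
rewrite ler_pdivlMr // ler_pdivrMl // .
have A0 : 0 <= A by apply: le_trans aA; exact: sqr_ge0.
(* Uses [t ^ 2 <= 2 a ^ 2 + 2 (t - a) ^ 2]. *)
apply: (@le_trans _ _ (1 + 2 * A + 2 * (t - a) ^+ 2)).
  have := sqr_ge0 (t - a - a); rewrite !expr2 in aA *; nra.
have -> : (e ^+ 2 + (t - a) ^+ 2) * ((1 + 2 * A) / e ^+ 2 + 2) =
   1 + 2 * A + 2 * (t - a) ^+ 2 + (2 * e ^+ 2 + (t - a) ^+ 2 * ((1 + 2 * A) / e ^+ 2)).
  by field; rewrite gt_eqF.
rewrite lerDl; apply: addr_ge0; first by rewrite mulr_ge0 // ltW.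
apply: mulr_ge0; first exact: sqr_ge0.
by apply: divr_ge0; [lra|exact: ltW].
Qed.

(** Concentration in quantitative form. The width [d ^+ 3] yields a factor [d] in both ranges: for
    [|t| <= d] from the minimum, and for [|t| > d] because [d ^ 3 / t ^ 2 <= 2 d / (1 + t ^ 2)]
    there. *)
Lemma poisson_small d t : 0 < d -> d <= 1 ->
  Num.min 1 `|t| * poisson (d ^+ 3) t <= d * (poisson (d ^+ 3) t + 2 * ker1 t).
Proof.
move=> d0 d1; have e0 : 0 < d ^+ 3 by rewrite exprn_gt0.
have P0 := poisson_ge0 t e0; have K0 := ker1_ge0 t.
have [td|td] := leP `|t| d.
  apply: (@le_trans _ _ (d * poisson (d ^+ 3) t)).
    by rewrite ler_wpM2r // (le_trans _ td) // ge_min lexx orbT.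
  by rewrite ler_wpM2l ?(ltW d0) // lerDl mulr_ge0.
apply: (@le_trans _ _ (1 * poisson (d ^+ 3) t)).
  by rewrite ler_wpM2r // ge_min lexx.
rewrite mul1r; apply: (@le_trans _ _ (d * (2 * ker1 t))); last first.
  by rewrite ler_wpM2l ?(ltW d0) // lerDr.
rewrite /poisson /ker1 mulrA ler_pdivrMr; last first.
  by rewrite ltr_wpDr ?sqr_ge0 // exprn_gt0.
have p2 : 0 < 1 + t ^+ 2 by rewrite ltr_wpDr ?sqr_ge0.
rewrite mulrAC ler_pdivlMr //.
have t2 : d ^+ 2 <= t ^+ 2 by rewrite -(real_normK (num_real t)) lerXn2r ?nnegrE ?(ltW d0) ?(ltW td).
have d2 : d ^+ 2 <= 1 by rewrite exprn_ile1 // ltW.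
have t20 := sqr_ge0 t.
apply: (@le_trans _ _ (d * 2 * t ^+ 2)); last first.
  by rewrite ler_wpM2l ?mulr_ge0 ?(ltW d0) // lerDr sqr_ge0.
rewrite exprS -!mulrA ler_wpM2l ?(ltW d0) //.
nra.
Qed.

Let is_derive_damped (e b p q x : R) :
  is_derive x (1 : R) (fun s : R => expR (- (e * s)) * (p * sin (b * s) + q * cos (b * s)))
    (expR (- (e * x)) * ((- e * p - q * b) * sin (b * x) + (p * b - e * q) * cos (b * x))).
Proof.
have lin (c : R) : is_derive x (1 : R) (fun s : R => c * s) c.
  have h := is_deriveZ c (is_derive_id x (1 : R)).
  by rewrite /GRing.scale /= mulr1 in h.
have hE : is_derive x (1 : R) (fun s : R => expR (- (e * s))) (expR (- (e * x)) * (- e)).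
  exact: (@is_derive1_comp _ expR (fun s : R => - (e * s)) x _ _ (is_derive_expR _) (is_deriveN (lin e))).
have hS := @is_derive1_comp _ sin (fun s : R => b * s) x _ _ (is_derive_sin _) (lin b).
have hC := @is_derive1_comp _ cos (fun s : R => b * s) x _ _ (is_derive_cos _) (lin b).
have hs : is_derive x (1 : R) (fun s : R => p * sin (b * s) + q * cos (b * s))
    (p * (cos (b * x) * b) + q * (- sin (b * x) * b)).
  exact: (is_deriveD (is_deriveZ p hS) (is_deriveZ q hC)).
apply: is_derive_eq (is_deriveM hE hs) _; rewrite /GRing.scale /=; ring.
Qed.

Let damped_cvg0 (e b p q : R) : 0 < e ->
  (fun s : R => expR (- (e * s)) * (p * sin (b * s) + q * cos (b * s))) x @[x --> +oo] --> (0 : R).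
Proof.
move=> e0; apply/cvgrPdist_le => eps eps0; near=> s.
have s0 : 0 < s by near: s; exact: nbhs_pinfty_gt.
have se : (`|p| + `|q|) / eps / e <= s by near: s; apply: nbhs_pinfty_ge; rewrite num_real.
rewrite sub0r normrN normrM ger0_norm ?expR_ge0 //.
apply: (@le_trans _ _ (expR (- (e * s)) * (`|p| + `|q|))).
  rewrite ler_wpM2l ?expR_ge0 // (le_trans (ler_normD _ _)) // !normrM.
  by rewrite lerD // ler_piMr // ler_norml ?sin_geN1 ?sin_le1 ?cos_geN1 ?cos_le1.
rewrite expRN ler_pdivrMl ?expR_gt0 // -ler_pdivrMr //.
apply: le_trans (_ : e * s <= _); last by apply: le_trans (expR_ge1Dx _); lra.
by rewrite (mulrC e) -ler_pdivrMr.
Unshelve. all: by end_near. Qed.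

Let damped_continuous (e b p q : R) :
  continuous (fun s : R => expR (- (e * s)) * (p * sin (b * s) + q * cos (b * s))).
Proof.
move=> x; apply/differentiable_continuous/derivable1_diffP.
have h := is_derive_damped e b p q x; exact: ex_derive.
Qed.

Lemma damped_even (e b p q x : R) : 0 < x ->
  expR (- (e * `|x|)) * (p * sin (b * x) + q * cos (b * x)) =
  expR (- (e * x)) * (p * sin (b * x) + q * cos (b * x)).
Proof. by move=> x0; rewrite gtr0_norm. Qed.

Let continuous_damped_abs (e b p q : R) :
  continuous (fun s : R => expR (- (e * `|s|)) * (p * sin (b * s) + q * cos (b * s))).
Proof.
have cl : continuous (fun s : R => b * s).
  by move=> x; apply: cvgM; [exact: cvg_cst|exact: cvg_id].
move=> s; apply: cvgM; first exact: continuous_expR_abs.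
apply: cvgD; (apply: cvgM; first exact: cvg_cst).
  by apply: (@continuous_comp _ _ _ (fun s : R => b * s) sin); [exact: cl|exact: continuous_sin].
by apply: (@continuous_comp _ _ _ (fun s : R => b * s) cos); [exact: cl|exact: continuous_cos].
Qed.

Lemma cmod_damped e b s : cmod ((expR (- (e * `|s|)))%:C * cis (b * s)) = expR (- (e * `|s|)).
Proof. by rewrite cmodM cmod_cis mulr1 cmodC ger0_norm ?expR_ge0. Qed.

Lemma Cint_damped e b : 0 < e ->
  Cint mu (fun s : T => (expR (- (e * `|s|)))%:C * cis (b * s)) = (2 * poisson e b)%:C.
Proof.
move=> e0; have D0 := sqrD_gt0 b e0.
have Dn : e ^+ 2 + b ^+ 2 != 0 by rewrite gt_eqF.
have bnd (p q : R) : `|p| <= 1 -> forall s, `|expR (- (e * `|s|)) * p| <= (1 + 2 / e ^+ 2) * ker1 s.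
  move=> hp s; rewrite normrM ger0_norm ?expR_ge0 //.
  by apply: le_trans (expR_abs_ker1 s e0); rewrite ler_piMr ?expR_ge0.
have ER s : complex.Re ((expR (- (e * `|s|)))%:C * cis (b * s)) =
    expR (- (e * `|s|)) * (0 * sin (b * s) + 1 * cos (b * s)).
  by rewrite /cis /=; ring.
have EI s : complex.Im ((expR (- (e * `|s|)))%:C * cis (b * s)) =
    expR (- (e * `|s|)) * (-1 * sin (b * s) + 0 * cos (b * s)).
  by rewrite /cis /=; ring.
have bR s : `|expR (- (e * `|s|)) * (0 * sin (b * s) + 1 * cos (b * s))| <= (1 + 2 / e ^+ 2) * ker1 s.
  by rewrite mul0r add0r mul1r; apply: (bnd _ 0); rewrite ler_norml cos_geN1 cos_le1.
have bI s : `|expR (- (e * `|s|)) * (-1 * sin (b * s) + 0 * cos (b * s))| <= (1 + 2 / e ^+ 2) * ker1 s.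
  by rewrite mul0r addr0 mulN1r; apply: (bnd _ 0); rewrite normrN ler_norml sin_geN1 sin_le1.
(* These coefficients solve the linear system in [is_derive_damped] that makes the derivative of the
   antiderivative a pure cosine or a pure sine. *)
pose p := b / (e ^+ 2 + b ^+ 2); pose q := e / (e ^+ 2 + b ^+ 2).
have neg x : b * - x = - (b * x) by ring.
rewrite /Cint.
have -> : Rintegral mu setT (fun x : T => complex.Re ((expR (- (e * `|x|)))%:C * cis (b * x))) = 2 * poisson e b.
  under eq_Rintegral => x _ do rewrite ER.
  pose F (s : R) := expR (- (e * s)) * (p * sin (b * s) + (- q) * cos (b * s)).
  have dF x : is_derive x (1 : R) F (expR (- (e * x)) * (0 * sin (b * x) + 1 * cos (b * x))).
    apply: is_derive_eq (is_derive_damped e b p (- q) x) _.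
    by congr (_ * (_ * _ + _ * _)); rewrite /p /q; field.
  apply: (@etrans _ _ (- F 0 - F 0)); last first.
    by rewrite /F !mulr0 oppr0 expR0 sin0 cos0 /poisson /q; ring.
  refine (@Rintegral_line _ _ F F _ (@continuous_damped_abs _ _ _ _) bR
    (@damped_continuous _ _ _ _) _ (@damped_cvg0 _ _ _ _ e0) (@damped_continuous _ _ _ _) _ (@damped_cvg0 _ _ _ _ e0)).
    by move=> x x0; rewrite damped_even //; exact: dF.
  move=> x x0; rewrite normrN neg sinN cosN mulrN.
  have -> : - (0 * sin (b * x)) = 0 * sin (b * x) by ring.
  by rewrite damped_even //; exact: dF.
have -> : Rintegral mu setT (fun x : T => complex.Im ((expR (- (e * `|x|)))%:C * cis (b * x))) = 0.
  under eq_Rintegral => x _ do rewrite EI.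
  pose F (s : R) := expR (- (e * s)) * (q * sin (b * s) + p * cos (b * s)).
  pose G (s : R) := expR (- (e * s)) * (- q * sin (b * s) + - p * cos (b * s)).
  have dF x : is_derive x (1 : R) F (expR (- (e * x)) * (-1 * sin (b * x) + 0 * cos (b * x))).
    apply: is_derive_eq (is_derive_damped e b q p x) _.
    by congr (_ * (_ * _ + _ * _)); rewrite /p /q; field.
  have dG x : is_derive x (1 : R) G (expR (- (e * x)) * (1 * sin (b * x) + 0 * cos (b * x))).
    apply: is_derive_eq (is_derive_damped e b (- q) (- p) x) _.
    by congr (_ * (_ * _ + _ * _)); rewrite /p /q; field.
  apply: (@etrans _ _ (- F 0 - G 0)); last first.
    by rewrite /F /G !mulr0 oppr0 expR0 sin0 cos0; ring.
  refine (@Rintegral_line _ _ F G _ (@continuous_damped_abs _ _ _ _) bI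
    (@damped_continuous _ _ _ _) _ (@damped_cvg0 _ _ _ _ e0) (@damped_continuous _ _ _ _) _ (@damped_cvg0 _ _ _ _ e0)).
    by move=> x x0; rewrite damped_even //; exact: dF.
  move=> x x0; rewrite normrN neg sinN cosN.
  have -> : -1 * - sin (b * x) = 1 * sin (b * x) by ring.
  by rewrite damped_even //; exact: dG.
by [].
Qed.

End inversion_kernel.

Section inversion.
Context {R : realType} {N : nat}.
Local Notation V := 'rV[R]_N.
Local Notation T := (measurableTypeR R).
Local Notation mu := (@lebesgue_measure R).
Local Notation L := (lebesgue_Rn R N).
Local Notation vec := (@vec_of_tuple R N).
Implicit Types (f g h : V -> R[i]) (x y xi : V) (B C e d : R) (j : 'I_N).

Lemma dotpC x y : dotp x y = dotp y x.
Proof. by apply: eq_bigr => j _; rewrite mulrC. Qed.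

Lemma cis_sum (I : Type) (s : seq I) (a : I -> R) :
  cis (\sum_(i <- s) a i) = \prod_(i <- s) cis (a i).
Proof.
elim: s => [|i s IH]; last by rewrite !big_cons cisD IH.
by rewrite !big_nil /cis cos0 sin0 oppr0.
Qed.

Let damp e (y x xi : V) : R[i] :=
  \prod_(j < N) ((expR (- (e * `|xi 0 j|)))%:C * cis ((x 0 j - y 0 j) * xi 0 j)).

Let damp_split e y x xi :
  damp e y x xi = (\prod_(j < N) (expR (- (e * `|xi 0 j|)))%:C) * cis (- dotp y xi) * wave xi x.
Proof.
rewrite /damp big_split /= -mulrA; congr (_ * _).
rewrite -cisD -cis_sum; congr cis.
by rewrite /dotp -sumrN -big_split /=; apply: eq_bigr => j _; ring.
Qed.

(* Integrating [fourier f] against the damped wave in two orders (Fubini). *)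
Lemma fourier_poisson f C e y : ccontinuous f -> dominated f C -> 0 < e ->
  cintegral (fun xi => (\prod_(j < N) (expR (- (e * `|xi 0 j|)))%:C) * cis (- dotp y xi) * fourier f xi) =
  cintegral (fun x => f x * (\prod_(j < N) (2 * poisson e (x 0 j - y 0 j)))%:C).
Proof.
move=> cf df e0.
pose D := 1 + 2 / e ^+ 2.
pose G (p : N.-tuple T * N.-tuple T) : R[i] := f (vec p.1) * damp e y (vec p.1) (vec p.2).
have [ik kI] := @integral_kern R N.
have mG : cmeasurable G.
  apply: cmeasurableM; first exact: (cmeasurable_comp measurable_fst (cmeasurable_vec cf)).
  apply: cmeasurable_prod => j.
  have mx : measurable_fun setT (fun p : N.-tuple T * N.-tuple T => tnth p.1 j).
    exact: (measurableT_comp (measurable_tnth j) measurable_fst).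
  have mxi : measurable_fun setT (fun p : N.-tuple T * N.-tuple T => tnth p.2 j).
    exact: (measurableT_comp (measurable_tnth j) measurable_snd).
  have mm : measurable_fun setT (fun p : N.-tuple T * N.-tuple T => (tnth p.1 j - y 0 j) * tnth p.2 j).
    by apply: measurable_funM => //; apply: measurable_funB.
  apply: cmeasurableM; split => /=.
  - under eq_fun do rewrite mxE.
    have cE : measurable_fun setT (fun s : T => expR (- (e * `|s|))).
      by apply: continuous_measurable_fun; exact: continuous_expR_abs.
    exact: (measurableT_comp cE mxi).
  - exact: measurable_cst.
  - under eq_fun do rewrite !mxE.
    have cE : measurable_fun setT (cos : T -> R).
      by apply: continuous_measurable_fun; exact: continuous_cos.
    exact: (measurableT_comp cE mm).
  - under eq_fun do rewrite !mxE.
    apply: measurable_funN.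
    have cE : measurable_fun setT (sin : T -> R).
      by apply: continuous_measurable_fun; exact: continuous_sin.
    exact: (measurableT_comp cE mm).
have damp_le x xi : cmod (damp e y x xi) <= D ^+ N * kerv xi.
  rewrite /damp cmod_prod.
  have -> : D ^+ N * kerv xi = \prod_(j < N) (D * ker1 (xi 0 j)).
    by rewrite big_split /= prodr_const card_ord.
  by apply: ler_prod => j _; rewrite cmod_ge0 cmod_damped; exact: expR_abs_ker1.
have hG (t u : N.-tuple T) : cmod (G (t, u)) <= (C * D ^+ N) * kern t * kern u.
  rewrite /G /= cmodM !kern_vec.
  apply: (@le_trans _ _ ((C * kerv (vec t)) * (D ^+ N * kerv (vec u)))).
    by apply: ler_pM; rewrite ?cmod_ge0.
  by rewrite le_eqVlt; apply/orP; left; apply/eqP; ring.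
have [F1 F2] := Cint_fubini ik ik mG hG.
rewrite !cintegralE; transitivity (Cint (L \x L)%E G).
  rewrite -F2; congr Cint; apply/funext => u.
  rewrite fourierE -(cintegralZ _ (ccontinuousM cf (ccontinuous_wave _)) (dominated_wave _ df)).
  rewrite cintegralE; congr Cint; apply/funext => t.
  by rewrite /G /= damp_split /mulop; ring.
rewrite -F1; congr Cint; apply/funext => t.
pose a j (s : T) : R[i] := (expR (- (e * `|s|)))%:C * cis ((vec t 0 j - y 0 j) * s).
have ma j : cmeasurable (a j).
  apply: cmeasurableM; split => /=.
  - by apply: continuous_measurable_fun; exact: continuous_expR_abs.
  - exact: measurable_cst.
  - apply: continuous_measurable_fun => s.
    apply: (@continuous_comp _ _ _ (fun s => (vec t 0 j - y 0 j) * s) cos); last exact: continuous_cos.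
    by apply: cvgM; [exact: cvg_cst|exact: cvg_id].
  - apply: continuous_measurable_fun => s; apply: cvgN.
    apply: (@continuous_comp _ _ _ (fun s => (vec t 0 j - y 0 j) * s) sin); last exact: continuous_sin.
    by apply: cvgM; [exact: cvg_cst|exact: cvg_id].
have ha j s : cmod (a j s) <= D * ker1 s.
  by rewrite /a cmod_damped; exact: expR_abs_ker1.
have -> : (fun u => G (t, u)) = fun u : N.-tuple T => f (vec t) * \prod_(j < N) a j (tnth u j).
  by apply/funext => u; rewrite /G /damp /=; congr (_ * _); apply: eq_bigr => j _; rewrite /a !mxE.
rewrite CintZ; last first.
  apply: (cintegrable_dominated (k := @kern R N) (C := D ^+ N)) => //.
    apply: cmeasurable_prod => j; exact: (cmeasurable_comp (measurable_tnth j) (ma j)).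
  move=> u; rewrite cmod_prod.
  have -> : D ^+ N * kern u = \prod_(j < N) (D * ker1 (tnth u j)).
    by rewrite big_split /= prodr_const card_ord.
  by apply: ler_prod => j _; rewrite cmod_ge0 ha.
rewrite (Cint_prod ma ha); congr (_ * _).
rewrite rmorph_prod; apply: eq_bigr => j _.
exact: Cint_damped.
Qed.

Let poissonN e y x := \prod_(j < N) (2 * poisson e (x 0 j - y 0 j)).

Let cont_poissonN e y : 0 < e -> continuous (fun x : V => poissonN e y x).
Proof.
move=> e0; apply: continuous_prod => j x.
apply: (@continuous_comp _ _ _ (fun x : V => x 0 j) (fun s => 2 * poisson e (s - y 0 j))).
  exact: continuous_coord.
move=> /=; apply: cvgM; first exact: cvg_cst.
apply: (@continuous_comp _ _ _ (fun s => s - y 0 j) (poisson e)).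
  by apply: cvgB; [exact: cvg_id|exact: cvg_cst].
exact: continuous_poisson.
Qed.

Let shift_bound e y : 0 < e -> exists2 D, 0 <= D & forall j (s : R),
  poisson e (s - y 0 j) <= D * ker1 s.
Proof.
move=> e0; exists (e * ((1 + 2 * enorm y ^+ 2) / e ^+ 2 + 2)).
  by rewrite mulr_ge0 ?(ltW e0) // addr_ge0 // divr_ge0 ?sqr_ge0 // addr_ge0 // mulr_ge0 // sqr_ge0.
move=> j s; apply: poisson_shift_ker1 => //.
rewrite -(real_normK (num_real (y 0 j))) lerXn2r ?nnegrE ?enorm_ge0 //.
exact: coord_le_enorm.
Qed.

Let Cint_shift_prod (a : R -> R) D I y : continuous a -> (forall j s, `|a (s - y 0 j)| <= D * ker1 s) ->
  (forall j, Rintegral mu setT (fun s : R => a (s - y 0 j)) = I) ->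
  cintegral (fun x => (\prod_(j < N) a (x 0 j - y 0 j))%:C) = (I ^+ N)%:C.
Proof.
move=> ca ha Ia; rewrite cintegralE.
pose b j (s : T) : R[i] := (a (s - y 0 j))%:C.
have mb j : cmeasurable (b j).
  split => /=; last exact: measurable_cst.
  apply: continuous_measurable_fun => s.
  apply: (@continuous_comp _ _ _ (fun s => s - y 0 j) a); last exact: ca.
  by apply: cvgB; [exact: cvg_id|exact: cvg_cst].
have hb j s : cmod (b j s) <= D * ker1 s by rewrite /b cmodC.
have -> : (fun t : N.-tuple T => (\prod_(j < N) a (vec t 0 j - y 0 j))%:C) =
    fun t => \prod_(j < N) b j (tnth t j).
  apply/funext => t; rewrite rmorph_prod; apply: eq_bigr => j _; by rewrite /b mxE.
rewrite (Cint_prod mb hb) (eq_bigr (fun=> I%:C)); last first.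
  by move=> j _; rewrite /Cint /b /= Ia Rintegral_cst0.
by rewrite prodr_const card_ord rmorphXn.
Qed.

Let Rint_poisson e a : 0 < e -> Rintegral mu setT (fun s : R => poisson e (s - a)) = pi.
Proof. by move=> e0; rewrite /Rintegral integral_poisson. Qed.

Let int_poisson e a D : 0 < e -> (forall s, poisson e (s - a) <= D * ker1 s) ->
  mu.-integrable setT (EFin \o (fun s : R => poisson e (s - a))).
Proof.
move=> e0 hD.
have mf : measurable_fun setT (fun s : T => poisson e (s - a)).
  apply: continuous_measurable_fun => s.
  apply: (@continuous_comp _ _ _ (fun s => s - a) (poisson e)).
    by apply: cvgB; [exact: cvg_id|exact: cvg_cst].
  exact: continuous_poisson.
have hD' s : `|poisson e (s - a)| <= D * ker1 s by rewrite ger0_norm // poisson_ge0.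
exact: (dominated_integrable mf integrable_ker1 hD').
Qed.

(** Near [y] this is continuity. Elsewhere some coordinate differs by at least [r], so the sum is at
    least [r] and [K * r = 2 * C] covers the trivial bound. The truncated distance is the one that
    [poisson_small] controls. *)
Lemma continuous_modulus f C y (eta : R) : ccontinuous f -> dominated f C -> 0 < eta ->
  exists2 K, 0 <= K & forall x,
    cmod (f x - f y) <= eta + K * \sum_(j < N) Num.min 1 `|x 0 j - y 0 j|.
Proof.
move=> [cr ci] df eta0.
have C0 : 0 <= C.
  by have := le_trans (cmod_ge0 _) (df 0); rewrite pmulr_lge0 // kerv_gt0.
have eta2 : 0 < eta / 2 by rewrite divr_gt0.
have hr := (@cvgrPdist_lt _ _ _ (nbhs y) (nbhs_filter y) (cRe f) (cRe f y)).1 (cr y) _ eta2.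
have hi := (@cvgrPdist_lt _ _ _ (nbhs y) (nbhs_filter y) (cIm f) (cIm f y)).1 (ci y) _ eta2.
have hn : nbhs y (_ `&` _) := @filterI _ (nbhs y) (nbhs_filter y) _ _ hr hi.
move: hn => /nbhs_ballP[rho /= rho0 hrho].
pose r := Num.min 1 rho.
have r0 : 0 < r by rewrite lt_min ltr01.
have min0 x j : 0 <= Num.min 1 `|x 0 j - y 0 j| by rewrite le_min ler01 normr_ge0.
exists (2 * C / r) => [|x]; first by rewrite divr_ge0 ?mulr_ge0 // ltW.
have S0 : 0 <= \sum_(j < N) Num.min 1 `|x 0 j - y 0 j| by apply: sumr_ge0 => j _.
have [near|] := pselect (forall j, `|x 0 j - y 0 j| < r).
  have bx : ball y rho x.
    split => // i j; rewrite ord1 /ball /= distrC; apply: lt_le_trans (near j) _.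
    by rewrite ge_min lexx orbT.
  have [h1 h2] := hrho x bx.
  apply: (@le_trans _ _ eta); last by rewrite lerDl mulr_ge0 // divr_ge0 ?mulr_ge0 // ltW.
  apply: (le_trans (cmod_le _)); rewrite (splitr eta); apply: lerD.
    by move: h1; rewrite /= /cRe distrC => h1; apply: ltW; move: h1; case: (f x) (f y) => a b [c d].
  by move: h2; rewrite /= /cIm distrC => h2; apply: ltW; move: h2; case: (f x) (f y) => a b [c d].
move/existsNP => [j /negP]; rewrite -leNgt => rj.
have bC z : cmod (f z) <= C.
  by apply: (le_trans (df z)); rewrite ler_piMr // kerv_le1.
apply: (@le_trans _ _ (2 * C)).
  apply: (le_trans (cmodD _ _)); rewrite /cmod normcN mulr_natl mulr2n.
  by apply: lerD; exact: bC.
apply: (@le_trans _ _ (2 * C / r * r)); first by rewrite divfK // gt_eqF.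
apply: (@le_trans _ _ (2 * C / r * \sum_(j < N) Num.min 1 `|x 0 j - y 0 j|)); last first.
  by rewrite lerDr ltW.
rewrite ler_wpM2l //; first by rewrite divr_ge0 ?mulr_ge0 // ltW.
rewrite (bigD1 j) //=; apply: (@le_trans _ _ (Num.min 1 `|x 0 j - y 0 j|)).
  by rewrite le_min rj ge_min lexx.
by rewrite lerDl; apply: sumr_ge0 => i _.
Qed.

(** In [fourier_poisson] the frequency side is bounded uniformly in the damping, while the other
    side tends to [f y] times the total mass [(2 * pi) ^+ N]. Explicit errors replace the limit. *)
Lemma fourier_bound f C B : ccontinuous f -> dominated f C ->
  ccontinuous (fourier f) -> dominated (fourier f) B ->
  forall y, cmod (f y) <= 2 * B.
Proof.
move=> cf df cFf dFf y.
have pi0 : 0 < pi :> R by exact: pi_gt0.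
pose S : R := 2 * (6 * pi) ^+ N.
have S0 : 0 <= S by rewrite mulr_ge0 // exprn_ge0 // mulr_ge0 // ltW.
suff H eta : 0 < eta -> exists2 K, 0 <= K & forall d, 0 < d -> d <= 1 ->
    cmod (f y) * (2 * pi) ^+ N <= 2 * (B * pi ^+ N) + S * (eta + K * N%:R * d).
  have B0 : 0 <= B.
    by have := le_trans (cmod_ge0 _) (dFf 0); rewrite pmulr_lge0 // kerv_gt0.
  have pN : 0 < pi ^+ N :> R by rewrite exprn_gt0.
  suff : cmod (f y) * (2 * pi) ^+ N <= 2 * (B * pi ^+ N).
    rewrite exprMn (mulrA (cmod _)) (mulrA 2) ler_pM2r // => h; apply: le_trans h.
    by rewrite ler_peMr ?cmod_ge0 // exprn_ege1 // ler1n.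
  (* Both error terms are made at most [eta], so that their total is at most
     [S * (2 * eta) <= eps]. *)
  apply/ler_addgt0Pr => eps eps0.
  pose eta := eps / (2 * (S + 1)).
  have eta0 : 0 < eta by rewrite divr_gt0 // mulr_gt0 //; lra.
  have [K K0 HK] := H eta eta0.
  pose Q := K * N%:R; have Q0 : 0 <= Q by rewrite mulr_ge0.
  pose d := Num.min 1 (eta / (Q + 1)).
  have Q1 : 0 < Q + 1 by lra.
  have d0 : 0 < d by rewrite lt_min ltr01 divr_gt0.
  have d1 : d <= 1 by rewrite ge_min lexx.
  apply: (le_trans (HK d d0 d1)); rewrite lerD2l -/Q.
  have : d <= eta / (Q + 1) by rewrite ge_min lexx orbT.
  rewrite ler_pdivlMr // => hd.
  have E : eta * (2 * (S + 1)) = eps by rewrite /eta divfK // gt_eqF // mulr_gt0 //; lra.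
  rewrite -E; nra.
move=> eta0; have [K K0 hK] := continuous_modulus y cf df eta0; exists K => // d.
move=> d0 d1; pose e := d ^+ 3.
have e0 : 0 < e by rewrite exprn_gt0.
have [D D0 hD] := shift_bound y e0.
have [DK DK0 hDK] := shift_bound y ltr01.
have P0 s : 0 <= poisson e s by exact: poisson_ge0.
have cP := @cont_poissonN e y e0.
have dP x : poissonN e y x <= (2 * D) ^+ N * kerv x.
  have -> : (2 * D) ^+ N * kerv x = \prod_(j < N) (2 * D * ker1 (x 0 j)).
    by rewrite big_split /= prodr_const card_ord.
  by apply: ler_prod => j _; rewrite mulr_ge0 //= -mulrA ler_wpM2l.
have PN0 x : 0 <= poissonN e y x by apply: prodr_ge0 => j _; rewrite mulr_ge0.
have E1 := fourier_poisson y cf df e0.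
have B1 : cmod (cintegral (fun xi => (\prod_(j < N) (expR (- (e * `|xi 0 j|)))%:C) *
    cis (- dotp y xi) * fourier f xi)) <= 2 * (B * pi ^+ N).
  apply: cintegral_le.
    apply: ccontinuousM cFf; apply: ccontinuousM.
      rewrite (_ : (fun x : V => _) = fun x : V => (\prod_(j < N) expR (- (e * `|x 0 j|)))%:C); last first.
        by apply/funext => x; rewrite rmorph_prod.
      split; last exact: cst_continuous.
      apply: continuous_prod => j x.
      apply: (@continuous_comp _ _ _ (fun x : V => x 0 j) (fun s => expR (- (e * `|s|)))).
        exact: continuous_coord.
      exact: continuous_expR_abs.
    have cN : continuous (fun x : V => - dotp y x).
      move=> x; apply: (@continuous_comp _ _ _ (fun x => dotp y x) (fun a => - a)); last exact: opp_continuous.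
      have -> : (fun x : V => dotp y x) = fun x : V => dotp x y by apply/funext => z; exact: dotpC.
      exact: continuous_dotp.
    split => x.
      by apply: (@continuous_comp _ _ _ (fun x : V => - dotp y x) cos); [exact: cN|exact: continuous_cos].
    apply: (@continuous_comp _ _ _ (fun x : V => - dotp y x) (fun a => - sin a)); first exact: cN.
    by apply: continuousN; exact: continuous_sin.
  move=> x; rewrite !cmodM cmod_cis mulr1 cmod_prod.
  apply: le_trans (dFf x); rewrite ler_piMl ?cmod_ge0 //.
  apply: prodr_ile1 => j _; apply/andP; split; first exact: cmod_ge0.
  rewrite cmodC ger0_norm ?expR_ge0 //.
  by rewrite -[leRHS]expR0 ler_expR oppr_le0 mulr_ge0 // ltW.
rewrite E1 in B1.
pose df' := fun x : V => (f x - f y) * (poissonN e y x)%:C.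
have cPC : ccontinuous (fun x : V => (poissonN e y x)%:C).
  by split; [exact: cP|exact: cst_continuous].
have dPC : dominated (fun x : V => (poissonN e y x)%:C) ((2 * D) ^+ N).
  by move=> x; rewrite cmodC ger0_norm.
have E2 : cintegral (fun x : V => (poissonN e y x)%:C) = ((2 * pi) ^+ N)%:C.
  apply: (@Cint_shift_prod (fun s => 2 * poisson e s) (2 * D)).
  - by move=> s; apply: cvgM; [exact: cvg_cst|exact: continuous_poisson].
  - move=> j s; have := hD j s; have := P0 (s - y 0 j).
    move: (poisson _ _) (D * _) (mulrA 2 D (ker1 s)) => p q <- p0 pq.
    by rewrite ger0_norm; lra.
  - by move=> j; rewrite RintegralZl ?Rint_poisson //; exact: int_poisson.
have cst_f : ccontinuous (fun x => f x - f y).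
  by apply: ccontinuousD => //; split; exact: cst_continuous.
have bdd2 x : cmod (f x - f y) <= eta + K * N%:R.
  apply: (le_trans (hK x)); rewrite lerD2l ler_wpM2l //.
  apply: (@le_trans _ _ (\sum_(j < N) 1)); last by rewrite sumr_const card_ord.
  by apply: ler_sum => j _; rewrite ge_min lexx.
have cdf : ccontinuous df' by exact: ccontinuousM cst_f cPC.
have ddf : dominated df' ((eta + K * N%:R) * (2 * D) ^+ N).
  move=> x; rewrite cmodM -mulrA; apply: ler_pM; rewrite ?cmod_ge0 //; exact: dPC.
have E3 : cintegral (fun x => f x * (poissonN e y x)%:C) = f y * ((2 * pi) ^+ N)%:C + cintegral df'.
  rewrite -E2 -(cintegralZ (f y) cPC dPC).
  rewrite -(cintegralD (ccontinuousZ (f y) cPC) cdf (dominatedZ (f y) dPC) ddf).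
  by congr cintegral; apply/funext => x; rewrite /df'; ring.
(* [A] dominates every factor of [poissonN], and [d * A] dominates a factor multiplied by its
   truncated distance. Its integral is [2 * (pi + 2 * pi)]. *)
pose A s := 2 * (poisson e s + 2 * ker1 s).
have A0 s : 0 <= A s by rewrite mulr_ge0 // addr_ge0 // mulr_ge0 // ker1_ge0.
have hA j s : A (s - y 0 j) <= 2 * (D + 2 * DK) * ker1 s.
  have := hDK j s; have := hD j s; rewrite /A -(poisson1 (s - y 0 j)); nra.
have cA : continuous A.
  move=> s; apply: cvgM; first exact: cvg_cst.
  apply: cvgD; first exact: continuous_poisson.
  by apply: cvgM; [exact: cvg_cst|exact: continuous_ker1].
have IA j : Rintegral mu setT (fun s : R => A (s - y 0 j)) = 6 * pi.
  pose p (s : T) := poisson e (s - y 0 j); pose q (s : T) := ker1 (s - y 0 j).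
  have ip : mu.-integrable setT (EFin \o p) := int_poisson e0 (hD j).
  have qE : q = fun s : T => poisson 1 (s - y 0 j).
    by apply/funext => s; rewrite poisson1.
  have iq : mu.-integrable setT (EFin \o q) by rewrite qE; exact: (int_poisson ltr01 (hDK j)).
  have i2q : mu.-integrable setT (EFin \o (fun s => 2 * q s)).
    exact: (integrableZl measurableT 2 iq).
  have ipq : mu.-integrable setT (EFin \o (fun s => p s + 2 * q s)).
    exact: (integrableD measurableT ip i2q).
  transitivity (2 * Rintegral mu setT (fun s => p s + 2 * q s)).
    exact (@RintegralZl _ _ _ mu setT (fun s => p s + 2 * q s) 2 measurableT ipq).
  have -> : Rintegral mu setT (fun s => p s + 2 * q s) = Rintegral mu setT p + 2 * Rintegral mu setT q.
    transitivity (Rintegral mu setT p + Rintegral mu setT (fun s => 2 * q s)).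
      exact (@RintegralD _ _ _ mu setT p (fun s => 2 * q s) measurableT ip i2q).
    congr (_ + _); exact (@RintegralZl _ _ _ mu setT q 2 measurableT iq).
  by rewrite qE /p !Rint_poisson //; ring.
have E4 : Rintegral L setT (fun t => \prod_(j < N) A (vec t 0 j - y 0 j)) = (6 * pi) ^+ N.
  have bA j s : `|A (s - y 0 j)| <= 2 * (D + 2 * DK) * ker1 s by rewrite ger0_norm.
  exact: (congr1 (@complex.Re R) (Cint_shift_prod cA bA IA)).
have [ik _] := @integral_kern R N.
have B2 : cmod (cintegral df') <= S * (eta + K * N%:R * d).
  have -> : S * (eta + K * N%:R * d) = 2 * ((eta + K * N%:R * d) * (6 * pi) ^+ N) by rewrite /S; ring.
  rewrite cintegralE.
  apply: (Cint_le (k := fun t : N.-tuple T => \prod_(j < N) A (vec t 0 j - y 0 j)) (cmeasurable_vec cdf) _ E4).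
    apply: (dominated_integrable (D := (2 * (D + 2 * DK)) ^+ N) _ ik).
      apply: (measurable_vec (u := fun x => \prod_(j < N) A (x 0 j - y 0 j))).
      apply: continuous_prod => j x.
      apply: (@continuous_comp _ _ _ (fun x : V => x 0 j) (fun s => A (s - y 0 j))).
        exact: continuous_coord.
      move=> /=; apply: (@continuous_comp _ _ _ (fun s => s - y 0 j) A); last exact: cA.
      by apply: cvgB; [exact: cvg_id|exact: cvg_cst].
    move=> t; rewrite ger0_norm; last exact: prodr_ge0.
    have -> : (2 * (D + 2 * DK)) ^+ N * kern t = \prod_(j < N) (2 * (D + 2 * DK) * ker1 (tnth t j)).
      by rewrite big_split /= prodr_const card_ord.
    by apply: ler_prod => j _; rewrite A0 mxE hA.
  move=> t; move: (vec t) => x; rewrite /df' cmodM cmodC ger0_norm //.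
  apply: (@le_trans _ _ ((eta + K * (\sum_(j < N) Num.min 1 `|x 0 j - y 0 j|)) * poissonN e y x)).
    by rewrite ler_wpM2r.
  rewrite !mulrDl; apply: lerD.
    rewrite ler_wpM2l ?(ltW eta0) //; apply: ler_prod => j _; rewrite mulr_ge0 //=.
    by rewrite /A ler_wpM2l // lerDl mulr_ge0 // ker1_ge0.
  rewrite -!mulrA ler_wpM2l // mulr_suml.
  have -> : N%:R * (d * \prod_(j < N) A (x 0 j - y 0 j)) =
      \sum_(i < N) (d * \prod_(j < N) A (x 0 j - y 0 j)).
    by rewrite sumr_const card_ord mulr_natl.
  (* Only the factor of coordinate [i] carries the truncated distance and yields [d]; the others are
     just replaced by [A]. *)
  apply: ler_sum => i _; rewrite /poissonN (bigD1 i) //= [in leRHS](bigD1 i) //= [leLHS]mulrA [leRHS]mulrA.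
  apply: ler_pM.
  - by apply: mulr_ge0; [rewrite le_min ler01 normr_ge0|exact: mulr_ge0].
  - by apply: prodr_ge0 => j _; rewrite mulr_ge0.
  - have := poisson_small (x 0 i - y 0 i) d0 d1; rewrite -/e /A => hp.
    apply: (@le_trans _ _ (2 * (Num.min 1 `|x 0 i - y 0 i| * poisson e (x 0 i - y 0 i)))); first by rewrite mulrCA.
    by rewrite (mulrCA d) ler_wpM2l.
  - apply: ler_prod => j _; rewrite mulr_ge0 //= /A ler_wpM2l // lerDl.
    by rewrite mulr_ge0 // ker1_ge0.
have -> : cmod (f y) * (2 * pi) ^+ N = cmod (f y * ((2 * pi) ^+ N)%:C).
  by rewrite cmodM cmodC ger0_norm // exprn_ge0 // mulr_ge0 // ltW.
have -> : f y * ((2 * pi) ^+ N)%:C =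
   cintegral (fun x => f x * (poissonN e y x)%:C) + (- 1) * cintegral df'.
  by rewrite E3; ring.
rewrite (le_trans (cmodD _ _)) // lerD //.
by rewrite mulN1r /cmod normcN.
Qed.

End inversion.

(** * Weighted estimates of derivatives *)

Section weighted_fourier.
Context {R : realType} {N : nat}.
Local Notation V := 'rV[R]_N.
Variable w : R -> R.
Hypothesis hw : nonquasianalytic_weight w.
Hypothesis hN : (0 < N)%N.
Local Notation om x := (w (enorm x)).
Local Notation ub := (@ub R w).
Implicit Types (f g h : V -> R[i]) (p x y xi : V) (l m a b A B C M : R)
  (j : 'I_N) (ws : seq 'I_N) (k : nat).

Lemma om_ge0 x : 0 <= om x.
Proof. by apply: (weight_ge0 hw); exact: enorm_ge0. Qed.

Lemma om_ge_coord x j : w `|x 0 j| <= om x.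
Proof. by apply: (weight_le hw) => //; exact: coord_le_enorm. Qed.

(** The largest coordinate is comparable with the Euclidean norm. This reduces weights of vectors to
    one variable; [0 < N] provides the coordinate. *)
Lemma om_le_coord : exists2 L : R, 1 <= L & forall x, exists j, om x <= L * (1 + w `|x 0 j|).
Proof.
have [L L1 hL] := weight_scale hw N; exists L => // x.
have [j [hj _]] := enorm_le_coord x hN; exists j.
apply: le_trans (hL _ (normr_ge0 _)).
by apply: (weight_le hw) => //; exact: enorm_ge0.
Qed.

(** The hypothesis on coordinates reduces the claim to [weight_add] at the coordinate given by
    [om_le_coord]. *)
Lemma om_triangle : exists2 K : R, 1 <= K & forall x y z : V,
  (forall j, `|x 0 j| <= `|y 0 j| + `|z 0 j|) -> om x <= K * (1 + om y + om z).
Proof.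
have [L L1 hL] := om_le_coord; have [K K1 hK] := weight_add hw.
exists (L * (1 + K)) => [|x y z h]; first by rewrite mulr_ege1 // lerDl; lra.
have [j hj] := hL x; apply: (le_trans hj); rewrite -mulrA ler_wpM2l //; first lra.
have h1 : w `|x 0 j| <= K * (1 + w `|y 0 j| + w `|z 0 j|).
  apply: le_trans (hK _ _ (normr_ge0 _) (normr_ge0 _)).
  by apply: (weight_le hw) => //; exact: h.
have h2 : K * (1 + w `|y 0 j| + w `|z 0 j|) <= K * (1 + om y + om z).
  by rewrite ler_wpM2l //; [lra|rewrite !lerD // om_ge_coord].
have := om_ge0 y; have := om_ge0 z; rewrite mulrDl mul1r; lra.
Qed.

(** Each factor of [kerv x] is at least the inverse square of [1 + enorm x], so (gamma) pays for any
    power of [kerv]. *)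
Lemma om_kerv k : exists b, 0 < b /\ exists2 C, 1 <= C &
  forall x, expR (- (b * om x)) <= C * kerv x ^+ k.
Proof.
have [b [b0 [C C1 hC]]] := weight_expr hw (2 * N * k).
exists b; split => //; exists C => // x.
have e0 := enorm_ge0 x.
have h1 : ((1 + enorm x) ^+ (2 * N * k))^-1 <= kerv x ^+ k.
  rewrite exprM -exprVn lerXn2r ?nnegrE ?invr_ge0 ?exprn_ge0 ?(ltW (kerv_gt0 x)) //; try lra.
  rewrite exprM -exprVn /kerv.
  have -> : (((1 + enorm x) ^+ 2)^-1) ^+ N = \prod_(j < N) ((1 + enorm x) ^+ 2)^-1.
    by rewrite prodr_const card_ord.
  apply: ler_prod => j _; rewrite invr_ge0 sqr_ge0 /= /ker1.
  rewrite lef_pV2 ?posrE ?exprn_gt0 //; try by have := sqr_ge0 (x 0 j); lra.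
  have : x 0 j ^+ 2 <= enorm x ^+ 2.
    rewrite -(real_normK (num_real (x 0 j))) lerXn2r ?nnegrE //; exact: coord_le_enorm.
  by rewrite sqrrD expr1n mul1r; lra.
apply: (@le_trans _ _ (C * ((1 + enorm x) ^+ (2 * N * k))^-1)); last by rewrite ler_wpM2l //; lra.
have h0 : 0 < (1 + enorm x) ^+ (2 * N * k) by rewrite exprn_gt0 //; lra.
rewrite ler_pdivlMr // expRN mulrC ler_pdivrMr ?expR_gt0 //; exact: hC.
Qed.

(** The supremum may be infinite for small [l]; (gamma) makes it finite once [l] is large in terms
    of [k]. *)
Lemma ub_exists k : exists2 l, 0 < l & exists M, ub l k M.
Proof.
have [b [b0 [C C1 hC]]] := weight_expr hw k; exists b => //; exists C => r r1.
rewrite expRN ler_pdivrMr ?expR_gt0 //; apply: le_trans (hC r _); last lra.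
by rewrite lerXn2r ?nnegrE; lra.
Qed.

(* In multi-index notation: [|D^alpha f x| <= a * exp (l phi^*(|alpha| / l))] for all [alpha]. *)
Definition dbound l a f x := forall ws M, sorted_word ws -> ub l (size ws) M ->
  cmod (dw ws f x) <= a * M.

Lemma dbound_le l l' a a' f x : l' <= l -> a <= a' -> dbound l a f x -> dbound l' a' f x.
Proof.
move=> ll aa h ws M sws hM; apply: le_trans (h _ _ sws (ub_le hw ll hM)) _.
by rewrite ler_wpM2r //; have := ub_ge1 hw hM; lra.
Qed.

(** [ub_geom] provides a bound divided by [2 ^ k], which cancels the number of terms of the product
    rule, and [ub_split] distributes it over the two factors. *)
Lemma dbound_mul l : 0 <= l -> exists2 L : R, 1 <= L & exists2 C, 1 <= C &
  forall f g x a b, smooth f -> smooth g -> 0 <= a -> 0 <= b ->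
    dbound (l * L) a f x -> dbound (l * L) b g x -> dbound l (C * (a * b)) (mulop f g) x.
Proof.
move=> l0; have [L L1 [C C1 hC]] := ub_geom hw 1 l0.
exists L => //; exists C => // f g x a b sf sg a0 b0 fa gb ws M sws hM.
have lL0 : 0 <= l * L by rewrite mulr_ge0 //; lra.
have h1 := hC (l * L) _ _ (lexx _) hM.
have E : C * (a * b) * M = 2 ^+ size ws * (a * b * (C * M / 2 ^+ size ws)).
  have : 2 ^+ size ws != 0 :> R by rewrite expf_neq0.
  by move=> ?; field.
rewrite E; apply: dw_mulop_le => // u v su sv suv.
move: h1; rewrite -suv => h1.
have [M1 [M2 [m1 m2 m12]]] := ub_split hw lL0 h1.
apply: (@le_trans _ _ ((a * M1) * (b * M2))).
  by apply: ler_pM; rewrite ?cmod_ge0 //; [exact: fa|exact: gb].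
by rewrite mulrACA ler_wpM2l // mulr_ge0.
Qed.

(** Factorial growth lies below every [E_l] up to a constant, so tensors of analytic jets satisfy
    the bounds for all [l]. *)
Lemma dbound_tensor (A : nat) l : 0 < l -> exists2 C, 1 <= C &
  forall (g : 'I_N -> nat -> R -> R) x (b : 'I_N -> R), (forall j, jet (g j)) ->
    (forall j k, `|g j k (x 0 j)| <= A%:R ^+ k * k`!%:R * b j) ->
    dbound l (C * \prod_j b j) (tensor g (fun=> 0%N)) x.
Proof.
move=> l0; have [C C1 hC] := ub_fact hw A l0; exists C => // g x b jg hg ws M sws hM.
apply: (le_trans (dw_tensor_le _ jg _ hg)) => //.
rewrite [leRHS]mulrAC ler_wpM2r //; last exact: hC.
apply: prodr_ge0 => j _; have := hg j 0%N; rewrite expr0 fact0 !mul1r.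
exact: le_trans.
Qed.

Definition allrapid f := forall ws, sorted_word ws -> rapid (dw ws f).

Lemma allrapidP f : (forall l k, 0 < l -> exists B, forall x, dbound l (B * kerv x ^+ k) f x) ->
  allrapid f.
Proof.
move=> h ws sws k; have [l l0 [M hM]] := ub_exists (size ws).
have [B hB] := h l k l0; exists (B * M) => x; rewrite mulrAC; exact: hB.
Qed.

Lemma fourier_dw ws f xi : smooth f -> allrapid f -> sorted_word ws ->
  cmod (fourier (dw ws f) xi) = \prod_(j <- ws) `|xi 0 j| * cmod (fourier f xi).
Proof.
move=> sf rf; elim: ws => [|j ws IH] sws; first by rewrite big_nil mul1r.
have sws' : sorted_word ws by move: sws; rewrite /sorted_word /=; exact: path_sorted.
have [C0 C00 d0] := rapid_dominated (rf _ sws').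
have [C1 C10 d1] := rapid_dominated (rf _ sws).
have d0' : dominated (dw ws f) (C0 + C1).
  by move=> x; apply: (le_trans (d0 x)); rewrite ler_wpM2r ?(ltW (kerv_gt0 x)) // lerDl.
have d1' : dominated (partial j (dw ws f)) (C0 + C1).
  by move=> x; apply: (le_trans (d1 x)); rewrite ler_wpM2r ?(ltW (kerv_gt0 x)) // lerDr.
have sd := smooth_dw ws sf.
rewrite -[dw (j :: ws) f]/(partial j (dw ws f)) (fourier_partial xi (smooth_derivable sd) (smooth_ccontinuous sd)
  (smooth_ccontinuous (smooth_partial j sd)) d0' d1').
rewrite cmodM IH // big_cons mulrA; congr (_ * _ * _).
by rewrite /cmod /= expr0n /= add0r sqrtr_sqr.
Qed.

(* The optimal order [k] of differentiation is provided by [ub_legendre]. *)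
Lemma fourier_decay m : 0 <= m -> exists2 l, 0 < l & exists2 c, 0 <= c &
  forall f B, smooth f -> allrapid f -> 0 <= B -> (forall x, dbound l (B * kerv x) f x) ->
  forall xi, cmod (fourier f xi) <= c * B * expR (- (m * om xi)).
Proof.
move=> m0; have [L L1 hL] := om_le_coord.
have [b [b0 [C C1 hC]]] := weight_log hw.
(* [m * L] produces the decay after passing to one coordinate; [b] pays for the extra factor [r] of
   [ub_legendre]. *)
pose l := m * L + b.
have mL0 : 0 <= m * L by rewrite mulr_ge0 //; lra.
have l0 : 0 < l by rewrite /l; lra.
have pN : 0 <= pi ^+ N :> R by rewrite exprn_ge0 // ltW // pi_gt0.
exists l => //; exists (2 * pi ^+ N * C * expR (m * L)).
  by rewrite !mulr_ge0 ?expR_ge0 //; lra.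
move=> f B sf rf B0 fB xi; have [j hj] := hL xi.
(* [ub] speaks of radii at least 1; as [w] vanishes on [[0, 1]], the truncation does not change the
   weight. *)
pose r := Num.max 1 `|xi 0 j|.
have r1 : 1 <= r by rewrite le_max lexx.
have wr : w r = w `|xi 0 j|.
  rewrite /r; case: (leP `|xi 0 j| 1) => // x1; rewrite (weight1 hw).
  by rewrite (weight_normalized hw) // normr_ge0.
have key M k : ub l k M -> `|xi 0 j| ^+ k * cmod (fourier f xi) <= 2 * (B * M * pi ^+ N).
  move=> hM; have := fourier_dw xi sf rf (sorted_nseq k j).
  rewrite big_nseq -/(GRing.exp _ _) => E.
  have -> : `|xi 0 j| ^+ k = iter k ( *%R `|xi 0 j|) 1.
    by elim: k {hM E} => // k IH; rewrite exprS IH.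
  rewrite -E; apply: fourier_le; first exact: smooth_ccontinuous (smooth_dw _ sf).
  move=> x; rewrite mulrAC; apply: fB; first exact: sorted_nseq.
  by rewrite size_nseq.
have main : cmod (fourier f xi) <= 2 * pi ^+ N * B * (r * expR (- (l * w r))).
  case: (leP `|xi 0 j| 1) => x1.
    have := key _ _ (ub0 hw (ltW l0)); rewrite expr0 mul1r => h.
    apply: (le_trans h); rewrite /r; have -> : Num.max 1 `|xi 0 j| = 1 by apply/max_idPl.
    by rewrite (weight1 hw) mulr0 oppr0 expR0; lra.
  have rE : r = `|xi 0 j| by apply/max_idPr; exact: ltW.
  have [k hk] := ub_legendre hw (ltW l0) r1.
  have := key _ _ hk; rewrite -rE exprS => h.
  have rk : 0 < r ^+ k by rewrite exprn_gt0 //; lra.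
  rewrite -(ler_pM2l rk); apply: (le_trans h).
  by rewrite le_eqVlt; apply/orP; left; apply/eqP; ring.
apply: (le_trans main).
rewrite -!mulrA ler_wpM2l // ler_wpM2l //.
rewrite [leRHS](_ : _ = B * (C * (expR (m * L) * expR (- (m * om xi))))); last by ring.
rewrite ler_wpM2l //.
have hr : r <= C * expR (b * w r) by apply: le_trans (hC r _); lra.
apply: (@le_trans _ _ (C * expR (b * w r) * expR (- (l * w r)))).
  by rewrite ler_wpM2r ?expR_ge0.
rewrite -mulrA -!expRD ler_wpM2l ?ler_expR //; first lra.
have : m * om xi <= m * (L * (1 + w r)) by rewrite wr ler_wpM2l.
by rewrite /l; lra.
Qed.

(** Derivatives become at most [enorm xi ^ k], which is bounded by [M * expR (l * om xi)]; the extra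
    decay [b] makes the product integrable. *)
Lemma fourier_inversion_bound : exists2 b, 0 < b & exists2 c, 0 <= c & forall l f B,
  0 <= l -> smooth f -> allrapid f -> 0 <= B ->
  (forall xi, cmod (fourier f xi) <= B * expR (- ((l + b) * om xi))) ->
  forall y, dbound l (c * B) f y.
Proof.
have [b [b0 [C C1 hC]]] := om_kerv 1; exists b => //; exists (2 * C); first lra.
move=> l f B l0 sf rf B0 fB y ws M sws hM.
have M1 := ub_ge1 hw hM.
have cf := smooth_ccontinuous (smooth_dw ws sf); have rw := rf _ sws.
have [D D0 hD] := rapid_dominated rw.
have H : dominated (fourier (dw ws f)) (C * B * M).
  move=> xi; rewrite fourier_dw //.
  have h1 : \prod_(j <- ws) `|xi 0 j| <= enorm xi ^+ size ws.
    elim: (ws) => [|j s IH]; first by rewrite big_nil.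
    rewrite big_cons exprS; apply: ler_pM => //; last exact: coord_le_enorm.
    by apply: prodr_ge0.
  apply: (@le_trans _ _ ((M * expR (l * om xi)) * (B * expR (- ((l + b) * om xi))))).
    apply: ler_pM => //; rewrite ?cmod_ge0 //; first exact: prodr_ge0.
    apply: (le_trans h1); apply: ub_expr => //; exact: enorm_ge0.
  rewrite mulrACA -expRD.
  have -> : l * om xi + - ((l + b) * om xi) = - (b * om xi) by ring.
  have -> : C * B * M * kerv xi = M * B * (C * kerv xi ^+ 1) by rewrite expr1; ring.
  by rewrite ler_wpM2l // mulr_ge0 //; lra.
have := fourier_bound cf hD (fourier_continuous cf rw) H y.
by rewrite !mulrA.
Qed.

End weighted_fourier.

(** * Hyperbolic windows *)

Section hyperbolic_windows.
Context {R : realType}.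
Implicit Types (s x y : R) (n k : nat).

(** The hyperbolic cosine for even [n], the hyperbolic sine for odd [n]. *)
Definition cosh_jet n x : R := (expR x + (-1) ^+ n * expR (- x)) / 2.

Lemma jet_cosh : jet cosh_jet.
Proof.
move=> n x.
have h1 : is_derive x (1 : R) (fun y : R => expR y + (-1) ^+ n * expR (- y))
    (expR x + (-1) ^+ n * (expR (- x) * -1)).
  by apply: is_deriveD; apply: is_deriveZ.
have -> : cosh_jet n.+1 x = 2^-1 *: (expR x + (-1) ^+ n * (expR (- x) * -1)).
  by rewrite /cosh_jet exprS /GRing.scale /=; field.
have -> : cosh_jet n = 2^-1 \*: (fun y : R => expR y + (-1) ^+ n * expR (- y)).
  by apply/funext => y; rewrite /cosh_jet /= /GRing.scale /= mulrC.
exact: is_deriveZ.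
Qed.

Lemma cosh_ge1 x : 1 <= cosh_jet 0 x.
Proof.
rewrite /cosh_jet expr0 mul1r expRN; have := expR_gt0 x; move: (expR x) => a a0.
rewrite ler_pdivlMr // mul1r -subr_ge0.
have -> : a + a^-1 - 2 = (a - 1) ^+ 2 / a by field; rewrite gt_eqF.
by rewrite divr_ge0 ?sqr_ge0 // ltW.
Qed.

Lemma cosh_jet_le n x : `|cosh_jet n x| <= cosh_jet 0 x.
Proof.
rewrite /cosh_jet normrM (ger0_norm (_ : 0 <= 2^-1)) ?invr_ge0 // ler_wpM2r ?invr_ge0 //.
apply: (le_trans (ler_normD _ _)); rewrite normrM normrX normrN1 expr1n !ger0_norm ?expR_ge0 //.
Qed.

Lemma cosh_ge_expR x : expR `|x| / 2 <= cosh_jet 0 x.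
Proof.
rewrite /cosh_jet expr0 mul1r ler_wpM2r ?invr_ge0 //.
by case: (ger0P x) => _; rewrite ?lerDl ?lerDr expR_ge0.
Qed.

Lemma sech_jet : exists r, [/\ jet r, forall x, r 0%N x = (cosh_jet 0 x)^-1 &
  forall n x, `|r n x| <= 2 ^+ n * n`!%:R * r 0%N x].
Proof.
have c0 x : 0 < cosh_jet 0 x by exact: lt_le_trans ltr01 (cosh_ge1 x).
have [r [jr r0 hr]] := jet_inv jet_cosh c0; exists r; split => // n x.
have := hr 1 ler01; rewrite mulr1; apply => {}n {}x.
apply: (le_trans (cosh_jet_le n x)); rewrite expr1n mul1r.
by rewrite ler_peMl ?(ltW (c0 x)) // ler1n fact_gt0.
Qed.

Lemma sech_ge0 x : 0 <= (cosh_jet 0 x)^-1.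
Proof. by rewrite invr_ge0; exact: le_trans ler01 (cosh_ge1 x). Qed.

Lemma sech_le1 x : (cosh_jet 0 x)^-1 <= 1.
Proof. by rewrite invf_le1 ?cosh_ge1 //; exact: lt_le_trans ltr01 (cosh_ge1 x). Qed.

Lemma cosh0 : cosh_jet 0 0 = 1.
Proof. by rewrite /cosh_jet expr0 mul1r oppr0 expR0; field. Qed.

Variable w : R -> R.
Hypothesis hw : nonquasianalytic_weight w.

Lemma sech_decay (m : R) : 0 <= m -> exists2 C : R, 1 <= C &
  forall s, (cosh_jet 0 s)^-1 <= C * expR (- (m * w `|s|)).
Proof.
(* With this slope [m * w] is at most [|s|] plus a constant; the summand 1 allows [m = 0]. *)
move=> m0; have e0 : 0 < (m + 1)^-1 by rewrite invr_gt0; lra.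
have [C C0 hC] := weight_littleo hw e0.
exists (2 * expR (m * C)) => [|s].
  have : 1 <= expR (m * C) by rewrite -[leLHS]expR0 ler_expR mulr_ge0.
  lra.
apply: (@le_trans _ _ (2 * expR (- `|s|))).
  have c0 : 0 < cosh_jet 0 s by exact: lt_le_trans ltr01 (cosh_ge1 s).
  have d0 : 0 < (2 * expR (- `|s|))^-1 by rewrite invr_gt0 mulr_gt0 // expR_gt0.
  rewrite -[leRHS]invrK lef_pV2 ?posrE //.
  by rewrite expRN invfM invrK mulrC; exact: cosh_ge_expR.
rewrite -mulrA -expRD ler_pM2l // ler_expR.
have h := hC _ (normr_ge0 s).
have : m * w `|s| <= m * ((m + 1)^-1 * `|s| + C) by rewrite ler_wpM2l.
have : m * (m + 1)^-1 * `|s| <= 1 * `|s|.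
  by rewrite ler_wpM2r // ler_pdivrMr; lra.
rewrite mulrDr mulrA; lra.
Qed.

(** The coordinate that carries the weight of the vector supplies all the decay; the exponentials of
    the others are at most 1. *)
Lemma prod_decay (N : nat) (hN : (0 < N)%N) (u : 'I_N -> R -> R) : (forall j s, 0 <= u j s) ->
  (forall m : R, 0 <= m -> exists2 C : R, 1 <= C & forall j s, u j s <= C * expR (- (m * w `|s|))) ->
  forall m : R, 0 <= m -> exists2 C : R, 1 <= C &
    forall x : 'rV[R]_N, \prod_(j < N) u j (x 0 j) <= C * expR (- (m * w (enorm x))).
Proof.
move=> u0 hu m m0; have [L L1 hL] := om_le_coord hw hN.
have mL0 : 0 <= m * L by rewrite mulr_ge0 //; lra.
have [C C1 hC] := hu _ mL0.
exists (C ^+ N * expR (m * L)) => [|x].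
  by rewrite mulr_ege1 ?exprn_ege1 // -[leLHS]expR0 ler_expR.
apply: (@le_trans _ _ (\prod_(j < N) (C * expR (- (m * L * w `|x 0 j|))))).
  by apply: ler_prod => j _; rewrite u0 hC.
rewrite big_split /= prodr_const card_ord -mulrA ler_wpM2l //; first by rewrite exprn_ge0 //; lra.
rewrite -expRD.
have [j hj] := hL x.
rewrite (bigD1 j) //=; apply: (@le_trans _ _ (expR (- (m * L * w `|x 0 j|)) * 1)).
  rewrite ler_wpM2l ?expR_ge0 //; apply: prodr_ile1 => i _; rewrite expR_ge0 /=.
  rewrite -[leRHS]expR0 ler_expR oppr_le0 mulr_ge0 //; exact: (weight_ge0 hw).
rewrite mulr1 ler_expR.
have : m * w (enorm x) <= m * (L * (1 + w `|x 0 j|)) by rewrite ler_wpM2l.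
lra.
Qed.

End hyperbolic_windows.

(** * Characterisation of S_omega by derivatives alone *)

Section test_space.
Context {R : realType} {N : nat}.
Local Notation V := 'rV[R]_N.
Variable w : R -> R.
Hypothesis hw : nonquasianalytic_weight w.
Hypothesis hN : (0 < N)%N.
Local Notation om x := (w (enorm x)).
Local Notation ub := (@ub R w).
Local Notation dbound := (@dbound R N w).
Implicit Types (f g h : V -> R[i]) (p x y xi : V) (l m a b A B C M : R)
  (j : 'I_N) (ws : seq 'I_N) (k : nat).

Definition decaying f := forall m, 0 < m -> exists2 C, 0 <= C &
  forall x, cmod (f x) <= C * expR (- (m * om x)).

Lemma decaying_rapid f : decaying f -> rapid f.
Proof.
move=> hf k; have [b [b0 [C C1 hC]]] := @om_kerv R N w hw k.
have [D D0 hD] := hf b b0; exists (D * C) => x; apply: (le_trans (hD x)).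
by rewrite -mulrA ler_wpM2l.
Qed.

Lemma weighted_sup_normP l f : (weighted_sup_norm w l f < +oo)%E <->
  exists2 C, 0 <= C & forall x, cmod (f x) <= C * expR (- (l * om x)).
Proof.
rewrite /weighted_sup_norm; set S := [set _ | _ in _]; split=> [h|[C C0 hC]].
  have ub1 x : ((expR (l * om x) * cmod (f x))%:E <= ereal_sup S)%E.
    by apply: ereal_sup_ubound; exists x.
  have s0 : (0 <= ereal_sup S)%E.
    by apply: le_trans (ub1 0); rewrite lee_fin mulr_ge0 ?expR_ge0 ?cmod_ge0.
  have sfin : ereal_sup S \is a fin_num by rewrite ge0_fin_numE.
  exists (fine (ereal_sup S)) => [|x]; first exact: fine_ge0.
  rewrite expRN ler_pdivlMr ?expR_gt0 // mulrC -lee_fin fineK //.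
apply: (@le_lt_trans _ _ C%:E); last exact: ltry.
apply: ge_ereal_sup => _ [x _ <-]; rewrite lee_fin.
by have := hC x; rewrite expRN ler_pdivlMr ?expR_gt0 // mulrC.
Qed.

Lemma S_omega_decaying g ws : S_omega w g -> sorted_word ws ->
  decaying (dw ws g) /\ decaying (dw ws (fourier g)).
Proof.
move=> [_ _ _ hg] sws; have [alpha _ E] := @dw_dmulti R N ws sws.
by split=> m m0; have [h1 h2] := hg m alpha m0; rewrite E; apply/weighted_sup_normP.
Qed.

(** The description of [S_omega] by derivatives alone; [S_omegaE] proves the equivalence. *)
Definition Qspace g := smooth g /\ forall l m, 0 < l -> 0 < m ->
  exists2 C, 0 <= C & forall x, dbound l (C * expR (- (m * om x))) g x.

(** The growth rate [n] may depend on [l], as in [O_M_omega]; here [l] is real and every bound is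
    finite. *)
Definition OMspace f := smooth f /\ forall l, 0 < l -> exists2 n : R, 0 <= n &
  exists2 C, 0 <= C & forall x, dbound l (C * expR (n * om x)) f x.

Lemma Q_decaying g ws : Qspace g -> sorted_word ws -> decaying (dw ws g).
Proof.
move=> [_ hg] sws m m0; have [l l0 [M hM]] := ub_exists hw (size ws).
have [C C0 hC] := hg l m l0 m0; have M1 := ub_ge1 hw hM.
exists (C * M) => [|x]; first by rewrite mulr_ge0 //; lra.
by rewrite mulrAC; exact: hC.
Qed.

Lemma Q_allrapid g : Qspace g -> allrapid g.
Proof. by move=> hg ws sws; apply: decaying_rapid; exact: Q_decaying. Qed.

(** The constants are independent of [g], so the same estimate gives the multiplier property and the
    continuity of multiplication. *)
Lemma OM_mul f l m : OMspace f -> 0 < l -> 0 < m -> exists l' m' C,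
  [/\ 0 < l', 0 < m', 0 <= C & forall g B, smooth g -> 0 <= B ->
    (forall x, dbound l' (B * expR (- (m' * om x))) g x) ->
    forall x, dbound l (C * B * expR (- (m * om x))) (mulop f g) x].
Proof.
move=> [sf hf] l0 m0; have [L L1 [C C1 hC]] := dbound_mul (N := N) hw (ltW l0).
have lL : 0 < l * L by rewrite mulr_gt0 //; lra.
have [n n0 [D D0 hD]] := hf _ lL.
exists (l * L), (m + n), (C * D); split => //; first lra.
  by rewrite mulr_ge0 //; lra.
move=> g B sg B0 gB x.
have := hC f g x _ _ sf sg _ _ (hD x) (gB x).
rewrite !mulr_ge0 ?expR_ge0 // => /(_ isT isT).
apply: dbound_le => //.
rewrite [leLHS](_ : _ = C * D * B * (expR (n * om x) * expR (- ((m + n) * om x)))); last by ring.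
by rewrite -expRD; have -> : n * om x + - ((m + n) * om x) = - (m * om x) by ring.
Qed.

Lemma OM_Q f g : OMspace f -> Qspace g -> Qspace (mulop f g).
Proof.
move=> hf [sg hg]; split; first exact: smoothM hf.1 sg.
move=> l m l0 m0; have [l' [m' [C [l'0 m'0 C0 hC]]]] := OM_mul hf l0 m0.
have [B B0 hB] := hg l' m' l'0 m'0; exists (C * B); first by rewrite mulr_ge0.
exact: hC.
Qed.

Lemma dw_cst (c : R[i]) ws : dw ws (fun _ : V => c) = fun=> if ws is [::] then c else 0.
Proof.
elim: ws => //= j ws IH; rewrite -/(dw ws _) IH; apply/funext => x.
by rewrite /partial /cRe /cIm !derive_cst.
Qed.

Lemma OM_cst (c : R[i]) : OMspace (fun=> c).
Proof.
split; first exact: smooth_cst.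
move=> l l0; exists 0 => //; exists (cmod c) => [|x ws M _ hM]; first exact: cmod_ge0.
rewrite dw_cst mul0r expR0 mulr1; have M1 := ub_ge1 hw hM.
by case: ws {hM} => [|_ _]; rewrite ?cmod0 ?ler_peMr ?mulr_ge0 ?cmod_ge0 //; lra.
Qed.

(** The coordinate function [x_j] as a tensor: the jet of the identity in variable [j] and the jet
    of 1 in the others. *)
Let cj j (i : 'I_N) (n : nat) (s : R) : R :=
  if i == j then (if n is n'.+1 then (n' == 0%N)%:R else s) else (n == 0%N)%:R.

Let jet_cj j i : jet (cj j i).
Proof.
move=> n x; rewrite /cj; case: (i == j); last by exact: is_derive_cst.
by case: n => [|n]; [exact: is_derive_id|exact: is_derive_cst].
Qed.

Lemma OM_coord j : OMspace (tensor (cj j) (fun=> 0%N)).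
Proof.
split; first by apply: smooth_tensor; exact: jet_cj.
move=> l l0; have [C C1 hC] := dbound_tensor (N := N) hw 1 l0.
have [b [b0 [D D1 hD]]] := weight_log hw.
exists b; first exact: ltW.
exists (C * D) => [|x]; first by rewrite mulr_ge0 //; lra.
pose bb (i : 'I_N) := if i == j then 1 + `|x 0 j| else 1.
have h (i : 'I_N) n : `|cj j i n (x 0 i)| <= 1%:R ^+ n * n`!%:R * bb i.
  have f1 : 1 <= n`!%:R :> R by rewrite ler1n fact_gt0.
  rewrite expr1n mul1r /cj /bb; case: eqP => [->|_].
    have x0 := normr_ge0 (x 0 j).
    case: n f1 => [|n] f1; first by rewrite fact0; lra.
    apply: (@le_trans _ _ 1); first by case: eqP; rewrite ?normr1 ?normr0.
    by rewrite mulr_ege1 //; lra.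
  by rewrite mulr1; apply: le_trans f1; case: eqP; rewrite ?normr1 ?normr0.
apply: dbound_le (hC _ x bb (jet_cj j) h) => //.
rewrite -mulrA ler_wpM2l //; first lra.
rewrite (bigD1 j) //= big1 => [|i /negPf]; last by rewrite /bb => ->.
rewrite mulr1 /bb eqxx; apply: le_trans (hD _ (enorm_ge0 x)).
by rewrite lerD2l; exact: coord_le_enorm.
Qed.

(** A constant and a coordinate both lie in [OMspace], so the claim is an instance of [OM_Q]. *)
Lemma Q_mulX j g : Qspace g -> Qspace (mulX j g).
Proof.
move=> hg; have -> : mulX j g = mulop (fun=> 0 -i* 1) (mulop (tensor (cj j) (fun=> 0%N)) g).
  apply/funext => x; rewrite /mulX /mulop mulrA; congr (_ * _).
  rewrite /tensor (bigD1 j) //= big1 => [|i /negPf ij]; last by rewrite /cj ij.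
  rewrite /cj eqxx mulr1; apply/eqP; rewrite eq_complex /=; apply/andP.
  by split; apply/eqP; ring.
by apply: OM_Q; [exact: OM_cst|apply: OM_Q => //; exact: OM_coord].
Qed.

Lemma Q_mulXs ws g : Qspace g -> Qspace (mulXs ws g).
Proof. by move=> hg; elim: ws => //= j ws; exact: Q_mulX. Qed.

(** Derivatives of the Fourier transform are transforms of [mulXs ws g], which is again in [Qspace],
    so [fourier_decay] applies to each of them. *)
Theorem Q_S_omega g : Qspace g -> S_omega w g.
Proof.
move=> hg; have cg := smooth_ccontinuous hg.1.
have rg : rapid g := Q_allrapid hg (isT : sorted_word [::]).
have [C C0 dC] := rapid_dominated rg.
split.
- exact: (dominated_cintegrable cg dC).
- exact: hg.1.
- exact: smooth_fourier.
move=> m alpha m0; have [ws [sws _ E]] := @dmulti_dw R N alpha; rewrite !E.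
split; apply/weighted_sup_normP; first exact: (Q_decaying hg sws m0).
have [-> _ _] := dw_fourier ws cg rg.
have hX := Q_mulXs ws hg.
have [l l0 [c c0 hc]] := @fourier_decay R N w hw hN m (ltW m0).
have [b [b0 [D D1 hD]]] := @om_kerv R N w hw 1.
have [B B0 hB] := hX.2 l b l0 b0.
have BD : 0 <= B * D by rewrite mulr_ge0 //; lra.
exists (c * (B * D)); first by rewrite mulr_ge0.
apply: hc => //; [exact: hX.1|exact: Q_allrapid|move=> x].
by apply: dbound_le (hB x) => //; rewrite -mulrA ler_wpM2l // -(expr1 (kerv x)).
Qed.

Variable sech : nat -> R -> R.
Hypothesis jsech : jet sech.
Hypothesis sechE : forall s, sech 0%N s = (cosh_jet 0 s)^-1.
Hypothesis sech_le : forall n s, `|sech n s| <= 2 ^+ n * n`!%:R * sech 0%N s.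

Let win p : V -> R[i] := tensor (fun j n s => sech n (s - p 0 j)) (fun=> 0%N).
Let win0 p x : R := \prod_j sech 0%N (x 0 j - p 0 j).

Let jet_win p j : jet (fun n s => sech n (s - p 0 j)).
Proof. exact: jet_shift. Qed.

Let smooth_win p : smooth (win p).
Proof. by apply: smooth_tensor; exact: jet_win. Qed.

Let sech0_ge0 s : 0 <= sech 0%N s.
Proof. by rewrite sechE; exact: sech_ge0. Qed.

Let win0_ge0 p x : 0 <= win0 p x.
Proof. exact: prodr_ge0. Qed.

Let cmod_win p x : cmod (win p x) = win0 p x.
Proof. by rewrite /win /tensor cmodC ger0_norm //; exact: win0_ge0. Qed.

Let win_decay m : 0 <= m -> exists2 C, 1 <= C &
  forall p x, win0 p x <= C * expR (- (m * om (x - p))).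
Proof.
move=> m0.
have hd (a : R) : 0 <= a -> exists2 C : R, 1 <= C &
    forall (j : 'I_N) s, sech 0%N s <= C * expR (- (a * w `|s|)).
  by move=> a0; have [C C1 hC] := sech_decay hw a0; exists C => // _ s; rewrite sechE.
have [C C1 hC] := @prod_decay R w hw N hN (fun _ s => sech 0%N s) (fun _ => sech0_ge0) hd m m0.
exists C => // p x; apply: le_trans (hC (x - p)).
by apply: ler_prod => j _; rewrite sech0_ge0 !mxE /=.
Qed.

(** The derivatives of [g] are bounded by inversion and the window decays in [x - p]. Turning this
    into decay in [x] costs a factor exponential in [om p], which [window_decay] compensates. *)
Let window_dbound g l k : S_omega w g -> 0 < l -> exists B b,
  [/\ 0 <= B, 0 <= b & forall p x,
    dbound l (B * expR (b * om p) * kerv x ^+ k) (mulop g (win p)) x].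
Proof.
move=> hg l0; have sg : smooth g by case: hg.
have [L L1 [D D1 hD]] := dbound_mul (N := N) hw (ltW l0).
have lL : 0 < l * L by rewrite mulr_gt0 //; lra.
have [C1 C11 hC1] := dbound_tensor (N := N) hw 2 lL.
have [b0 b00 [c c0 hinv]] := @fourier_inversion_bound R N w hw.
have [A A0 hA] := (S_omega_decaying hg (isT : sorted_word [::])).2 (l * L + b0) (addr_gt0 lL b00).
have rg : allrapid g.
  by move=> ws sws; apply: decaying_rapid; exact: (S_omega_decaying hg sws).1.
have gA := hinv _ g A (ltW lL) sg rg A0 hA.
have [b [b1 [Ck Ck1 hCk]]] := @om_kerv R N w hw k.
have [K K1 hK] := @om_triangle R N w hw hN.
have bK : 0 <= b * K by rewrite mulr_ge0 //; lra.
have [Cs Cs1 hCs] := win_decay bK.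
exists (D * (c * A * (C1 * (Cs * expR (b * K) * Ck)))), (b * K); split => //.
  by rewrite !mulr_ge0 ?expR_ge0 //; lra.
move=> p x.
have h1 : dbound (l * L) (C1 * win0 p x) (win p) x.
  by apply: hC1 => [j|j n]; [exact: jet_win|exact: sech_le].
have cA : 0 <= c * A by rewrite mulr_ge0.
have C1w : 0 <= C1 * win0 p x by rewrite mulr_ge0 //; lra.
apply: dbound_le (hD _ _ _ _ _ sg (smooth_win p) cA C1w (gA x) h1) => //.
rewrite -[leRHS]mulrA -[leRHS]mulrA ler_wpM2l //; first lra.
rewrite -[leRHS]mulrA ler_wpM2l // -[leRHS]mulrA ler_wpM2l //; first lra.
apply: (le_trans (hCs p x)).
rewrite -[leRHS]mulrA -[leRHS]mulrA ler_wpM2l //; first lra.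
apply: (@le_trans _ _ (expR (b * K) * (expR (b * K * om p) * expR (- (b * om x))))).
  rewrite -!expRD ler_expR.
  have : b * om x <= b * (K * (1 + om p + om (x - p))).
    rewrite ler_wpM2l ?(ltW b1) //; apply: hK => j.
    have -> : x 0 j = p 0 j + (x - p) 0 j by rewrite !mxE; ring.
    exact: ler_normD.
  lra.
rewrite ler_wpM2l ?expR_ge0 // [leRHS]mulrCA ler_wpM2l ?expR_ge0 //; exact: hCk.
Qed.

(* [g] is localised near [p] by the window [win p]; the Fourier transform of
   [g * win p] is small both in [p] (decay of [g]) and in the frequency (decay
   of the Fourier transform of [g]), and a geometric mean combines the two. *)
Let window_decay g l m : S_omega w g -> 0 < l -> 0 < m -> exists2 B, 0 <= B &
  forall p x, dbound l (B * expR (- (m * om p))) (mulop g (win p)) x.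
Proof.
move=> hg l0 m0; have sg : smooth g by case: hg.
have sgw p : smooth (mulop g (win p)) by exact: smoothM.
have rgw p : allrapid (mulop g (win p)).
  apply: (allrapidP hw) => l' k l'0; have [B [b [B0 b0 hB]]] := window_dbound k hg l'0.
  by exists (B * expR (b * om p)) => x; exact: hB.
have [b0 b00 [c c0 hinv]] := @fourier_inversion_bound R N w hw.
(* Twice the required rate, since the geometric mean halves exponents. *)
have lb : 0 <= 2 * (l + b0) by lra.
have [l2 l20 [c2 c20 hdec]] := @fourier_decay R N w hw hN _ lb.
have [B1 [b1 [B10 b10 hB1]]] := window_dbound 1 hg l20.
have F1 p xi : cmod (fourier (mulop g (win p)) xi) <=
    c2 * B1 * (expR (b1 * om p) * expR (- (2 * (l + b0) * om xi))).
  have Be : 0 <= B1 * expR (b1 * om p) by rewrite mulr_ge0 ?expR_ge0.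
  apply: le_trans (hdec _ _ (sgw p) (rgw p) Be _ xi) _.
    by move=> x; rewrite -(expr1 (kerv x)); exact: hB1.
  by rewrite !mulrA.
have [b3 [b30 [D D1 hD]]] := @om_kerv R N w hw 1.
have [K K1 hK] := @om_triangle R N w hw hN.
(* Under the geometric mean, [b1] cancels the growth in [p] of the first bound and [2 * m] leaves
   the decay rate [m]. *)
pose mu := 2 * m + b1; have mu0 : 0 < mu by rewrite /mu; lra.
have Kmu : 0 < K * mu by rewrite mulr_gt0 //; lra.
(* [K * mu] pays for the triangle inequality between [p], [x] and [x - p]; [b3] is left for
   integrability in [x]. *)
have Kb : 0 < K * mu + b3 by lra.
have [A A0 hA] := (S_omega_decaying hg (isT : sorted_word [::])).1 _ Kb.
have [Cs Cs1 hCs] := win_decay (ltW Kmu).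
pose B2 := A * Cs * expR (K * mu) * D.
have B20 : 0 <= B2 by rewrite !mulr_ge0 ?expR_ge0 //; lra.
have dgw p : dominated (mulop g (win p)) (B2 * expR (- (mu * om p))).
  move=> x; rewrite cmodM cmod_win.
  apply: (@le_trans _ _ ((A * expR (- ((K * mu + b3) * om x))) * (Cs * expR (- (K * mu * om (x - p)))))).
    by apply: ler_pM; rewrite ?cmod_ge0 //; exact: hA.
  rewrite [leRHS](_ : _ = A * Cs * (expR (K * mu) * expR (- (mu * om p)) * (D * kerv x ^+ 1))); last first.
    by rewrite /B2 expr1; ring.
  rewrite mulrACA ler_wpM2l ?mulr_ge0 //; first lra.
  apply: (@le_trans _ _ (expR (K * mu) * expR (- (mu * om p)) * expR (- (b3 * om x)))).
    rewrite -!expRD ler_expR.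
    have : mu * om p <= mu * (K * (1 + om x + om (x - p))).
      rewrite ler_wpM2l ?(ltW mu0) //; apply: hK => j.
      have -> : p 0 j = x 0 j + - (x - p) 0 j by rewrite !mxE; ring.
      by apply: le_trans (ler_normD _ _) _; rewrite normrN.
    lra.
  by rewrite ler_wpM2l ?mulr_ge0 ?expR_ge0.
have piN : 0 <= pi ^+ N :> R by rewrite exprn_ge0 // ltW // pi_gt0.
have F2 p xi : cmod (fourier (mulop g (win p)) xi) <= 2 * pi ^+ N * B2 * expR (- (mu * om p)).
  apply: le_trans (fourier_le xi (smooth_ccontinuous (sgw p)) (dgw p)) _.
  by rewrite le_eqVlt; apply/orP; left; apply/eqP; ring.
pose P := c2 * B1; pose S := 2 * pi ^+ N * B2.
have P0 : 0 <= P by rewrite mulr_ge0.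
have S0 : 0 <= S by apply: mulr_ge0 => //; apply: mulr_ge0.
exists (c * (P + S)) => [|p]; first by rewrite mulr_ge0 // addr_ge0.
have Be : 0 <= (P + S) * expR (- (m * om p)) by rewrite mulr_ge0 ?expR_ge0 ?addr_ge0.
rewrite -mulrA; apply: hinv => //; first exact: ltW.
move=> xi; set z := cmod _.
have z0 : 0 <= z by exact: cmod_ge0.
have y0 : 0 <= (P + S) * expR (- (m * om p)) * expR (- ((l + b0) * om xi)) by rewrite mulr_ge0 ?expR_ge0.
(* The geometric mean without roots: bound the square of the transform by the product of [F1] and
   [F2]; finally [P * S <= (P + S) ^ 2]. *)
rewrite -(ler_pXn2r (n := 2)) ?nnegrE //.
apply: (@le_trans _ _ ((P * (expR (b1 * om p) * expR (- (2 * (l + b0) * om xi)))) * (S * expR (- (mu * om p))))).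
  by rewrite expr2; apply: ler_pM => //; [exact: F1|exact: F2].
have Ee : expR (b1 * om p) * expR (- (2 * (l + b0) * om xi)) * expR (- (mu * om p)) =
    (expR (- (m * om p)) * expR (- ((l + b0) * om xi))) ^+ 2.
  by rewrite expr2 -!expRD /mu; congr expR; ring.
rewrite [leLHS]mulrACA Ee -[in leRHS]mulrA [leRHS]exprMn ler_wpM2r ?sqr_ge0 //.
have PS := mulr_ge0 P0 S0; have := sqr_ge0 P; have := sqr_ge0 S.
by rewrite sqrrD mulr2n => h1 h2; lra.
Qed.

Theorem S_omega_Q g : S_omega w g -> Qspace g.
Proof.
move=> hg; have sg : smooth g by case: hg.
split => // l m l0 m0.
have [L L1 [D D1 hD]] := dbound_mul (N := N) hw (ltW l0).
have lL : 0 < l * L by rewrite mulr_gt0 //; lra.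
have [B B0 hB] := window_decay hg lL m0.
have [C C1 hC] := dbound_tensor (N := N) hw 1 lL.
exists (D * (B * C)) => [|p]; first by rewrite !mulr_ge0 //; lra.
(* The inverse of the window, bounded only at [p] itself: all derivatives of cosh at 0 are at most
   1. *)
pose chi : V -> R[i] := tensor (fun j n s => cosh_jet n (s - p 0 j)) (fun=> 0%N).
have jchi j : jet (fun n s => cosh_jet n (s - p 0 j)) by apply: jet_shift; exact: jet_cosh.
have schi : smooth chi by exact: smooth_tensor.
have hchi : dbound (l * L) C chi p.
  have -> : C = C * \prod_(j < N) 1 by rewrite big1 // mulr1.
  apply: hC => // j n; rewrite subrr mulr1 expr1n mul1r.
  apply: (le_trans (cosh_jet_le _ _)); rewrite cosh0 ler1n; exact: fact_gt0.
have E : g = mulop (mulop g (win p)) chi.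
  apply/funext => x; rewrite /mulop -mulrA /win /chi /tensor -rmorphM /= -big_split /=.
  rewrite big1 ?mulr1 // => j _; rewrite sechE mulVf //.
  by rewrite gt_eqF //; exact: lt_le_trans ltr01 (cosh_ge1 _).
have sgw : smooth (mulop g (win p)) by exact: smoothM.
rewrite E; have e0 : 0 <= B * expR (- (m * om p)) by rewrite mulr_ge0 ?expR_ge0.
have C0 : 0 <= C by lra.
apply: dbound_le (hD _ _ _ _ _ sgw schi e0 C0 (hB p p) hchi) => //.
by rewrite le_eqVlt; apply/orP; left; apply/eqP; ring.
Qed.

End test_space.

(** * Necessity of the growth condition *)

Section necessity.
Context {R : realType} {N : nat}.
Local Notation V := 'rV[R]_N.
Variable w : R -> R.
Hypothesis hw : nonquasianalytic_weight w.
Hypothesis hN : (0 < N)%N.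
Local Notation om x := (w (enorm x)).
Local Notation ub := (@ub R w).
Local Notation dbound := (@dbound R N w).
Implicit Types (f g : V -> R[i]) (x : V) (l m : R) (j : 'I_N) (k n : nat).

Variable sech : nat -> R -> R.
Hypothesis jsech : jet sech.
Hypothesis sechE : forall s, sech 0%N s = (cosh_jet 0 s)^-1.
Hypothesis sech_le : forall n s, `|sech n s| <= 2 ^+ n * n`!%:R * sech 0%N s.

Let sech0_ge0 s : 0 <= sech 0%N s.
Proof. by rewrite sechE; exact: sech_ge0. Qed.

Let sech0_abs s : `|sech 0%N s| <= 1.
Proof. by rewrite ger0_norm // sechE sech_le1. Qed.

Let sech_bound n s : `|sech n s| <= 2 ^+ n * n`!%:R.
Proof.
apply: (le_trans (sech_le n s)); rewrite ler_piMr ?mulr_ge0 ?exprn_ge0 //.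
by rewrite sechE sech_le1.
Qed.

Variable X : nat -> V.
Let half k : R := 2^-1 ^+ k.
(** The rate [k] compromises between two demands: it eventually beats every fixed multiple of
    [om (X k)], so the sum decays, yet at [X k] the sum is at least the explicit number [c k]. *)
Let c k : R := half k * expR (- (k%:R * om (X k))).
Let gam j n (s : R) : R := wsum c (fun k => sech n (s - X k 0 j)).

Let half_ge0 k : 0 <= half k. Proof. by rewrite exprn_ge0 // invr_ge0. Qed.

Let cvg_half : cvgn (series half).
Proof.
have -> : half = geometric 1 (2^-1 : R).
  by apply/funext => k; rewrite /geometric /= mul1r.
by apply: is_cvg_geometric_series; rewrite ger0_norm ?invr_ge0 // invf_lt1 // ltr1n.
Qed.

Let c_gt0 k : 0 < c k.
Proof. by rewrite mulr_gt0 ?expR_gt0 // exprn_gt0 // invr_gt0. Qed.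

Let c_ge0 k : 0 <= c k. Proof. exact: ltW. Qed.

Let cvg_c : cvgn (series c).
Proof.
apply: (series_le_cvg c_ge0 half_ge0) => // k.
rewrite /c ler_piMr // -[leRHS]expR0 ler_expR oppr_le0 mulr_ge0 //.
exact: om_ge0.
Qed.

Let jet_gam j : jet (gam j).
Proof.
apply: (jet_wsum c_ge0 cvg_c) => // n; exists (2 ^+ n * n`!%:R) => s; exact: sech_bound.
Qed.

Let gam_le j n s : `|gam j n s| <= 2 ^+ n * n`!%:R * gam j 0%N s.
Proof.
set A := 2 ^+ n * n`!%:R; have A0 : 0 <= A by rewrite mulr_ge0 ?exprn_ge0.
pose b k := sech 0%N (s - X k 0 j); pose d k := sech n (s - X k 0 j).
have hb k : `|b k| <= 1 by exact: sech0_abs.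
have hd k : `|d k| <= A by exact: sech_bound.
have hE (a : R) : wsum c (fun k => a * b k + 0 * b k) = a * wsum c b.
  by rewrite (wsum_lin c_ge0 cvg_c a 0 hb hb) mul0r addr0.
have hab (a : R) k : `|a * b k + 0 * b k| <= `|a|.
  by rewrite mul0r addr0 normrM ler_piMr.
have hdb k : - (A * b k) <= d k <= A * b k by rewrite -ler_norml; exact: sech_le.
rewrite ler_norml -[X in X <= _ <= _]mulNr -!hE; apply/andP; split.
  apply: (wsum_le c_ge0 cvg_c (hab _) hd) => k.
  by rewrite mul0r addr0 mulNr; case/andP: (hdb k).
apply: (wsum_le c_ge0 cvg_c hd (hab _)) => k.
by rewrite mul0r addr0; case/andP: (hdb k).
Qed.

Let gam_term j k s : c k * sech 0%N (s - X k 0 j) <= gam j 0%N s.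
Proof.
apply: (wsum_term c_ge0 cvg_c (b := fun k => sech 0%N (s - X k 0 j)) (B := 1)) => i.
  exact: sech0_abs.
exact: sech0_ge0.
Qed.

Let gam_gt0 j s : 0 < gam j 0%N s.
Proof.
apply: lt_le_trans (gam_term j 0 s); rewrite mulr_gt0 // sechE invr_gt0.
exact: lt_le_trans ltr01 (cosh_ge1 _).
Qed.

Let gam_X j k : c k <= gam j 0%N (X k 0 j).
Proof. by apply: le_trans (gam_term j k _); rewrite subrr sechE cosh0 invr1 mulr1. Qed.

(** For [k >= |a|] the product is at most 1; the finitely many smaller indices are covered by the
    finite sum [D]. *)
Let weights_bound (a : R) : exists2 D, 1 <= D & forall k,
  expR (- (k%:R * om (X k))) * expR (a * om (X k)) <= D.
Proof.
pose n0 := Num.bound `|a|; have hn0 : `|a| < n0%:R by exact: archi_boundP.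
pose D := \sum_(i < n0) expR (a * om (X i)).
have D0 : 0 <= D by apply: sumr_ge0 => i _; exact: expR_ge0.
exists (1 + D) => [|k]; first lra.
have ok := om_ge0 hw (X k).
case: (ltnP k n0) => kn.
  apply: (@le_trans _ _ (expR (a * om (X k)))).
    rewrite ler_piMl ?expR_ge0 // -[leRHS]expR0 ler_expR oppr_le0 mulr_ge0 //.
  rewrite /D (bigD1 (Ordinal kn)) //=.
  have : 0 <= \sum_(i < n0 | i != Ordinal kn) expR (a * om (X i)).
    by apply: sumr_ge0 => i _; exact: expR_ge0.
  lra.
rewrite -expRD; apply: (@le_trans _ _ 1); last lra.
rewrite -[leRHS]expR0 ler_expR.
have : a * om (X k) <= k%:R * om (X k).
  rewrite ler_wpM2r //; apply: le_trans (ler_norm a) _.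
  by apply: (le_trans (ltW hn0)); rewrite ler_nat.
lra.
Qed.

(** Moving the decay of the window from [s - X k] to [s] costs an exponential of a multiple of
    [om (X k)], which [weights_bound] absorbs uniformly in [k]. *)
Let gam_decay m : 0 <= m -> exists2 C, 1 <= C &
  forall j s, gam j 0%N s <= C * expR (- (m * w `|s|)).
Proof.
move=> m0; have [K K1 hK] := weight_add hw.
have mK : 0 <= m * K by rewrite mulr_ge0 //; lra.
have [C C1 hC] := sech_decay hw mK.
have [D D1 hD] := weights_bound (m * K).
pose S := limn (series half).
exists (C * D * expR (m * K) * (1 + `|S|)) => [|j s].
  rewrite !mulr_ege1 //; last by have := normr_ge0 S; lra.
  by rewrite -[leLHS]expR0 ler_expR.
(* The exponential part of [c k] joins the terms, where it has to compensate that cost; [half] alone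
   secures convergence. *)
pose b k := expR (- (k%:R * om (X k))) * sech 0%N (s - X k 0 j).
have -> : gam j 0%N s = wsum half b.
  rewrite /gam /wsum; congr (limn (series _)); apply/funext => k.
  by rewrite /c /b mulrA.
set E := expR (- (m * w `|s|)).
have hb k : `|b k| <= C * D * expR (m * K) * E.
  rewrite ger0_norm; last by rewrite mulr_ge0 ?expR_ge0.
  rewrite /b sechE.
  apply: (@le_trans _ _ (expR (- (k%:R * om (X k))) * (C * expR (- (m * K * w `|s - X k 0 j|))))).
    by rewrite ler_wpM2l ?expR_ge0.
  have h1 : expR (- (m * K * w `|s - X k 0 j|)) <=
      expR (m * K) * expR (m * K * om (X k)) * E.
    rewrite /E -!expRD ler_expR.
    have : w `|s| <= w (`|X k 0 j| + `|s - X k 0 j|).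
      apply: (weight_le hw) => //; have {1}-> : s = X k 0 j + (s - X k 0 j) by ring.
      exact: ler_normD.
    move=> /le_trans /(_ (hK _ _ (normr_ge0 _) (normr_ge0 _))) h2.
    have h3 := om_ge_coord hw (X k) j.
    have : m * w `|s| <= m * (K * (1 + om (X k) + w `|s - X k 0 j|)).
      rewrite ler_wpM2l //; apply: (le_trans h2); rewrite ler_wpM2l //; lra.
    lra.
  apply: (@le_trans _ _ (expR (- (k%:R * om (X k))) * (C * (expR (m * K) * expR (m * K * om (X k)) * E)))).
    by rewrite ler_wpM2l ?expR_ge0 // ler_wpM2l //; lra.
  rewrite [leLHS](_ : _ = expR (- (k%:R * om (X k))) * expR (m * K * om (X k)) * (C * expR (m * K) * E)); last by ring.
  rewrite [leRHS](_ : _ = D * (C * expR (m * K) * E)); last by ring.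
  by rewrite ler_wpM2r // !mulr_ge0 ?expR_ge0 //; lra.
have B0 : 0 <= C * D * expR (m * K) * E.
  by rewrite !mulr_ge0 ?expR_ge0 //; lra.
apply: (le_trans (ler_norm _)); apply: (le_trans (wsum_abs half_ge0 cvg_half hb)).
rewrite -/S [leRHS](_ : _ = C * D * expR (m * K) * E * (1 + `|S|)); last by ring.
by rewrite ler_wpM2l //; have := ler_norm S; lra.
Qed.

Let g0 : V -> R[i] := tensor gam (fun=> 0%N).

Let Q_g0 : Qspace w g0.
Proof.
split; first exact: smooth_tensor.
move=> l m l0 m0; have [C C1 hC] := dbound_tensor (N := N) hw 2 l0.
have [|D D1 hD] := @prod_decay R w hw N hN (fun j => gam j 0%N) _ gam_decay m (ltW m0).
  by move=> j s; exact: ltW.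
exists (C * D) => [|x]; first by rewrite mulr_ge0 //; lra.
apply: dbound_le (hC gam x (fun j => gam j 0%N (x 0 j)) jet_gam _) => //.
by rewrite -mulrA ler_wpM2l //; lra.
Qed.

(* The multiplier property applied to [g0] bounds the derivatives of
   [f = (f * g0) * (1 / g0)] along the sequence [X]. *)
Lemma multiplier_along_sequence f l : smooth f -> 0 < l ->
  (forall g, Qspace w g -> Qspace w (mulop f g)) ->
  exists2 D, 0 <= D & forall k,
    dbound l (D * (2 ^+ (k * N) * expR ((k * N)%:R * om (X k)))) f (X k).
Proof.
move=> sf l0 hf.
have /choice[r hr] (j : 'I_N) : exists r : nat -> R -> R,
    [/\ jet r, forall s, r 0%N s = (gam j 0%N s)^-1 &
    forall n s, `|r n s| <= 4%:R ^+ n * n`!%:R * r 0%N s].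
  have [r [jr r0 hr]] := jet_inv (jet_gam j) (gam_gt0 j); exists r; split => // n s.
  (* The constant 2 of [gam_le], doubled by [jet_inv]. *)
  have -> : 4%:R = 2 * 2 :> R by rewrite -natrM.
  exact: (hr 2 _ (gam_le j)).
have jr j : jet (r j) by case: (hr j).
have [L L1 [D D1 hD]] := dbound_mul (N := N) hw (ltW l0).
have lL : 0 < l * L by rewrite mulr_gt0 //; lra.
have [C C1 hC] := dbound_tensor (N := N) hw 4 lL.
have [sfg hfg] := hf _ Q_g0; have [B B0 hB] := hfg _ _ lL ltr01.
exists (D * (B * C)) => [|k]; first by rewrite !mulr_ge0 //; lra.
set x := X k; pose P := \prod_j r j 0%N (x 0 j).
have r_ge0 j s : 0 <= r j 0%N s.
  by have [_ -> _] := hr j; rewrite invr_ge0 ltW.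
have P0 : 0 <= P by exact: prodr_ge0.
have h1 : dbound (l * L) (C * P) (tensor r (fun=> 0%N)) x.
  by apply: hC => // j n; have [_ _] := hr j; apply.
have h2 : dbound (l * L) B (mulop f g0) x.
  apply: dbound_le (hB x) => //; rewrite ler_piMr // -[leRHS]expR0 ler_expR oppr_le0 mul1r.
  exact: om_ge0.
have E : f = mulop (mulop f g0) (tensor r (fun=> 0%N)).
  apply/funext => y; rewrite /mulop -mulrA /g0 /tensor -rmorphM /= -big_split /=.
  rewrite big1 ?mulr1 // => j _; have [_ -> _] := hr j.
  by rewrite mulfV // gt_eqF.
have CP : 0 <= C * P by rewrite mulr_ge0 //; lra.
rewrite [X in dbound _ _ X _]E.
apply: dbound_le (hD _ _ _ _ _ sfg (smooth_tensor _ jr) B0 CP h2 h1) => //.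
rewrite -!mulrA ler_wpM2l //; first lra.
rewrite ler_wpM2l // ler_wpM2l //; first lra.
(* At [X k] each reciprocal [1 / gam j] is at most [1 / c k], by [gam_X]. *)
have -> : 2 ^+ (k * N) * expR ((k * N)%:R * om x) = \prod_(j < N) (c k)^-1.
  rewrite prodr_const card_ord /c invfM exprMn /half -exprVn invrK -exprM; congr (_ * _).
  by rewrite -expRN opprK -expRM_natl natrM mulrA (mulrC N%:R).
apply: ler_prod => j _; rewrite r_ge0 /=; have [_ -> _] := hr j.
by rewrite lef_pV2 ?posrE.
Qed.

End necessity.

(** * The equivalence in terms of derivative bounds *)

Section multipliers.
Context {R : realType} {N : nat}.
Local Notation V := 'rV[R]_N.
Variable w : R -> R.
Hypothesis hw : nonquasianalytic_weight w.
Hypothesis hN : (0 < N)%N.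
Local Notation om x := (w (enorm x)).
Implicit Types (f g : V -> R[i]).

Lemma S_omegaE g : S_omega w g <-> Qspace w g.
Proof.
have [sech [jsech sechE sech_le]] := @sech_jet R.
split; last exact: Q_S_omega.
exact: (S_omega_Q hw hN jsech sechE sech_le).
Qed.

Lemma multiplier_OM f : smooth f -> (forall g, Qspace w g -> Qspace w (mulop f g)) ->
  OMspace w f.
Proof.
move=> sf hf; have [sech [jsech sechE sech_le]] := @sech_jet R.
split => // l l0; apply: contrapT => nof.
(* The constants in the failing estimate exceed by the factor [k] those that
   [multiplier_along_sequence] allows at the chosen points, up to its constant [D]; any [k > D]
   gives the contradiction. *)
have H k : exists t : V * seq 'I_N * R, [/\ sorted_word t.1.2, @ub R w l (size t.1.2) t.2 &
    k%:R * (2 ^+ (k * N) * expR ((k * N)%:R * om t.1.1)) * t.2 < cmod (dw t.1.2 f t.1.1)].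
  apply: contrapT => no; apply: nof; exists (k * N)%:R => //.
  exists (k%:R * 2 ^+ (k * N)) => [|x ws M sws hM]; first by rewrite mulr_ge0 ?exprn_ge0.
  rewrite leNgt; apply/negP => h; apply: no; exists (x, ws, M); split => //.
  by rewrite mulrA.
have [t ht] := choice H.
have [D D0 hD] := multiplier_along_sequence hw hN jsech sechE sech_le (fun k => (t k).1.1) sf l0 hf.
pose k := Num.bound D; have hk : D < k%:R by exact: archi_boundP.
have [sws hM] := ht k; have M1 := ub_ge1 hw hM.
have := hD k _ _ sws hM; rewrite leNgt => /negP h1 h2; apply: h1; apply: le_lt_trans h2.
by rewrite ler_wpM2r ?ler_wpM2r ?mulr_ge0 ?exprn_ge0 ?expR_ge0 ?(ltW hk) //; lra.
Qed.

End multipliers.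

(** * Seminorms and topology *)

Section seminorms.
Context {R : realType} {N : nat}.
Local Notation V := 'rV[R]_N.
Variable w : R -> R.
Hypothesis hw : nonquasianalytic_weight w.
Local Notation om x := (w (enorm x)).
Local Notation ub := (@ub R w).
Local Notation dbound := (@dbound R N w).
Implicit Types (f g h : V -> R[i]) (x : V) (l m c p M : R) (k : nat).

Lemma young_conj_ge0 s : (0 <= young_conj w s)%E.
Proof.
apply: ereal_sup_ubound; exists 0 => /=; first by rewrite in_itv /= lexx.
by rewrite mulr0 expR0 (weight1 hw) subrr.
Qed.

(** The substitution [r = expR t] identifies the supremum in [young_conj] with the one behind
    [ub]. *)
Lemma young_conj_ub l k p : 0 < l -> young_conj w (k%:R / l) = p%:E -> ub l k (expR (l * p)).
Proof.
move=> l0 E r r1; have r0 : 0 < r by lra.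
have : ((k%:R / l * ln r - w (expR (ln r)))%:E <= p%:E)%E.
  rewrite -E; apply: ereal_sup_ubound; exists (ln r) => //=.
  by rewrite in_itv /= andbT ln_ge0.
rewrite lnK ?posrE // lee_fin => h.
have -> : r ^+ k = expR (k%:R * ln r) by rewrite expRM_natl lnK ?posrE.
rewrite -expRD ler_expR.
have : l * (k%:R / l * ln r - w r) <= l * p by rewrite ler_wpM2l // ltW.
have -> : l * (k%:R / l * ln r - w r) = k%:R * ln r - l * w r.
  by field; rewrite gt_eqF.
by [].
Qed.

Lemma ub_young_conj l k M : 0 < l -> ub l k M ->
  exists2 p, young_conj w (k%:R / l) = p%:E & expR (l * p) <= M.
Proof.
move=> l0 hM; have M1 := ub_ge1 hw hM; have M0 : 0 < M by lra.
have le : (young_conj w (k%:R / l) <= (ln M / l)%:E)%E.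
  apply: ge_ereal_sup => y [t /=]; rewrite in_itv /= andbT => t0 <-.
  rewrite lee_fin ler_pdivlMr // -ler_expR lnK ?posrE //.
  have := hM (expR t); rewrite -[X in X <= expR t]expR0 ler_expR => /(_ t0).
  rewrite -expRM_natl -expRD; congr (expR _ <= _).
  by field; rewrite gt_eqF.
have ge := young_conj_ge0 (k%:R / l).
have fin : young_conj w (k%:R / l) \is a fin_num.
  by rewrite ge0_fin_numE //; apply: le_lt_trans le _; exact: ltry.
exists (fine (young_conj w (k%:R / l))); first by rewrite fineK.
rewrite -[leRHS](lnK (x := M)) ?posrE // ler_expR mulrC -ler_pdivlMr //.
by rewrite -lee_fin fineK.
Qed.

Lemma q_norm_ge0 l m f : (0 <= q_norm w l m f)%E.
Proof.
apply: (@le_trans _ _ (expeR (- (l%:E * young_conj w ((mlen [ffun=> 0%N : nat])%:R / l)%R)) *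
     (expR (m * w (enorm (0 : V))) * cmod (dmulti [ffun=> 0%N : nat] f 0))%:E)%E).
  by rewrite mule_ge0 ?expeR_ge0 // lee_fin mulr_ge0 ?expR_ge0 ?cmod_ge0.
by apply: ereal_sup_ubound; exists ([ffun=> 0%N : nat], 0).
Qed.

(** The bridge from extended-real seminorms to [dbound]: any real [M] with [ub] forces the conjugate
    to be finite. *)
Lemma q_norm_dbound l m c f : 0 < l -> 0 <= c ->
  (q_norm w l m f <= c%:E)%E <-> forall x, dbound l (c * expR (- (m * om x))) f x.
Proof.
move=> l0 c0; split=> [h x ws M sws hM|h].
  have [alpha Ea E] := @dw_dmulti R N ws sws; have [p Ep pM] := ub_young_conj l0 hM.
  have : (expeR (- (l%:E * young_conj w ((mlen alpha)%:R / l)%R)) *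
     (expR (m * om x) * cmod (dmulti alpha f x))%:E <= c%:E)%E.
    by apply: le_trans h; apply: ereal_sup_ubound; exists (alpha, x).
  rewrite Ea Ep -[(- (l%:E * p%:E))%E]/((- (l * p))%:E) /= lee_fin -E.
  rewrite expRN mulrC ler_pdivrMr ?expR_gt0 // => hc.
  rewrite expRN mulrAC ler_pdivlMr ?expR_gt0 // mulrC.
  by apply: (le_trans hc); rewrite ler_wpM2l.
apply: ge_ereal_sup => _ [[alpha x] _ <-] /=.
have [ws [sws Ews E]] := @dmulti_dw R N alpha.
rewrite -Ews E.
have := @young_conj_ge0 ((size ws)%:R / l); case Ey : (young_conj _ _) => [p||] // _.
  rewrite -[(- (l%:E * p%:E))%E]/((- (l * p))%:E) /= lee_fin.
  have := h x ws _ sws (young_conj_ub l0 Ey).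
  rewrite (expRN (m * om x)) mulrAC ler_pdivlMr ?expR_gt0 // mulrC => hc.
  by rewrite expRN mulrC ler_pdivrMr ?expR_gt0.
(* An infinite conjugate gives the factor [exp (- oo) = 0], so the corresponding term of the
   seminorm vanishes. *)
by rewrite gt0_muley ?lte_fin //= mul0e lee_fin.
Qed.

Lemma dw_add ws f g : smooth f -> smooth g ->
  dw ws (fun x => f x + g x) = fun x => dw ws f x + dw ws g x.
Proof.
move=> sf sg; elim: ws => //= j ws IH; rewrite -/(dw ws _) IH.
by apply: partialD; apply: smooth_derivable; exact: smooth_dw.
Qed.

Lemma dbound_add l a b f g x : smooth f -> smooth g -> dbound l a f x -> dbound l b g x ->
  dbound l (a + b) (fun x => f x + g x) x.
Proof.
move=> sf sg fa gb ws M sws hM; rewrite dw_add // mulrDl.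
by apply: (le_trans (cmodD _ _)); apply: lerD; [exact: fa|exact: gb].
Qed.

Lemma smoothB f g : smooth f -> smooth g -> smooth (fun x => f x - g x).
Proof.
move=> sf sg.
have -> : (fun x => f x - g x) = fun x => f x + mulop (fun=> -1) g x.
  by apply/funext => x; rewrite /mulop mulN1r.
by apply: smoothD => //; apply: smoothM => //; exact: smooth_cst.
Qed.

Lemma O_M_omegaE f : O_M_omega w f <-> OMspace w f.
Proof.
split=> [[sf hf]|[sf hf]]; split => //.
  (* An integer above [l] suffices, as [ub l] implies [ub m] for [l <= m]. *)
  move=> l l0; pose m := Num.bound l.
  have hm : l < m%:R by apply: archi_boundP; exact: ltW.
  have m0 : (0 < m)%N by rewrite -(ltr_nat R); exact: lt_trans hm.
  have [C [n [C0 n0 hC]]] := hf m m0; exists n%:R => //; exists C => [|x ws M sws hM].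
    exact: ltW.
  have [alpha Ea E] := @dw_dmulti R N ws sws.
  have mR : 0 < m%:R :> R by rewrite ltr0n.
  have [p Ep pM] := ub_young_conj mR (ub_le hw (ltW hm) hM).
  have := hC alpha x; rewrite Ea Ep -[(_ + _)%E]/((n%:R * om x + m%:R * p)%:E) /= lee_fin -E => /le_trans; apply.
  by rewrite expRD mulrA ler_wpM2l // mulr_ge0 ?expR_ge0 // ltW.
move=> m m0; have mR : 0 < m%:R :> R by rewrite ltr0n.
have [n n0 [C C0 hC]] := hf _ mR; have hn := archi_boundP n0.
(* Both increments serve the strict positivity demanded in [O_M_omega]. *)
exists (C + 1), (Num.bound n).+1; split => //; first lra.
move=> alpha x; have [ws [sws Ews E]] := @dmulti_dw R N alpha.
rewrite -Ews E; have := @young_conj_ge0 ((size ws)%:R / m%:R).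
case Ey : (young_conj _ _) => [p||] // _; last first.
  (* With an infinite conjugate the right-hand side is infinite. *)
  by rewrite gt0_muley ?lte_fin // addey //= gt0_muley ?leey // lte_fin; lra.
rewrite -[X in expeR X]/(((Num.bound n).+1%:R * om x + m%:R * p)%:E) /= lee_fin.
apply: (le_trans (hC x ws _ sws (young_conj_ub mR Ey))).
rewrite expRD mulrA ler_wpM2r ?expR_ge0 //; apply: ler_pM; rewrite ?expR_ge0 //; first lra.
rewrite ler_expR ler_wpM2r //; first exact: om_ge0.
by rewrite -natr1; lra.
Qed.

Lemma OM_q_norm f (m n : nat) : OMspace w f -> (0 < m)%N -> (0 < n)%N ->
  exists (m' n' : nat) (C : R), [/\ (0 < m')%N, (0 < n')%N, 0 <= C & forall g c, smooth g -> 0 <= c ->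
    (q_norm w m'%:R n'%:R g <= c%:E)%E -> (q_norm w m%:R n%:R (mulop f g) <= (C * c)%:E)%E].
Proof.
move=> hf m0 n0; have mR : 0 < m%:R :> R by rewrite ltr0n.
have nR : 0 < n%:R :> R by rewrite ltr0n.
have [l' [m' [C [l'0 m'0 C0 hC]]]] := OM_mul hw hf mR nR.
have hl := archi_boundP (ltW l'0); have hm := archi_boundP (ltW m'0).
have bl : 0 < (Num.bound l')%:R :> R by exact: lt_trans hl.
have bm : 0 < (Num.bound m')%:R :> R by exact: lt_trans hm.
exists (Num.bound l'), (Num.bound m'), C; split; rewrite -?(ltr_nat R) //.
move=> g c sg c0 /(q_norm_dbound _ _ bl c0) hg.
apply/q_norm_dbound => //; first by rewrite mulr_ge0.
apply: hC => // x; apply: (dbound_le hw) (hg x); first exact: ltW.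
by rewrite ler_wpM2l // ler_expR lerN2 ler_wpM2r ?(ltW hm) //; exact: om_ge0.
Qed.

Lemma S_space_nbhs (m n : nat) (e : R) (g : S_space N w) : (0 < m)%N -> (0 < n)%N -> 0 < e ->
  nbhs g (q_ball m n e g).
Proof.
move=> m0 n0 e0; rewrite nbhsE; exists (q_ball m n e g) => //; split.
  exists [set q_ball m n e g]; last by rewrite bigcup_set1.
  move=> _ ->; apply: (@finI_from1 _ _ (@q_subbase R N w) id).
  by exists m, n, e, g.
rewrite /q_ball /=; have -> : (fun x => sval g x - sval g x) = fun=> 0.
  by apply/funext => x; rewrite subrr.
have mR : 0 < m%:R :> R by rewrite ltr0n.
apply: (@le_lt_trans _ _ 0%:E); last by rewrite lte_fin.
apply/q_norm_dbound => // x ws M _ _; rewrite dw_cst; have -> : (if ws is [::] then 0 else 0) = 0 :> R[i] by case: ws.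
by rewrite cmod0 !mul0r.
Qed.

(** Neighbourhoods are finite intersections of subbasic balls. Their centres [g] are arbitrary, so
    balls not centred at [F h] have to be treated. *)
Lemma S_space_continuous (F : S_space N w -> S_space N w) :
  (forall (m n : nat) (e : R) (g h : S_space N w), (0 < m)%N -> (0 < n)%N -> 0 < e ->
    q_ball m n e g (F h) -> nbhs h (F @^-1` q_ball m n e g)) -> continuous F.
Proof.
move=> hF h A; rewrite nbhsE => -[B [[D sD DB] BF] BA].
move: BF; rewrite -DB => -[E DE EF].
have [T sT TE] := sD _ DE.
suff : nbhs h (F @^-1` E).
  by apply: filterS => k Ek; apply: BA; rewrite -DB; exists E.
rewrite -TE preimage_bigcap; apply: filter_bigI => U UT.
have := sT _ UT; rewrite inE => -[m [n [e [g [m0 n0 e0 UE]]]]].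
have UF : U (F h) by move: EF; rewrite -TE; apply.
by move: UF; rewrite UE; exact: hF.
Qed.

End seminorms.

Theorem theorem4p4 (R : realType) (N : nat) (hN : (0 < N)%N) (w : R -> R)
    (hw : nonquasianalytic_weight w)
    (f : 'rV[R]_N -> R[i]) (hf : smooth f) :
  (O_M_omega w f <->
   (forall g : 'rV[R]_N -> R[i], S_omega w g -> S_omega w (mulop f g))) /\
  (O_M_omega w f ->
   linear (mulop f) /\
   exists M : S_space N w -> S_space N w,
     (forall g : S_space N w, sval (M g) = mulop f (sval g)) /\
     continuous M).
Proof.
split; first split=> [/(O_M_omegaE hw) hO g /(S_omegaE hw hN) hg|hM].
- by apply/(S_omegaE hw hN); exact: (OM_Q hw hO hg).
- apply/(O_M_omegaE hw); apply: (multiplier_OM hw hN) => // g /(S_omegaE hw hN) hg.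
  by apply/(S_omegaE hw hN); exact: hM.
move=> /(O_M_omegaE hw) hO; split.
  move=> a u v; apply/funext => x.
  rewrite /mulop -[(a *: u + v) x]/(a * u x + v x) -[RHS]/(a * (f x * u x) + f x * v x).
  by ring.
have hS (g : S_space N w) : S_omega w (mulop f (sval g)).
  by apply/(S_omegaE hw hN); apply: (OM_Q hw hO); apply/(S_omegaE hw hN); exact: svalP.
exists (fun g => exist _ _ (hS g)); split => //.
have ss (g : S_space N w) : smooth (sval g) by case: (svalP g).
apply: S_space_continuous => m n e g h m0 n0 e0; rewrite /q_ball /= => he.
have mR : 0 < m%:R :> R by rewrite ltr0n.
have [m' [n' [C [m'0 n'0 C0 hC]]]] := OM_q_norm hw hO m0 n0.
have q0 := q_norm_ge0 w m%:R n%:R (fun x => mulop f (sval h) x - sval g x).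
have qf : q_norm w m%:R n%:R (fun x => mulop f (sval h) x - sval g x) \is a fin_num.
  by rewrite ge0_fin_numE //; apply: lt_trans he _; exact: ltry.
pose a := fine (q_norm w m%:R n%:R (fun x => mulop f (sval h) x - sval g x)).
have a0 : 0 <= a by exact: fine_ge0.
have ae : a < e by rewrite -lte_fin fineK.
(* [e - a] is the room that [f h] leaves inside the ball around [g]; the denominator [C + 1] is
   positive and makes [C * d] smaller than this room. *)
pose d := (e - a) / (C + 1); have d0 : 0 < d by rewrite divr_gt0; lra.
apply: filterS (S_space_nbhs hw h m'0 n'0 d0) => k; rewrite /q_ball /= => hk.
have sk : smooth (fun x => sval k x - sval h x) by exact: smoothB.
have h1 := hC _ d sk (ltW d0) (ltW hk).
have sfh : smooth (fun x => mulop f (sval h) x - sval g x).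
  by apply: smoothB => //; exact: smoothM.
have Cd : 0 <= C * d by rewrite mulr_ge0 // ltW.
apply: (@le_lt_trans _ _ (C * d + a)%:E).
  have -> : (fun x => mulop f (sval k) x - sval g x) =
      fun x => mulop f (fun x => sval k x - sval h x) x + (mulop f (sval h) x - sval g x).
    by apply/funext => x; rewrite /mulop; ring.
  apply/(q_norm_dbound hw _ _ mR (addr_ge0 Cd a0)) => x; rewrite mulrDl.
  apply: dbound_add => //; first exact: smoothM.
    exact: ((q_norm_dbound hw _ _ mR Cd).1 h1).
  by apply: ((q_norm_dbound hw _ _ mR a0).1 _ x); rewrite fineK.
rewrite lte_fin.
have : d * (C + 1) = e - a by rewrite /d divfK //; lra.
lra.
Qed.
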